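(* Let $1<p<\infty$ and let $\omega\in\mathcal R$ be such that its Bergman kernel $B^\omega_z$ admits the representation $$B^\omega_z(\zeta)=\frac{1}{(1-\overline{z}\zeta)^\gamma}\int_0^1\frac{d\nu(r)}{1-r\overline{z}\zeta},\qquad z,\zeta\in\mathbb D,$$ for some $\gamma\ge1$ and a positive measure $\nu$ supported on $[0,1]$. For an $\omega$-weight $v$, the following statements are equivalent: (i) $P^+_\omega:L^p_\omega(v)\to L^p_\omega(v)$ is bounded; (ii) $P_\omega:L^p_\omega(v)\to L^p_\omega(v)$ is bounded; (iii) $P_\omega:L^p_\omega(v)\to L^{p,\infty}_\omega(v)$ is bounded; (iv) $v\in B_{p,\omega}$. Moreover, $$\left\|P^+_\omega\right\|_{L^p_\omega(v)\to L^p_\omega(v)}\le C\,B_{p,\omega}(v)^{\max\left\{1,\frac1{p-1}\right\}}$$ for a constant $C>0$ depending only on $p$ and $\omega$ (and not on $v$).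
   Context: $\mathbb D$ is the open unit disc. For a positive Borel measure $\omega$ on $[0,1)$, $\widehat\omega(r)=\int_r^1d\omega$ and $\omega\otimes m$ is the measure on $\mathbb D$ with $d(\omega\otimes m)(re^{i\theta})=r\,d\omega(r)\,d\theta$. A finite non-zero positive Borel measure $\omega$ on $[0,1)$ belongs to $\mathcal R$ if there exist $C>0$ and $0<\gamma_0\le\beta_0$ (depending on $\omega$) such that $C^{-1}\left(\frac{1-r}{1-t}\right)^{\gamma_0}\widehat\omega(t)\le\widehat\omega(r)\le C\left(\frac{1-r}{1-t}\right)^{\beta_0}\widehat\omega(t)$ for all $0\le r\le t<1$. $A^2_\omega$ is the space of analytic functions $f$ in $\mathbb D$ with $\int_{\mathbb D}|f|^2d(\omega\otimes m)<\infty$; for $\omega\in\mathcal R$ it is a Hilbert space with bounded point evaluations, and $B^\omega_z$ is its reproducing kernel: $f(z)=\int_{\mathbb D}f(\zeta)\overline{B^\omega_z(\zeta)}\,d(\omega\otimes m)(\zeta)$, $f\in A^2_\omega$. The Bergman projection and maximal Bergman projection are $$P_\omega(f)(z)=\int_{\mathbb D}f(\zeta)\overline{B^\omega_z(\zeta)}\,d(\omega\otimes m)(\zeta),\qquad P^+_\omega(f)(z)=\int_{\mathbb D}f(\zeta)|B^\omega_z(\zeta)|\,d(\omega\otimes m)(\zeta).$$ An $\omega$-weight is a positive $(\omega\otimes m)$-integrable function $v$ on $\mathbb D$. $L^p_\omega(v)$ is the space with norm $\|f\|_{L^p_\omega(v)}^p=\int_{\mathbb D}|f|^pv\,d(\omega\otimes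 m)$, and $L^{p,\infty}_\omega(v)$ is the corresponding weak space, so that (iii) means $\lambda^p\,(v\omega)(\{z:|P_\omega(f)(z)|>\lambda\})\le C\|f\|^p_{L^p_\omega(v)}$ for all $\lambda>0$ and $f\in L^p_\omega(v)$. For a non-negative function $h$ write $(h\omega)(E)=\int_E h\,d(\omega\otimes m)$ and $\omega(E)=(\omega\otimes m)(E)$. For an arc $I\subset\mathbb T$ with normalized arc-length $|I|$, the Carleson square is $S(I)=\{re^{i\theta}:1-|I|\le r<1,\ e^{i\theta}\in I\}$. With $\frac1p+\frac1{p'}=1$, $v\in B_{p,\omega}$ means $$B_{p,\omega}(v)=\sup_S\frac{(v\omega)(S)}{\omega(S)}\left(\frac{\left(v^{-p'/p}\omega\right)(S)}{\omega(S)}\right)^{p/p'}<\infty,$$ the supremum being over all Carleson squares $S$. *)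

(* Defs.v *)
From HB Require Import structures.
From mathcomp Require Import all_boot all_order all_algebra.
From mathcomp Require Import all_classical all_reals all_analysis.
From mathcomp Require Import measurable_realfun complex.

Set Implicit Arguments.
Unset Strict Implicit.
Unset Printing Implicit Defensive.

Import Order.TTheory GRing.Theory Num.Theory.
Import numFieldNormedType.Exports.

Local Open Scope classical_set_scope.
Local Open Scope complex_scope.
Local Open Scope ring_scope.

(** R[i] carries the Borel sigma-algebra of the plane, transported along
    z |-> (Re z, Im z). *)
HB.instance Definition _ (R : realType) := isPointed.Build R[i] 0.

Definition complex_coord (R : realType) (z : R[i]) : R * R :=
  (complex.Re z, complex.Im z).

HB.instance Definition _ (R : realType) :=
  Measurable.copy R[i] (g_sigma_algebra_preimageType (@complex_coord R)).

Section Complex.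
Context {R : realType}.

Definition disc : set R[i] := [set z | `|z| < 1].

(** The norm of R[i] takes its values in R[i]; [cabs] is the modulus in R. *)
Definition cabs (z : R[i]) : R := complex.Re `|z|.

Definition expi (t : R) : R[i] := cos t +i* sin t.

(** Principal branch of w ^ g on the half-plane Re w > 0, where the principal
    argument is atan (Im w / Re w); only used with w = 1 - z^* * u for z, u in
    the unit disc. *)
Definition cpow (w : R[i]) (g : R) : R[i] :=
  (cabs w `^ g)%:C * expi (g * atan (complex.Im w / complex.Re w)).

(** Complex differentiability (over the field R[i]) at every point of the
    disc. *)
Definition analytic_disc (f : R[i] -> R[i]) : Prop :=
  forall z, disc z -> derivable (f : R[i]^o -> R[i]^o) z 1.

Definition cintegrable d (T : measurableType d) (mu : {measure set T -> \bar R})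
    (D : set T) (f : T -> R[i]) : Prop :=
  mu.-integrable D (fun x => (complex.Re (f x))%:E) /\
  mu.-integrable D (fun x => (complex.Im (f x))%:E).

Definition cintegral d (T : measurableType d) (mu : {measure set T -> \bar R})
    (D : set T) (f : T -> R[i]) : R[i] :=
  Rintegral mu D (fun x => complex.Re (f x)) +i*
  Rintegral mu D (fun x => complex.Im (f x)).

End Complex.

Section PolarMeasure.
Context {R : realType}.

Local Notation mR := (measurableTypeR R).

Definition polar (x : mR * mR) : R[i] := (x.1 : R)%:C * expi x.2.

Lemma measurable_polar : measurable_fun setT polar.
Proof.
have m1 : measurable_fun setT (fun x : mR * mR => x.1 : R).
  exact: (measurable_fst (T1 := mR) (T2 := mR)).
have m2 : measurable_fun setT (fun x : mR * mR => x.2 : R).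
  exact: (measurable_snd (T1 := mR) (T2 := mR)).
have mr : measurable_fun setT (fun x : mR * mR => (x.1 : R) * cos x.2).
  apply: measurable_funM => //; apply: (measurableT_comp (f := @cos R)) => //.
  by apply: continuous_measurable_fun; exact: continuous_cos.
have mi : measurable_fun setT (fun x : mR * mR => (x.1 : R) * sin x.2).
  apply: measurable_funM => //; apply: (measurableT_comp (f := @sin R)) => //.
  by apply: continuous_measurable_fun; exact: continuous_sin.
move=> _ _ [B mB <-]; rewrite !setTI.
have := measurable_fun_pair mr mi measurableT mB; rewrite setTI.
suff -> : (fun x : mR * mR => ((x.1 : R) * cos x.2, (x.1 : R) * sin x.2)) =
          @complex_coord R \o polar by [].
by apply/funext => -[r t]; rewrite /complex_coord /polar /expi /=;
  congr pair; rewrite mul0r ?subr0 ?addr0.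
Qed.

Variable om : {finite_measure set (measurableTypeR R) -> \bar R}.

(** d(om (x) m)(r e^{it}) = r d om(r) dt, with 0 <= r < 1 and 0 <= t < 2 pi. *)
Definition polar_measure (A : set R[i]) : \bar R :=
  \int[(om \x lebesgue_measure)%E]_(x in
    (`[0, 1[ `*` `[0, 2 * pi[) `&` polar @^-1` A) ((x.1 : R)%:E).

Let polar_measure0 : polar_measure set0 = 0%E.
Proof. by rewrite /polar_measure preimage_set0 setI0 integral_set0. Qed.

Let polar_measure_ge0 A : (0 <= polar_measure A)%E.
Proof.
by apply: integral_ge0 => -[r t] [[]]/=; rewrite in_itv/= => /andP[? _] _ _;
  rewrite lee_fin.
Qed.

Let polar_measure_semi_sigma_additive : semi_sigma_additive polar_measure.
Proof.
move=> F mF tF mUF; rewrite /polar_measure.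
have mP k : measurable (polar @^-1` F k).
  by rewrite -[X in measurable X]setTI; exact: measurable_polar.
apply: cvg_toP.
  apply: ereal_nondecreasing_is_cvgn => m n mn.
  by apply: lee_sum_nneg_natr => // k _ _; exact: polar_measure_ge0.
rewrite preimage_bigcup setI_bigcupr ge0_integral_bigcup//=.
- move=> k; apply: measurableI => //.
  by apply: measurableX; exact: measurable_itv.
- by apply/measurable_funTS/measurable_EFinP; exact: measurable_fst.
- move=> -[r t] [k _ [[/= + _] _]]; rewrite in_itv/= => /andP[r0 _].
  by rewrite lee_fin.
- apply/trivIsetP => i j _ _ ij; rewrite setIACA setIid -preimage_setI.
  by move/trivIsetP : tF => /(_ i j I I ij) ->; rewrite preimage_set0 setI0.
Qed.

HB.instance Definition _ := isMeasure.Build _ R[i] R polar_measure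
  polar_measure0 polar_measure_ge0 polar_measure_semi_sigma_additive.

End PolarMeasure.

Section Weights.
Context {R : realType}.
Implicit Types (om : {finite_measure set (measurableTypeR R) -> \bar R}) (p : R).

Definition tail om (r : R) : \bar R := om [set` `[r, 1[].

(** A measure on [0, 1) is a measure on R for which the complement of [0, 1)
    is null. *)
Definition class_R om : Prop :=
  [/\ om (~` [set` `[0, 1[]) = 0%E, om [set` `[0, 1[] <> 0%E &
    exists C g0 b0 : R, [/\ 0 < C, 0 < g0, g0 <= b0 &
      forall r t : R, 0 <= r -> r <= t -> t < 1 ->
        ((C^-1 * ((1 - r) / (1 - t)) `^ g0)%:E * tail om t <= tail om r)%E /\
        (tail om r <= (C * ((1 - r) / (1 - t)) `^ b0)%:E * tail om t)%E]].

(** Below, [mu] stands for [polar_measure om]. *)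
Implicit Types (mu : {measure set R[i] -> \bar R}) (v : R[i] -> R).
Implicit Types (f g : R[i] -> R[i]) (B K : R[i] -> R[i] -> R[i]).

Definition bergman_space mu f : Prop :=
  analytic_disc f /\ (\int[mu]_(z in disc) ((cabs (f z) ^+ 2)%:E) < +oo)%E.

(** [B z u] is the value at u of the kernel B_z. *)
Definition is_bergman_kernel mu B : Prop :=
  forall z, disc z -> bergman_space mu (B z) /\
    forall f, bergman_space mu f ->
      f z = cintegral mu disc (fun u => f u * (B z u)^*).

(** Absolute convergence at z = 0 forces [nu] to be finite. *)
Definition admits_representation B : Prop :=
  exists (g : R) (nu : {measure set (measurableTypeR R) -> \bar R}),
    [/\ 1 <= g, nu (~` [set` `[0, 1]]) = 0%E &
      forall z u, disc z -> disc u ->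
        cintegrable nu [set` `[0, 1]] (fun r => (1 - r%:C * z^* * u)^-1) /\
        B z u = (cpow (1 - z^* * u) g)^-1 *
                cintegral nu [set` `[0, 1]] (fun r => (1 - r%:C * z^* * u)^-1)].

Definition is_weight mu v : Prop :=
  (forall z, disc z -> 0 < v z) /\ mu.-integrable disc (fun z => (v z)%:E).

Definition lpnorm mu p v f : \bar R :=
  ((\int[mu]_(z in disc) ((cabs (f z) `^ p * v z)%:E)) `^ p^-1)%E.

Definition in_lp mu p v f : Prop :=
  measurable_fun disc f /\ (lpnorm mu p v f < +oo)%E.

Definition integral_op mu K f (z : R[i]) : R[i] :=
  cintegral mu disc (fun u => f u * K z u).

Definition op_defined mu K f : Prop :=
  forall z, disc z -> cintegrable mu disc (fun u => f u * K z u).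

(** The kernels of the Bergman projection and of the maximal Bergman
    projection. *)
Definition proj_kernel B z u : R[i] := (B z u)^*.
Definition max_proj_kernel B z u : R[i] := `|B z u|.

(** Boundedness of an operator on L^p includes that it is defined there, i.e.
    that the defining integrals converge absolutely. *)
Definition strong_bound mu K p v (M : R) : Prop :=
  0 <= M /\ forall f, in_lp mu p v f ->
    [/\ op_defined mu K f, in_lp mu p v (integral_op mu K f) &
      (lpnorm mu p v (integral_op mu K f) <= M%:E * lpnorm mu p v f)%E].

Definition strong_bounded mu K p v : Prop := exists M, strong_bound mu K p v M.

Definition weak_bounded mu K p v : Prop :=
  exists C : R, 0 <= C /\ forall f, in_lp mu p v f ->
    [/\ op_defined mu K f, measurable_fun disc (integral_op mu K f) &
      forall l : R, 0 < l ->
        ((l `^ p)%:E *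
          \int[mu]_(z in disc `&` [set z | (l < cabs (integral_op mu K f z))%R])
            (v z)%:E
         <= C%:E * lpnorm mu p v f `^ p)%E].

(** Equal to +oo if the operator is not bounded. *)
Definition op_norm mu K p v : \bar R :=
  ereal_inf [set M%:E | M in strong_bound mu K p v].

(** The closed arc of normalized length l starting at e^{ia}. *)
Definition circle_arc (a l : R) : set R[i] := [set expi t | t in `[a, a + 2 * pi * l]].

Definition carleson (a l : R) : set R[i] :=
  [set r%:C * u | r in `[1 - l, 1[ & u in circle_arc a l].

Definition conj_exp p : R := (1 - p^-1)^-1.

Definition bekolle mu p v : \bar R :=
  let q := conj_exp p in
  ereal_sup [set
    ((\int[mu]_(z in S) (v z)%:E) / mu S *
     ((\int[mu]_(z in S) (v z `^ (- (q / p)))%:E) / mu S) `^ (p / q))%E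
    | S in [set S | exists a l, [/\ 0 < l, l <= 1 & S = carleson a l]]].

Definition bekolle_class mu p v : Prop := (bekolle mu p v < +oo)%E.

End Weights.

(* Main.v *)
Require Import Defs.
From HB Require Import structures.
From mathcomp Require Import all_boot all_order all_algebra.
From mathcomp Require Import all_classical all_reals all_analysis.
From mathcomp Require Import measurable_realfun complex ring lra zify.

(** The proof compares the Bergman kernel with averages over Carleson squares.

    Size of the kernel. The integral in the representation has no cancellation,
    as its integrand stays in a quadrant, so that |B_z(u)| is comparable with a
    nonincreasing function Phi of x = |1 - z^* u| (lemmas [cabs_bergman_le] and
    [cabs_bergman_ge]). The identity B_a(a) = ||B_a||^2 and its extremal
    characterization, tested on a power of 1 / (1 - a u), show that Phi(x) is
    comparable with 1 / (x W(x)), where W(x) is the mass of [1 - x, 1[, that is,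
    with the inverse mass of a Carleson square of side x ([kernel_size_le_mass],
    [kernel_size_ge_mass]).

    From the testing condition to the maximal projection. Two points of the disc
    always share a box of side comparable with |1 - z^* u| in one of two grids
    shifted by a third of a turn ([common_box]); hence the maximal projection is
    dominated by two sparse operators, the averages [avg] over the boxes of each
    grid ([max_op_domination]). For such an average A, the integral of A^p v is
    a bilinear form in f and A^(p-1) v. The testing condition on a box, together
    with Hoelder's inequality on its top part, whose mass is a fixed share of the
    mass of the box, bounds each term of the form by Q^max(1, 1/(p-1)) times
    quantities carried by the top part ([node_bound]), Q being the constant of
    the weight. As the top parts are disjoint, Carleson's embedding theorem, for
    the weight and for its dual, sums them up ([tree_embedding],
    [sparse_form_self]). This gives the norm estimate with the stated exponent
    ([avg_bound], [max_op_bound]).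

    From the maximal projection to the weak-type bound one passes by pointwise
    domination and by Chebyshev's inequality.

    From the weak-type bound to the testing condition. If |1 - z^* u| is large
    compared with the variation of z^* u over Z x E, then the kernel is almost
    constant there, including its argument ([kernel_osc]), so that the projection
    of a positive function on E is bounded below on Z ([proj_lower]). Testing on
    the constants and on truncations of the dual weight, with for Z and E a small
    square and a translate of it, in both orders, gives the condition on small
    squares ([far_squares], [weak_bounded_bekolle]). On large squares it follows
    from the integrability of the dual weight, obtained by testing on small cells
    against squares on the opposite side of the disc ([weak_dual_integrable]). *)

Set Implicit Arguments.
Unset Strict Implicit.
Unset Printing Implicit Defensive.

Import Order.TTheory GRing.Theory Num.Theory.
Import numFieldNormedType.Exports.

Local Open Scope classical_set_scope.
Local Open Scope complex_scope.
Local Open Scope ring_scope.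


(** * The modulus and the polar form of complex numbers *)

Section Modulus.
Context {R : realType}.
Implicit Types z u w : R[i].

Lemma cabsE z : cabs z = Num.sqrt (complex.Re z ^+ 2 + complex.Im z ^+ 2).
Proof. by rewrite /cabs normc_def. Qed.

Lemma norm_cabs z : `|z| = (cabs z)%:C.
Proof. by rewrite /cabs normc_def. Qed.

Lemma cabs_ge0 z : 0 <= cabs z.
Proof. by rewrite cabsE sqrtr_ge0. Qed.

Lemma sqr_cabs z : cabs z ^+ 2 = complex.Re z ^+ 2 + complex.Im z ^+ 2.
Proof. by rewrite cabsE sqr_sqrtr// addr_ge0// sqr_ge0. Qed.

Lemma cabsM z w : cabs (z * w) = cabs z * cabs w.
Proof.
by apply: complexI; rewrite -norm_cabs normrM !norm_cabs rmorphM.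
Qed.

Lemma cabsV z : cabs z^-1 = (cabs z)^-1.
Proof. by apply: complexI; rewrite -norm_cabs normfV norm_cabs fmorphV. Qed.

Lemma cabsX z n : cabs (z ^+ n) = cabs z ^+ n.
Proof. by apply: complexI; rewrite -norm_cabs normrX norm_cabs rmorphXn. Qed.

Lemma cabsN z : cabs (- z) = cabs z.
Proof. by rewrite /cabs normrN. Qed.

Lemma cabsBC z w : cabs (z - w) = cabs (w - z).
Proof. by rewrite /cabs distrC. Qed.

Lemma cabs0 : cabs (0 : R[i]) = 0.
Proof. by rewrite /cabs normr0. Qed.

Lemma cabs1 : cabs (1 : R[i]) = 1.
Proof. by rewrite /cabs normr1. Qed.

Lemma cabs_conj z : cabs z^* = cabs z.
Proof. by rewrite /cabs normcJ. Qed.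

Lemma cabs_real (x : R) : cabs x%:C = `|x|.
Proof. by rewrite cabsE /= expr0n addr0 sqrtr_sqr. Qed.

Lemma cabs_cabs z : cabs (cabs z)%:C = cabs z.
Proof. by rewrite cabs_real ger0_norm// cabs_ge0. Qed.

Lemma cabs_eq0 z : (cabs z == 0) = (z == 0).
Proof.
rewrite -(normr_eq0 z) norm_cabs; apply/eqP/eqP => [->//|].
by move/complexI.
Qed.

Lemma cabs_gt0 z : (0 < cabs z) = (z != 0).
Proof. by rewrite lt_neqAle cabs_ge0 andbT eq_sym cabs_eq0. Qed.

Lemma cabsD z w : cabs (z + w) <= cabs z + cabs w.
Proof. by rewrite -lecR rmorphD /= -!norm_cabs ler_normD. Qed.

Lemma cabsB z w : cabs (z - w) <= cabs z + cabs w.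
Proof. by rewrite (le_trans (cabsD _ _))// cabsN. Qed.

Lemma cabs_dist z w : cabs z - cabs w <= cabs (z - w).
Proof. by rewrite lerBlDr -{1}(subrK w z) cabsD. Qed.

Lemma Re_le_cabs z : `|complex.Re z| <= cabs z.
Proof. by rewrite cabsE -sqrtr_sqr ler_sqrt ?lerDl ?addr_ge0 ?sqr_ge0. Qed.

Lemma Im_le_cabs z : `|complex.Im z| <= cabs z.
Proof. by rewrite cabsE -sqrtr_sqr ler_sqrt ?lerDr ?addr_ge0 ?sqr_ge0. Qed.

Lemma cabs_le_ReIm z : cabs z <= `|complex.Re z| + `|complex.Im z|.
Proof.
rewrite cabsE -(@ler_pXn2r _ 2) ?nnegrE ?sqrtr_ge0 ?addr_ge0 ?normr_ge0//.
rewrite sqr_sqrtr ?addr_ge0 ?sqr_ge0// sqrrD !real_normK ?num_real//.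
rewrite -subr_ge0 (_ : _ - _ = `|complex.Re z| * `|complex.Im z| *+ 2).
  by rewrite mulrn_wge0 // mulr_ge0.
ring.
Qed.

Lemma discE z : disc z <-> cabs z < 1.
Proof. by rewrite /disc /= norm_cabs ltcR. Qed.

Lemma cabs_expi t : cabs (expi t : R[i]) = 1.
Proof. by rewrite cabsE /= cos2Dsin2 sqrtr1. Qed.

Lemma expiD s t : expi (s + t) = expi s * expi t :> R[i].
Proof. by rewrite /expi cosD sinD; congr Complex; ring. Qed.

Lemma expi0 : expi 0 = 1 :> R[i].
Proof. by rewrite /expi cos0 sin0. Qed.

Lemma expiN t : expi (- t) = (expi t)^* :> R[i].
Proof. by rewrite /expi cosN sinN. Qed.

Lemma conj_expi t : (expi t)^* = (expi t)^-1 :> R[i].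
Proof.
have e0 : expi t != 0 :> R[i] by rewrite -cabs_eq0 cabs_expi oner_eq0.
by apply: (mulIf e0); rewrite mulVf// -expiN -expiD addNr expi0.
Qed.

Lemma expiDn t n : expi (t + (2 * pi) *+ n) = expi t :> R[i].
Proof.
have e : 2 * pi = pi *+ 2 :> R by rewrite mulr_natl.
by rewrite /expi e (periodicn (@cosD2pi R)) (periodicn (@sinD2pi R)).
Qed.

Lemma expiDz t (n : int) : expi (t + 2 * pi * n%:~R) = expi t :> R[i].
Proof.
case: n => n; first by rewrite -[in LHS]pmulrn mulr_natr expiDn.
rewrite NegzE mulrNz -[in LHS]pmulrn mulrN mulr_natr.
by rewrite -[in RHS](subrK ((2 * pi) *+ n.+1) t) expiDn.
Qed.

Lemma ReM z w : complex.Re (z * w) =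
  complex.Re z * complex.Re w - complex.Im z * complex.Im w.
Proof. by case: z; case: w. Qed.

Lemma ImM z w : complex.Im (z * w) =
  complex.Re z * complex.Im w + complex.Im z * complex.Re w.
Proof. by case: z => a b; case: w => c d /=. Qed.

Lemma ReD z w : complex.Re (z + w) = complex.Re z + complex.Re w.
Proof. by case: z; case: w. Qed.

Lemma ImD z w : complex.Im (z + w) = complex.Im z + complex.Im w.
Proof. by case: z => a b; case: w => c d /=. Qed.

Lemma ReV z : complex.Re z^-1 = complex.Re z / cabs z ^+ 2.
Proof. by rewrite sqr_cabs; case: z. Qed.

Lemma ImV z : complex.Im z^-1 = - complex.Im z / cabs z ^+ 2.
Proof. by rewrite sqr_cabs; case: z => a b /=; rewrite mulNr. Qed.

End Modulus.


Section Trigonometry.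
Context {R : realType}.
Implicit Types x y : R.

Lemma sin_lipschitz x y : `|sin x - sin y| <= `|x - y|.
Proof.
wlog yx : x y / y <= x.
  move=> H; case: (leP y x) => [|/ltW] /H//.
  by rewrite (distrC x) (distrC (sin x)).
have [|c _ ->] := @MVT_segment _ (@sin R) (@cos R) y x yx.
  by apply: continuous_subspaceT => z; exact: continuous_sin.
by rewrite normrM ler_piMl ?normr_ge0// cos_max.
Qed.

Lemma cos_lipschitz x y : `|cos x - cos y| <= `|x - y|.
Proof.
rewrite -2!sinDpihalf; apply: le_trans (sin_lipschitz _ _) _.
by rewrite opprD addrACA subrr addr0.
Qed.

(** A weak form of Jordan's inequality: the mean value theorem up to pi / 4,
    monotonicity beyond. *)
Lemma sin_ge_quarter x : 0 <= x <= pi / 2 -> x / 4 <= sin x.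
Proof.
move=> /andP[x0 xp]; have p0 := @pi_gt0 R.
have h4 : cos (pi / 4) ^+ 2 = 2^-1 :> R.
  have := cos_mulr2n (pi / 4 : R); rewrite (_ : pi / 4 *+ 2 = pi / 2); last by field.
  by rewrite cos_pihalf => h; lra.
have c4 : 2^-1 <= cos (pi / 4) :> R.
  have c0 : 0 < cos (pi / 4) :> R by apply: cos_gt0_pihalf; apply/andP; split; lra.
  rewrite leNgt; apply/negP => h.
  have : cos (pi / 4) ^+ 2 < 2^-1 * 1 :> R by rewrite expr2; apply: ltr_pM; lra.
  by rewrite h4; lra.
have s4 : 2^-1 <= sin (pi / 4) :> R.
  suff <- : cos (pi / 4) = sin (pi / 4) :> R by [].
  rewrite -sinDpihalf (_ : pi / 4 + pi / 2 = - (pi / 4) + pi); last by field.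
  by rewrite sinDpi sinN opprK.
have [x4|x4] := leP x (pi / 4).
  have [|c] := @MVT_segment _ (@sin R) (@cos R) 0 x x0.
    by apply: continuous_subspaceT => z; exact: continuous_sin.
  rewrite in_itv/= sin0 !subr0 => /andP[c0 cx] ->.
  have : cos (pi / 4) <= cos c.
    by rewrite leNgt ltr_cos ?in_itv/= -?leNgt; [lra|apply/andP; split; lra..].
  move=> h; rewrite mulrC ler_wpM2r//; lra.
have : sin (pi / 4) <= sin x.
  by rewrite leNgt ltr_sin ?in_itv/= -?leNgt; [lra|apply/andP; split; lra..].
have := @pihalf_lt2 R; lra.
Qed.

End Trigonometry.


Section Argument.
Context {R : realType}.
Implicit Types z u w : R[i].

Lemma expi_dist (s t : R) : cabs (expi s - expi t) <= 2 * `|s - t|.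
Proof.
apply: le_trans (cabs_le_ReIm _) _.
rewrite /expi /= -[- cos t]/(- cos t) mulr_natl mulr2n.
by apply: lerD; [exact: cos_lipschitz|exact: sin_lipschitz].
Qed.

(** The argument in [0, 2 pi[. The arccosine only sees the real part, hence the
    case distinction. *)
Definition arg z : R :=
  let t := acos (complex.Re z / cabs z) in
  if 0 <= complex.Im z then t else 2 * pi - t.

Lemma Re_div_cabs z : -1 <= complex.Re z / cabs z <= 1.
Proof.
rewrite -ler_norml normrM normfV (ger0_norm (cabs_ge0 z)).
have [->|z0] := eqVneq z 0; first by rewrite cabs0 invr0 mulr0 ler01.
by rewrite ler_pdivrMr ?cabs_gt0// mul1r Re_le_cabs.
Qed.

Lemma arg_itv z : 0 <= arg z < 2 * pi.
Proof.
have hz := Re_div_cabs z.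
have p0 := @pi_gt0 R; have h0 := acos_ge0 hz; have h1 := acos_lepi hz.
rewrite /arg; case: ifPn => Iz; first by apply/andP; split; lra.
suff : 0 < acos (complex.Re z / cabs z) by move=> ?; apply/andP; split; lra.
apply: acos_gt0; have /andP[-> /=] := hz; rewrite le_eqVlt => /orP[/eqP e|//].
have z0 : cabs z != 0.
  by apply/eqP => z0; move: e; rewrite z0 invr0 mulr0 => /eqP; rewrite eq_sym oner_eq0.
have {}e : complex.Re z = cabs z.
  by rewrite -[LHS](divfK z0) e mul1r.
have := sqr_cabs z; rewrite e => /eqP; rewrite -subr_eq0 opprD addrA subrr sub0r.
rewrite oppr_eq0 sqrf_eq0 => /eqP Iz0; by rewrite Iz0 lexx in Iz.
Qed.

Lemma polar_arg z : z = (cabs z)%:C * expi (arg z).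
Proof.
have [->|z0] := eqVneq z 0; first by rewrite cabs0 mul0r.
have hz := Re_div_cabs z.
have c0 : 0 < cabs z by rewrite cabs_gt0.
have hc : cos (acos (complex.Re z / cabs z)) = complex.Re z / cabs z.
  by rewrite acosK.
have hs : sin (acos (complex.Re z / cabs z)) = `|complex.Im z| / cabs z.
  rewrite sin_acos// -[X in _ = X]ger0_norm ?divr_ge0 ?cabs_ge0// -sqrtr_sqr.
  congr Num.sqrt; rewrite !expr_div_n real_normK ?num_real// sqr_cabs.
  have : complex.Re z ^+ 2 + complex.Im z ^+ 2 != 0 by rewrite -sqr_cabs sqrf_eq0 gt_eqF.
  by move=> h; field.
have c1 : cabs z != 0 by rewrite gt_eqF.
rewrite /arg /expi; case: ifPn => Iz.
  rewrite hc hs ger0_norm//; apply/eqP; rewrite eq_complex /=.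
  by apply/andP; split; apply/eqP; field.
rewrite -ltNge in Iz; rewrite mulr_natl addrC cosD2pi sinD2pi cosN sinN hc hs ltr0_norm//.
apply/eqP; rewrite eq_complex /=.
by apply/andP; split; apply/eqP; field.
Qed.

Lemma arg_polar (r t : R) : 0 < r -> 0 <= t < 2 * pi -> arg (r%:C * expi t) = t.
Proof.
move=> r0 /andP[t0 t2]; have p0 := @pi_gt0 R.
have e1 : complex.Re (r%:C * expi t) = r * cos t by rewrite /= mul0r subr0.
have e2 : complex.Im (r%:C * expi t) = r * sin t by rewrite /= mul0r addr0.
rewrite /arg e1 e2 cabsM cabs_expi mulr1 cabs_real gtr0_norm//.
rewrite mulrAC divff ?gt_eqF// mul1r pmulr_rge0//.
have [tp|tp] := leP t pi.
  by rewrite sin_ge0_pi ?t0// cosK// in_itv/= t0.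
have e : cos t = cos (2 * pi - t) by rewrite mulr_natl addrC cosD2pi cosN.
have st : sin t < 0.
  rewrite -(opprK t) sinN oppr_lt0 -(sinD2pi (- t)) -mulr_natl.
  by apply: sin_gt0_pi; apply/andP; split; lra.
rewrite leNgt st /= e cosK; first by lra.
by rewrite in_itv/=; apply/andP; split; lra.
Qed.

End Argument.


Section ComplexMeasurability.
Context {R : realType}.

Lemma measurable_Re : measurable_fun setT (@complex.Re R : R[i] -> R).
Proof.
have h : measurable_fun setT (@complex_coord R).
  by move=> _ B mB; rewrite setTI; exists B => //; rewrite setTI.
exact: (measurableT_comp (@measurable_fst _ _ R R) h).
Qed.

Lemma measurable_Im : measurable_fun setT (@complex.Im R : R[i] -> R).
Proof.
have h : measurable_fun setT (@complex_coord R).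
  by move=> _ B mB; rewrite setTI; exists B => //; rewrite setTI.
exact: (measurableT_comp (@measurable_snd _ _ R R) h).
Qed.

Context d (T : measurableType d).
Implicit Types (D : set T) (f g : T -> R[i]).

Lemma measurable_fun_complexP D f : measurable D ->
  measurable_fun D f <->
  measurable_fun D (fun x => complex.Re (f x)) /\
  measurable_fun D (fun x => complex.Im (f x)).
Proof.
move=> mD; split=> [mf|[mr mi]].
  by split; [apply: (measurableT_comp measurable_Re)|
             apply: (measurableT_comp measurable_Im)].
have mp : measurable_fun D (fun x => (complex.Re (f x), complex.Im (f x))).
  pose r := (fun x => complex.Re (f x)) \_ D.
  pose i := (fun x => complex.Im (f x)) \_ D.
  apply: (@eq_measurable_fun _ _ _ _ _ (fun x => (r x, i x))).
    by move=> x Dx; rewrite /r /i !patchE Dx.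
  apply: measurable_funTS; apply: measurable_fun_pair;
    exact/(measurable_restrictT _ mD).
move=> _ _ [B mB <-]; rewrite setTI; exact: mp.
Qed.

Lemma measurable_fun_Re D f :
  measurable_fun D f -> measurable_fun D (fun x => complex.Re (f x)).
Proof. exact: (measurableT_comp measurable_Re). Qed.

Lemma measurable_fun_Im D f :
  measurable_fun D f -> measurable_fun D (fun x => complex.Im (f x)).
Proof. exact: (measurableT_comp measurable_Im). Qed.

Lemma measurable_cabs D f : measurable D ->
  measurable_fun D f -> measurable_fun D (fun x => cabs (f x)).
Proof.
move=> mD mf; rewrite (_ : (fun x => _) = (fun x => Num.sqrt
  (complex.Re (f x) ^+ 2 + complex.Im (f x) ^+ 2))); last first.
  by apply/funext => x; rewrite cabsE.
apply: (measurableT_comp (continuous_measurable_fun (@sqrt_continuous R))).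
by apply: measurable_funD; apply: measurable_funX;
  [exact: measurable_fun_Re|exact: measurable_fun_Im].
Qed.

Lemma measurable_inv D (f : T -> R) :
  measurable_fun D f -> measurable_fun D (fun x => (f x)^-1).
Proof.
move=> mf; rewrite (_ : (fun x => _) = (fun x => f x * (f x ^+ 2) `^ (-1))).
  apply: measurable_funM => //.
  by apply: (measurableT_comp (@measurable_powR R (-1))); exact: measurable_funX.
apply/funext => x; rewrite powR_inv1 ?sqr_ge0//.
have [->|f0] := eqVneq (f x) 0; first by rewrite invr0 mul0r.
by rewrite expr2 invfM mulrA divff// mul1r.
Qed.

Lemma measurable_funMc D f g : measurable D ->
  measurable_fun D f -> measurable_fun D g ->
  measurable_fun D (fun x => f x * g x).
Proof.
move=> mD mf mg; apply/measurable_fun_complexP => //; split.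
  under eq_fun do rewrite ReM.
  by apply: measurable_funB; apply: measurable_funM;
    (exact: measurable_fun_Re || exact: measurable_fun_Im).
under eq_fun do rewrite ImM.
by apply: measurable_funD; apply: measurable_funM;
  (exact: measurable_fun_Re || exact: measurable_fun_Im).
Qed.

Lemma measurable_conj D f : measurable D ->
  measurable_fun D f -> measurable_fun D (fun x => (f x)^*).
Proof.
move=> mD mf; apply/measurable_fun_complexP => //; split.
  rewrite (_ : (fun x => _) = (fun x => complex.Re (f x))); last first.
    by apply/funext => x; case: (f x).
  exact: measurable_fun_Re.
rewrite (_ : (fun x => _) = (fun x => - complex.Im (f x))); last first.
  by apply/funext => x; case: (f x).
by apply: measurable_funN; exact: measurable_fun_Im.
Qed.

Lemma measurable_real D (f : T -> R) : measurable D ->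
  measurable_fun D f -> measurable_fun D (fun x => (f x)%:C).
Proof. by move=> mD mf; apply/measurable_fun_complexP. Qed.

Lemma measurable_invc D f : measurable D ->
  measurable_fun D f -> measurable_fun D (fun x => (f x)^-1).
Proof.
move=> mD mf; apply/measurable_fun_complexP => //.
have mq : measurable_fun D (fun x => (cabs (f x) ^+ 2)^-1).
  by apply: measurable_inv; apply: measurable_funX; exact: measurable_cabs.
split.
  apply: (@eq_measurable_fun _ _ _ _ _ (fun x => complex.Re (f x) * (cabs (f x) ^+ 2)^-1)).
    by move=> x _; rewrite ReV.
  by apply: measurable_funM => //; exact: measurable_fun_Re.
apply: (@eq_measurable_fun _ _ _ _ _ (fun x => - complex.Im (f x) * (cabs (f x) ^+ 2)^-1)).
  by move=> x _; rewrite ImV.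
by apply: measurable_funM => //; apply: measurable_funN; exact: measurable_fun_Im.
Qed.

Lemma measurable_oneB D f : measurable D ->
  measurable_fun D f -> measurable_fun D (fun x => 1 - f x).
Proof.
move=> mD mf; apply/measurable_fun_complexP => //; split.
  apply: (@eq_measurable_fun _ _ _ _ _ (fun x => 1 - complex.Re (f x))).
    by move=> x _; case: (f x).
  by apply: measurable_funB => //; exact: measurable_fun_Re.
apply: (@eq_measurable_fun _ _ _ _ _ (fun x => - complex.Im (f x))).
  by move=> x _; case: (f x) => a b /=; rewrite sub0r.
by apply: measurable_funN; exact: measurable_fun_Im.
Qed.

Lemma measurable_arg D f : measurable D ->
  measurable_fun D f -> measurable_fun D (fun x => arg (f x)).
Proof.
move=> mD mf.
(* clamped to [-1, 1], the arccosine becomes monotone on the whole line *)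
pose h (x : R) := - acos (Num.max (-1) (Num.min 1 x)).
have mh : measurable_fun setT h.
  apply: nondecreasing_measurable => // x y xy; rewrite /h lerN2.
  have I (t : R) : -1 <= Num.max (-1) (Num.min 1 t) <= 1.
    by rewrite le_max lexx /= ge_max ge_min lexx /= andbT; lra.
  rewrite leNgt -ltr_cos ?acosK ?in_itv/= ?I ?acos_ge0 ?acos_lepi ?I//.
  by rewrite -leNgt ge_max le_max lexx /= le_max; apply/orP; right;
    rewrite le_min ge_min lexx /= ge_min xy orbT.
have mt : measurable_fun D
    (fun x => acos (complex.Re (f x) / cabs (f x))).
  rewrite (_ : (fun x => _) =
      (fun x => - h (complex.Re (f x) / cabs (f x)))); last first.
    apply/funext => x; rewrite /h opprK; have /andP[a b] := Re_div_cabs (f x).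
    by congr acos; rewrite min_r// max_r.
  apply: measurable_funN; apply: (measurableT_comp mh).
  apply: measurable_funM; first exact: measurable_fun_Re.
  by apply: measurable_inv; exact: measurable_cabs.
rewrite /arg; apply: measurable_fun_if => //.
- by apply: measurable_fun_ler => //; exact: measurable_fun_Im.
- by apply: measurable_funS mt => //; exact: subIsetl.
- by apply: measurable_funB => //; apply: measurable_funS mt => //; exact: subIsetl.
Qed.

End ComplexMeasurability.

Lemma measurable_disc {R : realType} : measurable (@disc R).
Proof.
rewrite (_ : disc = setT `&` (fun z : R[i] => cabs z) @^-1` `]-oo, 1[); last first.
  by rewrite setTI; apply/seteqP; split=> z /=; rewrite in_itv/= => /discE.
by apply: measurable_cabs => //; exact: measurable_id.
Qed.
#[global] Hint Extern 0 (measurable disc) => solve [exact: measurable_disc] : core.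


(** * Sizes of Carleson squares and of polar rectangles *)

Section PolarMeasureBounds.
Context {R : realType}.
Variable om : {finite_measure set (measurableTypeR R) -> \bar R}.
Local Notation mR := (measurableTypeR R).
Local Notation mu := (polar_measure om).
Local Notation leb := (@lebesgue_measure R).
Local Open Scope ereal_scope.

Lemma measurable_polar_preimage A : measurable A -> measurable (@polar R @^-1` A).
Proof.
by move=> mA; rewrite -[X in measurable X]setTI; exact: measurable_polar.
Qed.

Lemma lebesgue_co (s t : R) : (s <= t)%R -> leb `[s, t[%classic = (t - s)%:E.
Proof.
rewrite lebesgue_measure_itv/= lte_fin le_eqVlt => /orP[/eqP ->|->//].
by rewrite ltxx subrr.
Qed.

Lemma measurable_radius D : measurable D ->
  measurable_fun D (fun x : mR * mR => (x.1 : R)%:E).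
Proof. by move=> mD; apply/measurable_EFinP; exact: measurable_funTS. Qed.

Lemma polar_measureT_le : mu setT <= om setT * (2 * pi)%:E.
Proof.
have p0 : (0 <= 2 * pi :> R)%R by rewrite mulr_ge0 ?pi_ge0.
rewrite /polar_measure preimage_setT setIT.
apply: (@le_trans _ _ (\int[(om \x leb)]_(x in `[0%R, 1%R[ `*` `[0%R, (2 * pi)%R[) (cst 1 x))).
  apply: ge0_le_integral => //=.
  - exact: measurableX.
  - by move=> -[r t] [/=]; rewrite in_itv/= lee_fin => /andP[].
  - by apply: measurable_radius; exact: measurableX.
  - by move=> -[r t] [/=]; rewrite in_itv/= lee_fin => /andP[_ /ltW].
rewrite integral_cst; last exact: measurableX.
rewrite mul1e [leLHS](product_measure1E om leb)//= lebesgue_co// subr0.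
by rewrite lee_wpmul2r ?lee_fin// le_measure ?inE//; exact: measurable_itv.
Qed.

Let polar_fin : fin_num_fun mu.
Proof.
move=> A mA; rewrite ge0_fin_numE//.
apply: (@le_lt_trans _ _ (mu setT)); first by rewrite le_measure ?inE.
apply: le_lt_trans polar_measureT_le _.
by rewrite muleC lte_mul_pinfty ?lee_fin ?mulr_ge0 ?pi_ge0// ltey_eq fin_num_measure.
Qed.

HB.instance Definition _ := @Measure_isFinite.Build _ _ _ mu polar_fin.

(** The density r of the polar measure is at least 1/2 on these annuli. *)
Lemma polar_measure_rect0 A (r1 r2 t1 t2 : R) : measurable A ->
  (2^-1 <= r1)%R -> (r2 <= 1)%R -> (0 <= t1)%R -> (t1 <= t2)%R -> (t2 <= 2 * pi)%R ->
  (forall r t : R, (r1 <= r < r2)%R -> (t1 <= t < t2)%R -> A (r%:C * expi t)%R) ->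
  om `[r1, r2[%classic * ((t2 - t1) / 2)%:E <= mu A.
Proof.
move=> mA r1h r21 t10 t12 t2p h.
have mX : measurable ((`[r1, r2[ : set mR) `*` (`[t1, t2[ : set mR)).
  by apply: measurableX; exact: measurable_itv.
apply: (@le_trans _ _ (\int[(om \x leb)]_(x in `[r1, r2[ `*` `[t1, t2[) (cst (2^-1)%:E x))).
  rewrite integral_cst// [X in _ <= _ * X](product_measure1E om leb)//= lebesgue_co//.
  by rewrite muleCA -EFinM mulrC.
rewrite /polar_measure.
have mB : measurable ((`[0%R, 1%R[ : set mR) `*` (`[0%R, (2 * pi)%R[ : set mR) `&` @polar R @^-1` A).
  apply: measurableI; last exact: measurable_polar_preimage.
  by apply: measurableX; exact: measurable_itv.
apply: (@le_trans _ _ (\int[(om \x leb)]_(x in `[r1, r2[ `*` `[t1, t2[) (x.1 : R)%:E)).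
  apply: ge0_le_integral => //.
  - by move=> x _; rewrite lee_fin invr_ge0.
  - exact: measurable_radius.
  - by move=> -[r t] [/=]; rewrite in_itv/= => /andP[rr _] _; rewrite lee_fin; lra.
apply: ge0_subset_integral => //.
- exact: measurable_radius.
- by move=> -[r t] [[/=]]; rewrite in_itv/= => /andP[r0 _] _ _; rewrite lee_fin.
- move=> -[r t] [/=]; rewrite !in_itv/= => /andP[rr1 rr2] /andP[tt1 tt2]; split.
    by split => /=; apply/andP; split; lra.
  by apply: h; apply/andP.
Qed.

(** Cutting the circle at angle 0 may break the arc in two, hence the loss of
    a factor 2. *)
Lemma polar_measure_rect A (r1 r2 t1 t2 : R) : measurable A ->
  (2^-1 <= r1)%R -> (r2 <= 1)%R -> (t1 <= t2)%R -> (t2 - t1 <= 2 * pi)%R ->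
  (forall r t : R, (r1 <= r < r2)%R -> (t1 <= t < t2)%R -> A (r%:C * expi t)%R) ->
  om `[r1, r2[%classic * ((t2 - t1) / 4)%:E <= mu A.
Proof.
move=> mA r1h r21 t12 t2p h.
have p0 : (0 < 2 * pi :> R)%R by rewrite mulr_gt0 ?pi_gt0.
pose n := Num.floor (t1 / (2 * pi)).
have /andP[n1 n2] : (n%:~R * (2 * pi) <= t1 < (n + 1)%:~R * (2 * pi))%R.
  by rewrite -ler_pdivlMr// -ltr_pdivrMr// floor_itv.
rewrite intrD mulrDl mul1r in n2.
pose s1 := (t1 - n%:~R * (2 * pi))%R; pose s2 := (t2 - n%:~R * (2 * pi))%R.
have hs (m : int) (u1 u2 : R) : (0 <= u1)%R -> (u1 <= u2)%R -> (u2 <= 2 * pi)%R ->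
    (t1 <= u1 + m%:~R * (2 * pi))%R -> (u2 + m%:~R * (2 * pi) <= t2)%R ->
    ((t2 - t1) / 4 <= (u2 - u1) / 2)%R ->
    om `[r1, r2[%classic * ((t2 - t1) / 4)%:E <= mu A.
  move=> u10 u12 u2p tu1 tu2 hu.
  apply: (@le_trans _ _ (om `[r1, r2[%classic * ((u2 - u1) / 2)%:E)).
    by rewrite lee_wpmul2l// lee_fin.
  apply: polar_measure_rect0 => // r t hr /andP[ht1 ht2].
  by rewrite -(expiDz t m) [X in expi (_ + X)]mulrC; apply: h => //; apply/andP; split; lra.
have es1 : (s1 = t1 - n%:~R * (2 * pi))%R by [].
have es2 : (s2 = t2 - n%:~R * (2 * pi))%R by [].
have hsn := hs n; have hsn1 := hs (n + 1)%R.
have En : ((n + 1)%:~R * (2 * pi) = n%:~R * (2 * pi) + 2 * pi :> R)%R.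
  by rewrite intrD mulrDl mul1r.
rewrite {}En in hsn1.
move: (n%:~R * (2 * pi))%R hsn hsn1 n1 n2 es1 es2 => c hsn hsn1 n1 n2.
clearbody s1 s2 => es1 es2.
have [s2p|s2p] := leP s2 (2 * pi)%R; first by apply: (hsn s1 s2); lra.
(* otherwise one of the two pieces is at least half of the arc *)
have [hh|hh] := leP (2 * (2 * pi - s1))%R (t2 - t1)%R.
  by apply: (hsn1 0%R (s2 - 2 * pi)%R); rewrite ?add0r; lra.
by apply: (hsn s1 (2 * pi)%R); lra.
Qed.

End PolarMeasureBounds.


Section CarlesonSquares.
Context {R : realType}.
Implicit Types z : R[i].

Lemma carlesonP (a l : R) z : (0 < l) -> (l <= 1) ->
  carleson a l z <->
  [/\ (1 - l <= cabs z), (cabs z < 1) & (arg (z * expi (- a)) <= 2 * pi * l)].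
Proof.
move=> l0 l1; have p0 : (0 < 2 * pi :> R) by rewrite mulr_gt0 ?pi_gt0.
split=> [[r /=]|[z1 z2 z3]].
  rewrite in_itv/= => /andP[r1 r2] [_ [t /= + <-] <-].
  rewrite in_itv/= => /andP[t1 t2].
  have r0 : (0 <= r) by lra.
  rewrite cabsM cabs_expi mulr1 cabs_real ger0_norm//; split => //.
  have [t2p|t2p] := ltP (t - a) (2 * pi); last first.
    have /andP[_ ?] := arg_itv (r%:C * expi t * expi (- a)); apply: ltW.
    lra.
  move: r0; rewrite le_eqVlt => /predU1P[r0|r0].
    have -> : l = 1 by lra.
    by rewrite mulr1; have /andP[_ /ltW] := arg_itv (r%:C * expi t * expi (- a)).
  rewrite -mulrA -expiD arg_polar//; first by lra.
  by apply/andP; split; lra.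
exists (cabs z); first by rewrite /= in_itv/= z1.
exists (expi (arg (z * expi (- a)) + a)).
  exists (arg (z * expi (- a)) + a) => //=.
  by rewrite in_itv/=; have /andP[? _] := arg_itv (z * expi (- a)); apply/andP; split; lra.
rewrite expiD mulrA.
have {1}-> : cabs z = cabs (z * expi (- a)) by rewrite cabsM cabs_expi mulr1.
by rewrite -polar_arg -mulrA -expiD addNr expi0 mulr1.
Qed.

Lemma measurable_carleson (a l : R) : (0 < l) -> (l <= 1) ->
  measurable (@carleson R a l).
Proof.
move=> l0 l1.
have mid : measurable_fun setT (@id R[i]) by exact: measurable_id.
rewrite (_ : carleson a l = setT `&` ((fun z => cabs z) @^-1` `[1 - l, 1[) `&`
  (setT `&` (fun z => arg (z * expi (- a))) @^-1` `]-oo, 2 * pi * l])).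
  apply: measurableI.
    by apply: measurable_cabs.
  by apply: measurable_arg => //; apply: measurable_funMc.
apply/seteqP; split => z /=.
  move=> /(carlesonP _ _ l0 l1)[h1 h2 h3]; do ![split] => //; rewrite /= in_itv/= ?h1//.
by rewrite !in_itv/= => -[[_ /andP[h1 h2]] [_ h3]]; apply/carlesonP.
Qed.

Lemma carleson_sub_disc (a l : R) : (0 < l) -> (l <= 1) ->
  @carleson R a l `<=` disc.
Proof. by move=> l0 l1 z /(carlesonP _ _ l0 l1)[_ ? _]; apply/discE. Qed.

End CarlesonSquares.

Section CarlesonMeasure.
Context {R : realType}.
Variable om : {finite_measure set (measurableTypeR R) -> \bar R}.
Local Notation mR := (measurableTypeR R).
Local Notation mu := (polar_measure om).
Local Notation leb := (@lebesgue_measure R).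
Local Open Scope ereal_scope.

Lemma polar_measure_carleson_le (a l : R) : (0 < l)%R -> (l <= 1)%R ->
  mu (carleson a l) <= tail om (1 - l) * (4 * pi * l)%:E.
Proof.
move=> l0 l1; have pi0 : (0 < pi :> R)%R by exact: pi_gt0.
have p0 : (0 < 2 * pi :> R)%R by rewrite mulr_gt0.
pose n := Num.floor (a / (2 * pi)).
have /andP[n1 n2] : (n%:~R * (2 * pi) <= a < (n + 1)%:~R * (2 * pi))%R.
  by rewrite -ler_pdivlMr// -ltr_pdivrMr// floor_itv.
rewrite intrD mulrDl mul1r in n2.
pose b := (a - n%:~R * (2 * pi))%R.
have b0 : (0 <= b)%R by rewrite /b; lra.
have b2 : (b < 2 * pi)%R by rewrite /b; lra.
(* the two translates of the arc that can meet [0, 2 pi[ *)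
pose J1 : set mR := [set` `[b, (b + 2 * pi * l)%R]].
pose J2 : set mR := [set` `[(b - 2 * pi)%R, (b - 2 * pi + 2 * pi * l)%R]].
have pl0 : (0 < 2 * pi * l)%R by rewrite mulr_gt0.
have lebJ c : leb [set` `[c, (c + 2 * pi * l)%R]] = (2 * pi * l)%:E.
  rewrite lebesgue_measure_itv/= lte_fin ltrDl pl0.
  by rewrite -EFinB addrAC subrr add0r.
have mS := measurable_carleson a l0 l1.
have mJ : measurable (J1 `|` J2) by apply: measurableU; exact: measurable_itv.
have mX : measurable ((`[(1 - l)%R, 1%R[ : set mR) `*` (J1 `|` J2)).
  by apply: measurableX => //; exact: measurable_itv.
rewrite /polar_measure.
set X := _ `&` _.
have mXX : measurable X.
  apply: measurableI; last exact: measurable_polar_preimage.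
  by apply: measurableX; exact: measurable_itv.
have sX : X `<=` (`[(1 - l)%R, 1%R[ : set mR) `*` (J1 `|` J2).
  move=> -[r t] [[/=]]; rewrite !in_itv/= => /andP[r0 r1] /andP[t0 t2].
  rewrite /preimage /= => -[r' /=].
  rewrite in_itv/= => /andP[r'1 r'2] [_ [t' /= + <-]].
  rewrite in_itv/= => /andP[t'1 t'2] e.
  have r'0 : (0 <= r')%R by lra.
  have er : r = r'.
    have := congr1 (@cabs R) e.
    by rewrite /polar !cabsM !cabs_expi !mulr1 !cabs_real !ger0_norm.
  split; first by rewrite /= er r'1.
  rewrite /J1 /J2 /= !in_itv/=.
  have [r'p|r'p] := leP r' 0%R.
    have l11 : l = 1%R by lra.
    by rewrite l11 mulr1; have [tb|tb] := leP b t; [left|right]; apply/andP; split; lra.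
  pose t'' := (t' - n%:~R * (2 * pi))%R.
  have et : expi t'' = expi t' :> R[i].
    by rewrite -(expiDz t'' n) /t'' [(n%:~R * _)%R]mulrC subrK.
  have e2 : (r%:C * expi t'' = r%:C * expi t :> R[i])%R.
    by rewrite et -[RHS]/(polar (r, t)) -e er.
  have at_ : arg (r%:C * expi t)%R = t by rewrite arg_polar ?er// t0.
  have [t2p|t2p] := ltP t'' (2 * pi)%R.
    left; suff <- : t'' = t by rewrite /t'' /b; apply/andP; split; lra.
    rewrite -at_ -e2 arg_polar ?er//; apply/andP; split => //; rewrite /t''; lra.
  right; suff <- : (t'' - 2 * pi)%R = t by rewrite /t'' /b; apply/andP; split; lra.
  rewrite -at_ -e2 -(expiDz t'' (-1)) mulrN1z mulrN1 arg_polar ?er//.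
  apply/andP; split; rewrite /t''; first by move: t2p; rewrite /t''; lra.
  by have : (2 * pi * l <= 2 * pi)%R; [rewrite ler_piMr// ltW|move=> ?; lra].
apply: (@le_trans _ _ (\int[(om \x leb)]_(x in X) (cst 1 x))).
  apply: ge0_le_integral => //.
  - by move=> -[r t] [[/=]]; rewrite in_itv/= => /andP[? _] _ _; rewrite lee_fin.
  - exact: measurable_radius.
  - by move=> -[r t] [[/=]]; rewrite in_itv/= => /andP[_ /ltW ?] _ _; rewrite lee_fin.
rewrite integral_cst// mul1e.
apply: (@le_trans _ _ ((om \x leb) (`[(1 - l)%R, 1%R[ `*` (J1 `|` J2)))).
  by apply: le_measure => //; rewrite ?inE.
rewrite [leLHS](product_measure1E om leb)//.
apply: (@lee_wpmul2l _ (om `[(1 - l)%R, 1%R[%classic)) => //.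
have mJ1 : measurable J1 by exact: measurable_itv.
have mJ2 : measurable J2 by exact: measurable_itv.
apply: (le_trans (@measureU2 _ _ _ leb J1 J2 mJ1 mJ2)).
have e1 : leb J1 = _ := lebJ b; have e2 : leb J2 = _ := lebJ (b - 2 * pi)%R.
rewrite [leLHS](_ : _ = (2 * pi * l)%:E + (2 * pi * l)%:E).
  by rewrite -EFinD lee_fin; lra.
by congr (_ + _); [exact: e1|exact: e2].
Qed.

End CarlesonMeasure.


(** * The tail of a measure of class R *)

Section Tail.
Context {R : realType}.
Implicit Types om : {finite_measure set (measurableTypeR R) -> \bar R}.
Implicit Types x y : R.

(** The tail as a real function of the distance to the boundary. *)
Definition bmass om x : R := fine (tail om (1 - x)).

Lemma tail_fin om (r : R) : tail om r \is a fin_num.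
Proof. by rewrite /tail fin_num_measure//; exact: measurable_itv. Qed.

Lemma bmassE om x : tail om (1 - x) = (bmass om x)%:E.
Proof. by rewrite /bmass fineK// tail_fin. Qed.

Lemma bmass_le om x y : x <= y -> bmass om x <= bmass om y.
Proof.
move=> xy; rewrite -lee_fin -!bmassE /tail le_measure ?inE//;
  [exact: measurable_itv..|].
move=> r /=; rewrite !in_itv/= => /andP[r1 ->]; rewrite andbT; lra.
Qed.

Lemma bmass_gt0 om x : class_R om -> 0 < x -> 0 < bmass om x.
Proof.
move=> [_ n0 [C [g0 [b0 [C0 _ _ h]]]]] x0.
wlog x1 : x x0 / x <= 1 => [H|].
  have [/H|/ltW x1] := leP x 1; first exact.
  exact: lt_le_trans (H 1 ltr01 (lexx 1)) (bmass_le _ x1).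
rewrite lt_neqAle; apply/andP; split; last first.
  by rewrite -lee_fin -bmassE.
apply/eqP => e.
have [_] := h 0 (1 - x) (lexx 0) ltac:(lra) ltac:(lra).
rewrite bmassE -e mule0 => t0; apply: n0; apply/eqP.
by rewrite eq_le measure_ge0 andbT.
Qed.

(** The exponent is rounded up to an integer, so as to be comparable with that
    of a rational test function. *)
Lemma bmass_doubling om : class_R om -> exists (C : R) (N : nat), 0 < C /\
  forall x y, 0 < x -> x <= y -> y <= 1 ->
    bmass om y <= C * (y / x) ^+ N * bmass om x.
Proof.
move=> [_ _ [C [g0 [b0 [C0 g00 g0b0 h]]]]].
exists C, (Num.truncn b0).+1; split => // x y x0 xy y1.
have yx : 1 <= y / x by rewrite ler_pdivlMr ?mul1r.
have [_] := h (1 - y) (1 - x) ltac:(lra) ltac:(lra) ltac:(lra).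
rewrite !bmassE -EFinM lee_fin !opprB !addrA ![1 + _]addrC !addrK.
move/le_trans; apply; rewrite ler_wpM2r//; first by rewrite -lee_fin -bmassE.
rewrite ler_pM2l// -powR_mulrn ?(le_trans ler01)// ler_powR//.
by apply/ltW; apply: truncnS_gt.
Qed.

(** The lower bound in class R: for a large enough ratio of the distances to the
    boundary, the tail decays by half. That ratio is the one of the grids, and
    the decay leaves a fixed share of the mass of a box to its top part. *)
Lemma bmass_decay om : class_R om -> exists m : nat, (0 < m)%N /\
  forall x, 0 < x -> x <= 1 ->
    bmass om (x / 2 ^+ m) <= 2^-1 * bmass om (x / 2).
Proof.
move=> hom; have := hom => -[_ _ [C [g0 [b0 [C0 g00 g0b0 h]]]]].
have [n hn] : exists n : nat, (2 * C) `^ g0^-1 <= 2 ^+ n.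
  exists (Num.truncn ((2 * C) `^ g0^-1)).+1; apply: ltW.
  apply: (@lt_le_trans _ _ (Num.truncn ((2 * C) `^ g0^-1)).+1%:R).
    exact: truncnS_gt.
  by rewrite -natrX ler_nat ltnW// ltn_expl.
exists n.+1; split => // x x0 x1.
have p0 : 0 < 2 ^+ n :> R by rewrite exprn_gt0.
have ge1 : 1 <= 2 ^+ n :> R by rewrite exprn_ege1 ?ler1n.
rewrite exprS; move: (2 ^+ n) hn p0 ge1 => P hn p0 ge1.
have hx : x / (2 * P) = (x / 2) / P by rewrite invfM mulrA.
have xx : x / (2 * P) <= x / 2.
  by rewrite hx ler_pdivrMr// ler_peMr//; lra.
have xp : 0 < x / (2 * P) by rewrite divr_gt0 ?mulr_gt0.
have [+ _] := h (1 - x / 2) (1 - x / (2 * P)) ltac:(lra) ltac:(lra) ltac:(lra).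
rewrite !bmassE -EFinM lee_fin !opprB !addrA ![1 + _]addrC !addrK => H.
have big : 2 * C <= ((x / 2) / (x / (2 * P))) `^ g0.
  rewrite (_ : x / 2 / (x / (2 * P)) = P); last by field; rewrite !gt_eqF.
  have e : ((2 * C) `^ g0^-1) `^ g0 = 2 * C.
    by rewrite -powRrM mulVf ?gt_eqF// powRr1// mulr_ge0// ltW.
  by rewrite -[leLHS]e; apply: ge0_ler_powR => //; rewrite ?nnegrE ?powR_ge0 ?(ltW g00) ?(ltW p0).
have b0' : 0 <= bmass om (x / (2 * P)) by rewrite -lee_fin -bmassE.
have : C^-1 * (2 * C) * bmass om (x / (2 * P)) <= bmass om (x / 2).
  by apply: le_trans H; rewrite ler_wpM2r// ler_wpM2l ?invr_ge0 // ltW.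
rewrite mulrCA mulVf ?gt_eqF// mulr1; lra.
Qed.

End Tail.


(** * Two shifted grids of boxes *)

Section CabsOneB.
Context {R : realType}.
Implicit Types z u : R[i].

Lemma conjM z u : (z * u)^* = z^* * u^*.
Proof. exact: rmorphM. Qed.

Lemma conjR (x : R) : (x%:C)^* = x%:C :> R[i].
Proof. exact: conjc_real. Qed.

Lemma conj1 : 1^* = 1 :> R[i].
Proof. exact: conjc1. Qed.

Lemma conjB z u : (z - u)^* = z^* - u^*.
Proof. exact: rmorphB. Qed.

Lemma conjK z : z^*^* = z.
Proof. exact: conjcK. Qed.

Lemma conjM_polar z u : z^* * u =
  (cabs z * cabs u)%:C * expi (arg u - arg z).
Proof.
have -> : z^* = (cabs z)%:C * expi (- arg z).
  by rewrite {1}(polar_arg z) conjM conjR expiN.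
rewrite {1}(polar_arg u) expiD (rmorphM (real_complex R)).
by rewrite mulrACA [expi _ * expi _]mulrC.
Qed.

Lemma sqr_cabs_1B (s t : R) :
  cabs (1 - s%:C * expi (2 * t)) ^+ 2 = (1 - s) ^+ 2 + 4 * s * sin t ^+ 2.
Proof.
rewrite sqr_cabs /= !mul0r subr0 addr0 sub0r sqrrN mulr_natl cos_mulr2n.
rewrite sin_mulr2n; have := cos2Dsin2 t => h.
have -> : (s * (cos t * sin t *+ 2)) ^+ 2 = 4 * s ^+ 2 * cos t ^+ 2 * sin t ^+ 2.
  by ring.
have -> : cos t ^+ 2 = 1 - sin t ^+ 2 by rewrite -h addrK.
by ring.
Qed.

Lemma cabs_1B_ge z u : cabs z < 1 -> cabs u < 1 ->
  1 - cabs z * cabs u <= cabs (1 - z^* * u).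
Proof.
move=> z1 u1; rewrite -(cabs_conj z) -cabsM -[X in X - _](@cabs1 R); exact: cabs_dist.
Qed.

Lemma cabs_1B_gt0 z u : disc z -> disc u -> 0 < cabs (1 - z^* * u).
Proof.
move=> /discE z1 /discE u1; apply: lt_le_trans (cabs_1B_ge z1 u1).
by rewrite subr_gt0 mulr_ilt1 ?cabs_ge0.
Qed.

Lemma cabs_1B_radius z u : disc z -> disc u -> 1 - cabs z <= cabs (1 - z^* * u).
Proof.
move=> /discE z1 /discE u1; apply: le_trans (cabs_1B_ge z1 u1).
by rewrite lerD2l lerN2 ler_piMr ?cabs_ge0// ltW.
Qed.

Lemma cabs_1BC z u : cabs (1 - z^* * u) = cabs (1 - u^* * z).
Proof.
by rewrite -[LHS]cabs_conj conjB conjM conjK conj1 mulrC.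
Qed.

(** The distance between the arguments, taken modulo full turns, is controlled
    by |1 - z^* u|. *)
Lemma arg_dist_le z u : disc z -> disc u -> 4^-1 <= cabs z * cabs u ->
  exists g : int, `|(arg z - arg u) / (2 * pi) - g%:~R| <=
    2 * cabs (1 - z^* * u).
Proof.
move=> dz du s4; pose s := cabs z * cabs u; have p0 := @pi_gt0 R.
pose d := (arg z - arg u) / (2 * pi).
pose g := Num.floor (d + 2^-1); exists g; rewrite -/d.
have /andP[g1 g2] : g%:~R <= d + 2^-1 < (g + 1)%:~R by exact: floor_itv.
rewrite intrD in g2.
pose y := pi * (g%:~R - d).
have ey : expi (arg u - arg z) = expi (2 * y) :> R[i].
  rewrite -(expiDz (arg u - arg z) g); congr expi.
  by rewrite /y /d; move: (pi) p0 => q q0; field; rewrite gt_eqF.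
have x2 : `|sin y| <= cabs (1 - z^* * u).
  rewrite -(@ler_pXn2r _ 2) ?nnegrE ?cabs_ge0// conjM_polar ey sqr_cabs_1B.
  rewrite real_normK ?num_real// -[leLHS]add0r lerD ?sqr_ge0//.
  by rewrite ler_peMl ?sqr_ge0//; move: s4; rewrite -/s; lra.
have yp : `|y| <= pi / 2.
  by rewrite /y normrM (gtr0_norm p0) ler_wpM2l ?pi_ge0// ler_norml; apply/andP; split; lra.
have ys : `|y| / 4 <= `|sin y|.
  suff : `|y| / 4 <= sin `|y|.
    have [y0|y0] := ler0P y; last by move/le_trans; apply; exact: ler_norm.
    by rewrite sinN => /le_trans; apply; rewrite -normrN ler_norm.
  by apply: sin_ge_quarter; rewrite normr_ge0.
have e : `|d - g%:~R| = `|y| / pi.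
  by rewrite /y normrM (gtr0_norm p0) mulrAC divff ?mul1r ?gt_eqF// distrC.
rewrite e ler_pdivrMr//; have p2 := @pi_ge2 R.
have : 2 * 2 * `|sin y| <= 2 * pi * cabs (1 - z^* * u).
  by apply: ler_pM => //; lra.
lra.
Qed.

End CabsOneB.

Section ThirdTrick.
Context {R : realType}.
Implicit Types a b : R.

(** Integers and integers shifted by M/3 stay at distance at least 1/3 when 3
    does not divide M, so a short interval cannot meet both. *)
Lemma third_trick a b (M : nat) : ~~ (3 %| M)%N -> `|a - b| < 3^-1 ->
  Num.floor a = Num.floor b \/
  Num.floor (a - M%:R / 3) = Num.floor (b - M%:R / 3).
Proof.
move=> M3; wlog ab : a b / a <= b.
  move=> H; have [|/ltW ba] := leP a b; first exact: H.
  rewrite distrC => h.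
  by have [->|->] := H b a ba h; [left|right].
rewrite distrC ger0_norm ?subr_ge0// => d.
have K (c e : R) : c <= e -> Num.floor c <> Num.floor e ->
    c < (Num.floor e)%:~R <= e.
  move=> ce /eqP ne; have /andP[-> _] := floor_itv e; rewrite andbT.
  have /andP[_ c2] := floor_itv c; apply: lt_le_trans c2 _.
  rewrite ler_int -ltzD1 ltrD2r lt_neqAle ne /=.
  by rewrite floor_ge_int (le_trans _ ce)// floor_le.
have [|/eqP/(K _ _ ab)/andP[n1 n2]] := eqVneq (Num.floor a) (Num.floor b); first by left.
have [|/eqP/(K _ _)] := eqVneq (Num.floor (a - M%:R / 3)) (Num.floor (b - M%:R / 3)).
  by right.
rewrite lerD2r => /(_ ab)/andP[m1 m2].
move: (Num.floor b) (Num.floor (b - M%:R / 3)) n1 n2 m1 m2 => n n' n1 n2 m1 m2.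
have h1 : (3 * (n - n') - M%:Z)%:~R < 1 :> R.
  by rewrite intrB intrM intrB -!pmulrn; lra.
have h2 : -1 < (3 * (n - n') - M%:Z)%:~R :> R.
  by rewrite intrB intrM intrB -!pmulrn; lra.
have : 3 * (n - n') - M%:Z = 0.
  have : (-1)%:~R < (3 * (n - n') - M%:Z)%:~R :> R by rewrite mulrN1z.
  have : (3 * (n - n') - M%:Z)%:~R < 1%:~R :> R by [].
  rewrite !ltr_int; lia.
move=> e; exfalso; move/negP: M3; apply.
by apply/dvdnP; exists `|n - n'|%N; lia.
Qed.

Lemma floor_period (M : nat) a b (g : int) :
  0 <= a < M%:R -> 0 <= b < M%:R -> Num.floor a = Num.floor b + M%:Z * g ->
  Num.floor a = Num.floor b.
Proof.
have K (c : R) : 0 <= c < M%:R -> (0 <= Num.floor c < M%:Z)%R.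
  move=> /andP[c0 c1]; rewrite floor_ge_int c0 /= -(@ltr_int R).
  exact: le_lt_trans (floor_le _) c1.
move=> /K /andP[a1 a2] /K /andP[b1 b2].
move: (Num.floor a) (Num.floor b) a1 a2 b1 b2 => x y a1 a2 b1 b2 e.
have [g0|g0] : g = 0 \/ (1 <= g \/ g <= -1) by lia.
  by rewrite e g0 mulr0 addr0.
by case: g0 => g0; nia.
Qed.

End ThirdTrick.


Section Grid.
Context {R : realType}.
Variable m : nat.
Implicit Types (z u : R[i]) (s : bool) (j k : nat).

Definition cut s : R := if s then 2 * pi / 3 else 0.

(** The angular coordinate of [z], in turns, measured from the cut of the
    grid. *)
Definition ang s z : R := arg (z * expi (- cut s)) / (2 * pi).

(** Each generation divides the arcs of the previous one into [split] parts;
    a power of 2, so as to be prime to 3. *)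
Definition split : nat := (2 ^ m)%N.
Definition side j : R := ((split ^ j)%:R)^-1.

(** Variants of the Carleson squares over the arcs of a grid, half-open in order
    that boxes of one generation be disjoint. *)
Definition box s j k : set R[i] :=
  [set z | [/\ 1 - side j <= cabs z, cabs z < 1 &
    k%:R <= (split ^ j)%:R * ang s z < k.+1%:R]].

Definition topbox s j k : set R[i] :=
  [set z | box s j k z /\ cabs z < 1 - side j.+1].

Lemma split_gt0 j : (0 < split ^ j)%N.
Proof. by rewrite expn_gt0 /split expn_gt0. Qed.

Lemma side_gt0 j : 0 < side j.
Proof. by rewrite invr_gt0 ltr0n split_gt0. Qed.

Lemma side_le1 j : side j <= 1.
Proof. by rewrite invf_le1 ?ltr0n ?split_gt0// ler1n split_gt0. Qed.

Lemma side0 : side 0 = 1.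
Proof. by rewrite /side expn0 invr1. Qed.

Lemma sideS j : side j.+1 = side j / split%:R.
Proof. by rewrite /side expnS natrM invfM mulrC. Qed.

Lemma side_split j : side j * (split ^ j)%:R = 1.
Proof. by rewrite mulVf// pnatr_eq0 -lt0n split_gt0. Qed.

Lemma ang_itv s z : 0 <= ang s z < 1.
Proof.
have p0 : 0 < 2 * pi :> R by rewrite mulr_gt0 ?pi_gt0.
have /andP[a0 a1] := arg_itv (z * expi (- cut s)).
by rewrite /ang divr_ge0 ?(ltW p0)//= ltr_pdivrMr// mul1r.
Qed.

Lemma polar_ang s z : z = (cabs z)%:C * expi (cut s + 2 * pi * ang s z).
Proof.
rewrite /ang mulrC [2 * pi * _]mulrC divfK; last by rewrite mulf_neq0// gt_eqF ?pi_gt0.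
rewrite expiD mulrC [expi _ * _]mulrC mulrA.
have {1}-> : cabs z = cabs (z * expi (- cut s)) by rewrite cabsM cabs_expi mulr1.
by rewrite -polar_arg -mulrA -expiD addNr expi0 mulr1.
Qed.

Lemma ang_polar s (r t : R) : 0 < r -> cut s <= t < cut s + 2 * pi ->
  ang s (r%:C * expi t) = (t - cut s) / (2 * pi).
Proof.
move=> r0 /andP[t0 t1]; rewrite /ang -mulrA -expiD arg_polar//.
by apply/andP; split; lra.
Qed.

Lemma floor_angE s j k z :
  (k%:R <= (split ^ j)%:R * ang s z < k.+1%:R) =
  (Num.floor ((split ^ j)%:R * ang s z) == k%:Z).
Proof. by rewrite floor_eq -pmulrn intrD -pmulrn natr1. Qed.

Lemma split_ang_itv s j z :
  0 <= (split ^ j)%:R * ang s z < (split ^ j)%:R.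
Proof.
have /andP[a0 a1] := ang_itv s z.
by rewrite mulr_ge0//= gtr_pMr// ltr0n split_gt0.
Qed.

Lemma floor_ang s j z : exists2 k, (k < split ^ j)%N &
  Num.floor ((split ^ j)%:R * ang s z) = k%:Z.
Proof.
have /andP[a0 a1] := split_ang_itv s j z.
have : (0 <= Num.floor ((split ^ j)%:R * ang s z))%R by rewrite floor_ge_int.
case e : (Num.floor _) => [k|//] _; exists k => //.
rewrite -(@ltr_nat R); apply: le_lt_trans a1.
by rewrite [leLHS](pmulrn _ k) -[Posz k]/(k%:Z) -e floor_le.
Qed.

Lemma box_inj s j k k' z : box s j k z -> box s j k' z -> k = k'.
Proof.
move=> [_ _ +] [_ _ +]; rewrite !floor_angE => /eqP -> /eqP.
by case.
Qed.

Lemma box_exists s j z : 1 - side j <= cabs z -> cabs z < 1 ->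
  exists2 k, (k < split ^ j)%N & box s j k z.
Proof.
move=> z0 z1; have [k ks e] := floor_ang s j z; exists k => //.
by split => //; rewrite floor_angE e.
Qed.

Lemma box_lt s j k z : box s j k z -> (k < split ^ j)%N.
Proof.
move=> [_ _]; rewrite floor_angE => /eqP e.
by have [k' ? e'] := floor_ang s j z; move: e; rewrite e' => -[<-].
Qed.

Lemma box0 s : box s 0 0 = disc.
Proof.
apply/seteqP; split=> z; first by case=> _ ? _; apply/discE.
move=> /discE z1; split => //; rewrite ?side0 ?subrr ?cabs_ge0//.
by rewrite expn0 mul1r; exact: ang_itv.
Qed.

Lemma box_sub_disc s j k : box s j k `<=` disc.
Proof. by move=> z [_ ? _]; apply/discE. Qed.

Lemma box_splitE s j k z : box s j k z <->
  topbox s j k z \/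
  exists2 i, (i < split)%N & box s j.+1 (split * k + i) z.
Proof.
have s0 : (0 < split)%N by have := split_gt0 1; rewrite expn1.
have sR : 0 < split%:R :> R by rewrite ltr0n.
have ss : side j.+1 <= side j.
  by rewrite sideS ler_pdivrMr// ler_peMr ?(ltW (side_gt0 _))// ler1n.
split=> [bz|[[]//|[i i_s [z0 z1 /andP[a0 a1]]]]].
  have [zt|zt] := ltP (cabs z) (1 - side j.+1); first by left.
  right; have [_ z1 /andP[a0 a1]] := bz.
  have [k' k's bz'] := box_exists s zt z1.
  have [_ _ /andP[b0 b1]] := bz'.
  have E : (split ^ j.+1)%:R * ang s z = split%:R * ((split ^ j)%:R * ang s z).
    by rewrite expnS natrM mulrA.
  rewrite E in b0 b1.
  have k1 : (split * k < k'.+1)%N.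
    rewrite -(@ltr_nat R) natrM; apply: le_lt_trans b1.
    by rewrite ler_pM2l.
  have k2 : (k' < split * k.+1)%N.
    rewrite -(@ltr_nat R) natrM; apply: le_lt_trans b0 _.
    by rewrite ltr_pM2l.
  exists (k' - split * k)%N; first by move: k1 k2; rewrite mulnS; lia.
  by rewrite subnKC.
have E : (split ^ j.+1)%:R * ang s z = split%:R * ((split ^ j)%:R * ang s z).
  by rewrite expnS natrM mulrA.
rewrite E in a0 a1; split => //; first by lra.
apply/andP; split.
  rewrite -(ler_pM2l sR); apply: le_trans a0.
  by rewrite -natrM ler_nat leq_addr.
rewrite -(ltr_pM2l sR); apply: lt_le_trans a1 _.
by rewrite -natrM ler_nat mulnS; move: i_s; lia.
Qed.

Lemma topbox_child_disj s j k i z :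
  topbox s j k z -> ~ box s j.+1 i z.
Proof. by move=> [_ h] [h' _ _]; move: h h'; lra. Qed.

Lemma measurable_ang s : measurable_fun setT (ang s).
Proof.
rewrite /ang; apply: measurable_funM => //; apply: measurable_arg => //.
by apply: measurable_funMc => //; exact: measurable_id.
Qed.

Lemma measurable_cabs_id : measurable_fun setT (@cabs R).
Proof. by apply: measurable_cabs => //; exact: measurable_id. Qed.

Lemma measurable_box s j k : measurable (box s j k).
Proof.
rewrite (_ : box s j k = (setT `&` cabs @^-1` `[1 - side j, 1[) `&`
  (setT `&` (fun z => (split ^ j)%:R * ang s z) @^-1` `[k%:R, k.+1%:R[)).
  apply: measurableI; first exact: measurable_cabs_id.
  by apply: measurable_funM => //; exact: measurable_ang.
apply/seteqP; split => z /=.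
  by move=> [h1 h2 h3]; rewrite !in_itv/= h1 h2 h3.
by rewrite !in_itv/= => -[[_ /andP[? ?]] [_ ?]].
Qed.

Lemma measurable_topbox s j k : measurable (topbox s j k).
Proof.
rewrite (_ : topbox s j k = box s j k `&`
  (setT `&` cabs @^-1` `]-oo, 1 - side j.+1[)).
  by apply: measurableI; [exact: measurable_box|exact: measurable_cabs_id].
apply/seteqP; split => z /=; rewrite in_itv/=.
  by move=> [? ?].
by move=> [? [_ ?]].
Qed.

Lemma box_sub_carleson s j k :
  box s j k `<=` carleson (cut s + 2 * pi * (k%:R * side j)) (side j).
Proof.
move=> z bz; have [z0 z1 /andP[a0 a1]] := bz; have kj := box_lt bz.
have p0 : 0 < 2 * pi :> R by rewrite mulr_gt0 ?pi_gt0.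
exists (cabs z); first by rewrite /= in_itv/= z0.
exists (expi (cut s + 2 * pi * ang s z)); last by rewrite -polar_ang.
exists (cut s + 2 * pi * ang s z) => //=; rewrite in_itv/= lerD2l.
rewrite -addrA lerD2l -mulrDr !ler_pM2l//.
have s0 := side_gt0 j.
have E : ang s z = ((split ^ j)%:R * ang s z) * side j.
  by rewrite mulrAC [_ * side j]mulrC side_split mul1r.
rewrite {}E; move: a0 a1; move: (_ * ang s z) => x a0 a1.
apply/andP; split; first by rewrite ler_pM2r.
rewrite -[X in _ + X]mul1r -mulrDl ler_pM2r// natr1; exact: ltW.
Qed.

End Grid.


Section GridCover.
Context {R : realType}.
Variable m : nat.
Implicit Types (z u : R[i]) (s : bool) (j k : nat).
Local Notation sd := (@side R m).
Local Notation K := (split m).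

Lemma split_coprime3 j : ~~ (3 %| K ^ j)%N.
Proof. by rewrite -prime_coprime// !coprimeXr. Qed.

Lemma ang_false z : ang false z = arg z / (2 * pi).
Proof. by rewrite /ang /cut oppr0 expi0 mulr1. Qed.

Lemma ang_true z : z != 0 ->
  exists e : int, ang true z = ang false z - 3^-1 + e%:~R.
Proof.
rewrite -cabs_gt0 => z0; have p0 := @pi_gt0 R.
have /andP[a0 a1] := arg_itv z; rewrite ang_false.
have E (e : int) : 0 <= arg z - 2 * pi / 3 + 2 * pi * e%:~R < 2 * pi ->
    exists e : int, ang true z = arg z / (2 * pi) - 3^-1 + e%:~R.
  move=> h; exists e; rewrite /ang /cut {1}(polar_arg z) -mulrA -expiD.
  rewrite -(expiDz _ e) arg_polar//.
  by move: (pi) p0 => q q0; field; rewrite gt_eqF.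
have [h|h] := leP (2 * pi / 3) (arg z).
  by apply: (E 0); rewrite mulr0 addr0; apply/andP; split; lra.
by apply: (E 1); rewrite mulr1; apply/andP; split; lra.
Qed.

(** The grids are shifted by a third of a turn against each other, so that an
    arc shorter than a third of the mesh is cut by at most one of them. *)
Lemma common_box z u : (0 < m)%N -> disc z -> disc u -> exists s j k,
  [/\ box m s j k z, box m s j k u &
      sd j <= 6 * K%:R * cabs (1 - z^* * u)].
Proof.
move=> m0 dz du; set x := cabs _; have x0 : 0 < x by exact: cabs_1B_gt0.
have sp : 1 <= K%:R :> R by rewrite ler1n; have := split_gt0 m 1; rewrite expn1.
have [x6|x6] := leP 1 (6 * x).
  exists false, 0%N, 0%N; rewrite box0; split => //; rewrite side0.
  apply: (le_trans x6); rewrite mulrAC ler_peMr// mulr_ge0//; exact: ltW.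
have /discE z1 := dz; have /discE u1 := du.
have s5 : 5 / 6 <= cabs z * cabs u.
  by have := cabs_1B_ge z1 u1; rewrite -/x; lra.
have z0 : z != 0.
  by rewrite -cabs_gt0 lt_neqAle cabs_ge0 andbT; apply/eqP => h; move: s5; rewrite -h mul0r; lra.
have u0 : u != 0.
  by rewrite -cabs_gt0 lt_neqAle cabs_ge0 andbT; apply/eqP => h; move: s5; rewrite -h mulr0; lra.
have [g hg] := arg_dist_le dz du (le_trans (ltac:(lra) : 4^-1 <= 5 / 6 :> R) s5).
rewrite mulrBl -!ang_false -/x in hg.
have exj : exists j, sd j <= 6 * x.
  exists (Num.truncn (6 * x)^-1).+1; set n := _.+1.
  have hn : (6 * x)^-1 <= n%:R by apply/ltW/truncnS_gt.
  have x60 : 0 < 6 * x by rewrite mulr_gt0.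
  rewrite /side -[leRHS]invrK lef_pV2 ?posrE ?invr_gt0 ?ltr0n ?split_gt0//.
  apply: (le_trans hn); rewrite ler_nat /split -expnM.
  apply: (@leq_trans (2 ^ n)); first by rewrite ltnW// ltn_expl.
  by rewrite leq_exp2l// leq_pmull.
case: (ex_minnP exj) => -[|j] hj jmin; first by move: hj; rewrite side0; lra.
have {jmin} hj' : 6 * x < sd j.
  by rewrite ltNge; apply/negP => /jmin; rewrite ltnn.
have js : sd j <= 6 * K%:R * x.
  rewrite -(mulrA 6) [K%:R * x]mulrC mulrA -ler_pdivrMr ?(lt_le_trans ltr01 sp)//.
  by rewrite -sideS.
have xj : x <= sd j by lra.
have zj : 1 - sd j <= cabs z by have := cabs_1B_radius dz du; rewrite -/x; lra.
have uj : 1 - sd j <= cabs u.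
  by have := cabs_1B_radius du dz; rewrite -cabs_1BC -/x; lra.
pose M := (K ^ j)%N.
have M0 : 0 < M%:R :> R by rewrite ltr0n split_gt0.
have Ms : M%:R * sd j = 1 by rewrite mulrC side_split.
have Mx : M%:R * (6 * x) < 1 by rewrite -[ltRHS]Ms ltr_pM2l.
have main s : Num.floor (M%:R * ang s z) = Num.floor (M%:R * ang s u) ->
    exists s j k, [/\ box m s j k z, box m s j k u & sd j <= 6 * K%:R * x].
  move=> e; have [k ks ek] := floor_ang m s j z; exists s, j, k; split => //.
    by split => //; rewrite floor_angE ek.
  by split => //; rewrite floor_angE -e ek.
pose a := M%:R * ang false z; pose b := M%:R * (ang false u + g%:~R).
have ab : `|a - b| < 3^-1.
  rewrite -mulrBr opprD addrA normrM gtr0_norm//.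
  apply: (@le_lt_trans _ _ (M%:R * (2 * x))); first by rewrite ler_pM2l.
  by move: Mx; lra.
have shift (c : R) (e : int) :
    Num.floor (M%:R * (c + e%:~R)) = Num.floor (M%:R * c) + M%:Z * e.
  have -> : M%:R * (c + e%:~R) = M%:R * c + (M%:Z * e)%:~R.
    by rewrite mulrDr intrM -pmulrn.
  by rewrite floorDrz ?intrKfloor// intr_int.
have [h|h] := third_trick (split_coprime3 j) ab.
  apply: (main false); apply: (@floor_period _ M _ _ g); rewrite ?(split_ang_itv m)//.
  by rewrite h /b shift.
apply: (main true).
have [e he] := ang_true z0; have [f hf] := ang_true u0.
apply: (@floor_period _ M _ _ (g + e - f)); rewrite ?(split_ang_itv m)//.
rewrite he hf !shift.
have -> : M%:R * (ang false z - 3^-1) = a - M%:R / 3 by rewrite /a mulrBr.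
rewrite h /b.
have -> : M%:R * (ang false u + g%:~R) - M%:R / 3 =
          M%:R * ((ang false u - 3^-1) + g%:~R) by ring.
by rewrite shift; ring.
Qed.

End GridCover.


Section GridMass.
Context {R : realType}.
Variable om : {finite_measure set (measurableTypeR R) -> \bar R}.
Local Notation mu := (polar_measure om).
Local Notation W := (bmass om).

Lemma annulus_mass (x y : R) : 0 <= y -> y <= x ->
  om [set` `[(1 - x), (1 - y)[] = (W x - W y)%:E.
Proof.
move=> y0 yx; have E : (W x)%:E = (om [set` `[(1 - x)%R, (1 - y)%R[] + (W y)%:E)%E.
  rewrite -!bmassE /tail -measureU; [|exact: measurable_itv|exact: measurable_itv|].
    congr (om _); apply/seteqP; split => r /=; rewrite !in_itv/=.
      by move=> /andP[r0 r1]; have [h|h] := ltP r (1 - y); [left|right]; apply/andP.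
    by case=> /andP[h1 h2]; apply/andP; split; lra.
  apply/seteqP; split => // r /= []; rewrite !in_itv/= => /andP[_ h1] /andP[h2 _].
  by move: h1 h2; lra.
by rewrite EFinB E addeK.
Qed.

Lemma bmass_half : class_R om -> exists2 c : R, 0 < c &
  forall x, 0 < x -> x <= 1 -> c * W x <= W (x / 2).
Proof.
move=> hom; have [C [N [C0 hC]]] := bmass_doubling hom.
exists (C * 2 ^+ N)^-1; first by rewrite invr_gt0 mulr_gt0 ?exprn_gt0.
move=> x x0 x1; rewrite ler_pdivrMl ?mulr_gt0 ?exprn_gt0//.
have := hC (x / 2) x ltac:(lra) ltac:(lra) x1.
by rewrite (_ : x / (x / 2) = 2)//; field; rewrite gt_eqF.
Qed.

(** By the decay of the tail, the annulus that separates a box from its children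
    carries a fixed share of its mass. *)
Lemma topbox_mass m : class_R om -> (0 < m)%N ->
  (forall x, 0 < x -> x <= 1 -> W (x / 2 ^+ m) <= 2^-1 * W (x / 2)) ->
  exists2 c : R, 0 < c & forall s j k, (k < split m ^ j)%N ->
    ((c * (side m j * W (side m j)))%:E <= mu (topbox m s j k))%E.
Proof.
move=> hom m0 hm; have [c c0 hc] := bmass_half hom.
have p0 := @pi_gt0 R.
exists (c * pi / 4) => [|s j k kj]; first by rewrite divr_gt0 ?mulr_gt0.
have s0 := @side_gt0 R m j; have s1 := @side_le1 R m j.
have sS : side m j.+1 = side m j / 2 ^+ m :> R by rewrite sideS natrX.
have P2 : 2 <= 2 ^+ m :> R by rewrite -[leLHS]expr1 ler_eXn2l// ltr1n.
have sS2 : side m j.+1 <= side m j / 2 :> R.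
  by rewrite sS ler_pM2l// lef_pV2 ?posrE ?exprn_gt0.
have sS0 := @side_gt0 R m j.+1.
pose a : R := cut s + 2 * pi * (k%:R * side m j).
have := @polar_measure_rect R om (topbox m s j k) (1 - side m j / 2)
  (1 - side m j.+1) a (a + 2 * pi * side m j) (@measurable_topbox R m s j k).
have ea (b : R) : a + b - a = b by rewrite addrAC subrr add0r.
rewrite annulus_mass ?(ltW sS0)// -EFinM !ea.
move=> H; apply: le_trans (H _ _ _ _ _); first last.
- move=> r t /andP[r1 r2] /andP[t1 t2].
  have r0 : 0 < r by lra.
  have kj' : k%:R * side m j + side m j <= 1 :> R.
    rewrite -[X in _ + X]mul1r -mulrDl natr1.
    by rewrite -[leRHS](@side_split R m j) mulrC ler_pM2l// ler_nat.
  have E : cabs (r%:C * expi t) = r.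
    by rewrite cabsM cabs_expi mulr1 cabs_real gtr0_norm.
  have k0 : 0 <= k%:R * side m j :> R by rewrite mulr_ge0 ?(ltW s0).
  have k2 : 2 * pi * (k%:R * side m j) + 2 * pi * side m j <= 2 * pi :> R.
    by rewrite -mulrDr ler_piMr//; lra.
  have k3 : 0 <= 2 * pi * (k%:R * side m j) :> R by rewrite mulr_ge0//; lra.
  rewrite /topbox /box /= E; split; last by lra.
  split; [lra|lra|].
  rewrite ang_polar//; last by apply/andP; move: t1 t2; rewrite /a; split; lra.
  have Ks : (split m ^ j)%:R = (side m j)^-1 :> R by rewrite /side invrK.
  rewrite Ks mulrC -mulrA -invfM ler_pdivlMr ?mulr_gt0// ltr_pdivrMr ?mulr_gt0//.
  rewrite -natr1; move: t1 t2; rewrite /a => t1 t2; apply/andP; split; lra.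
- by rewrite ler_piMr//; lra.
- by rewrite lerDl mulr_ge0//; lra.
- by lra.
- by lra.
rewrite lee_fin; have := hc _ s0 s1; have := hm _ s0 s1; rewrite -sS => h1 h2.
have -> : c * pi / 4 * (side m j * W (side m j)) = (c * W (side m j)) * (pi * side m j / 4).
  by ring.
have -> : 2 * pi * side m j / 4 = 2 * (pi * side m j / 4) :> R by ring.
rewrite [leRHS]mulrA; apply: ler_wpM2r; last by lra.
by rewrite divr_ge0// mulr_ge0//; exact: ltW.
Qed.

Lemma carleson_mass_le a l : 0 < l -> l <= 1 ->
  (mu (carleson a l) <= (4 * pi * (l * W l))%:E)%E.
Proof.
move=> l0 l1; apply: (le_trans (polar_measure_carleson_le om a l0 l1)).
by rewrite bmassE -EFinM lee_fin mulrC mulrA.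
Qed.

Lemma carleson_mass_ge : class_R om -> exists2 c : R, 0 < c &
  forall a l, 0 < l -> l <= 1 -> ((c * (l * W l))%:E <= mu (carleson a l))%E.
Proof.
move=> hom; have [c c0 hc] := bmass_half hom; have p0 := @pi_gt0 R.
exists (c * pi / 2) => [|a l l0 l1]; first by rewrite divr_gt0 ?mulr_gt0.
have := @polar_measure_rect R om (carleson a l) (1 - l / 2) 1
  a (a + 2 * pi * l) (measurable_carleson a l0 l1).
rewrite -[[set` `[(1 - l / 2), 1[]]/([set` `[1 - l / 2, 1[]) -/(tail om (1 - l / 2)) bmassE.
have ea (b : R) : a + b - a = b by rewrite addrAC subrr add0r.
rewrite -EFinM !ea.
move=> H; apply: le_trans (H _ _ _ _ _); first last.
- move=> r t /andP[r1 r2] /andP[t1 t2].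
  exists r; first by rewrite /= in_itv/=; apply/andP; split; lra.
  by exists (expi t) => //; exists t => //=; rewrite in_itv/= t1 ltW.
- by rewrite ler_piMr//; lra.
- by rewrite lerDl mulr_ge0//; lra.
- by lra.
- by lra.
rewrite lee_fin; have h := hc _ l0 l1.
have -> : c * pi / 2 * (l * W l) = (c * W l) * (2 * pi * l / 4).
  by field.
by rewrite ler_wpM2r// divr_ge0// mulr_ge0//; lra.
Qed.

Lemma box_mass_le m s j k : (mu (box m s j k) <= (4 * pi * (side m j * W (side m j)))%:E)%E.
Proof.
have s0 := @side_gt0 R m j; have s1 := @side_le1 R m j.
apply: le_trans (carleson_mass_le (cut s + 2 * pi * (k%:R * side m j)) s0 s1).
apply: le_measure; rewrite ?inE; [exact: measurable_box|exact: measurable_carleson|].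
exact: box_sub_carleson.
Qed.

End GridMass.


(** * Integrals of complex-valued functions *)

Section ComplexIntegral.
Context {R : realType} d (T : measurableType d).
Variable mu : {measure set T -> \bar R}.
Variable D : set T.
Hypothesis mD : measurable D.
Implicit Types f g : T -> R[i].

Lemma integrable_scale (a : R) (h : T -> R) :
  mu.-integrable D (EFin \o h) -> mu.-integrable D (EFin \o (fun x => a * h x)).
Proof.
move=> ih; rewrite (_ : _ \o _ = (fun x => a%:E * (h x)%:E)%E).
  exact: integrableZl.
by apply/funext => x; rewrite /= EFinM.
Qed.

Lemma integrable_add (h k : T -> R) :
  mu.-integrable D (EFin \o h) -> mu.-integrable D (EFin \o k) ->
  mu.-integrable D (EFin \o (fun x => h x + k x)).
Proof.
move=> ih ik; rewrite (_ : _ \o _ = (EFin \o h) \+ (EFin \o k))%E.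
  exact: integrableD.
by apply/funext => x; rewrite /= EFinD.
Qed.

Lemma cintegrable_measurable f : cintegrable mu D f -> measurable_fun D f.
Proof.
move=> [/measurable_int/measurable_EFinP h1 /measurable_int/measurable_EFinP h2].
exact/measurable_fun_complexP.
Qed.

Lemma le_cintegrable f (h : T -> R) : measurable_fun D f ->
  (forall x, D x -> cabs (f x) <= h x) ->
  mu.-integrable D (fun x => (h x)%:E) -> cintegrable mu D f.
Proof.
move=> mf fh ih; split; apply: le_integrable ih => //.
- by apply/measurable_EFinP; exact: measurable_fun_Re.
- move=> x Dx; rewrite lee_fin; apply: le_trans (Re_le_cabs _) _.
  by rewrite (le_trans (fh _ Dx))// ler_norm.
- by apply/measurable_EFinP; exact: measurable_fun_Im.
- move=> x Dx; rewrite lee_fin; apply: le_trans (Im_le_cabs _) _.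
  by rewrite (le_trans (fh _ Dx))// ler_norm.
Qed.

Lemma cintegrable_cabs f : cintegrable mu D f ->
  mu.-integrable D (fun x => (cabs (f x))%:E).
Proof.
move=> fi; have mf := cintegrable_measurable fi; case: fi => fr fi.
apply: (@le_integrable _ _ _ mu D mD _ (fun x =>
    (`|complex.Re (f x)| + `|complex.Im (f x)|)%:E)).
- by apply/measurable_EFinP; exact: measurable_cabs.
- move=> x Dx; rewrite lee_fin (ger0_norm (cabs_ge0 _)).
  by apply: (le_trans (cabs_le_ReIm _)); exact: ler_norm.
- by under eq_fun do rewrite EFinD; apply: integrableD => //;
    [apply: (integrable_abse fr)|apply: (integrable_abse fi)].
Qed.

(** The factor 2 is the price of bounding the real and the imaginary parts
    separately. *)
Lemma cabs_cintegral_le f : cintegrable mu D f ->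
  cabs (cintegral mu D f) <= 2 * \int[mu]_(x in D) cabs (f x).
Proof.
move=> fi; have fc := cintegrable_cabs fi; case: fi => fr fi.
apply: le_trans (cabs_le_ReIm _) _; rewrite /cintegral /= mulr_natl mulr2n.
apply: lerD; (apply: le_trans (le_normr_Rintegral _ _) _ => //; apply: le_Rintegral => //).
- exact: (integrable_abse fr).
- by move=> x _; exact: Re_le_cabs.
- exact: (integrable_abse fi).
- by move=> x _; exact: Im_le_cabs.
Qed.

Lemma cintegralB f g : cintegrable mu D f -> cintegrable mu D g ->
  cintegral mu D (fun x => f x - g x) = cintegral mu D f - cintegral mu D g.
Proof.
move=> [fr fi] [gr gi]; rewrite /cintegral.
have -> : (fun x => complex.Re (f x - g x)) =
          (fun x => complex.Re (f x) - complex.Re (g x)).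
  by apply/funext => x; rewrite ReD; case: (g x).
have -> : (fun x => complex.Im (f x - g x)) =
          (fun x => complex.Im (f x) - complex.Im (g x)).
  by apply/funext => x; rewrite ImD; case: (g x).
by rewrite !RintegralB.
Qed.

Lemma cintegralZl (c : R[i]) f : cintegrable mu D f ->
  cintegral mu D (fun x => c * f x) = c * cintegral mu D f.
Proof.
move=> [fr fi]; rewrite /cintegral.
have -> : (fun x => complex.Re (c * f x)) =
  (fun x => complex.Re c * complex.Re (f x) - complex.Im c * complex.Im (f x)).
  by apply/funext => x; rewrite ReM.
have -> : (fun x => complex.Im (c * f x)) =
  (fun x => complex.Re c * complex.Im (f x) + complex.Im c * complex.Re (f x)).
  by apply/funext => x; rewrite ImM.
rewrite RintegralB ?RintegralD ?RintegralZl//; try exact: integrable_scale.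
by case: c.
Qed.

Lemma cintegrableZl (c : R[i]) f : cintegrable mu D f ->
  cintegrable mu D (fun x => c * f x).
Proof.
move=> fi; have mf := cintegrable_measurable fi.
apply: (@le_cintegrable _ (fun x => cabs c * cabs (f x))).
- by apply: measurable_funMc.
- by move=> x _; rewrite cabsM.
- under eq_fun do rewrite EFinM.
  by apply: integrableZl => //; exact: cintegrable_cabs.
Qed.

Lemma cintegrableB f g : cintegrable mu D f -> cintegrable mu D g ->
  cintegrable mu D (fun x => f x - g x).
Proof.
move=> [fr fi] [gr gi]; split.
  have -> : (fun x => (complex.Re (f x - g x))%:E) =
            (fun x => (complex.Re (f x))%:E - (complex.Re (g x))%:E)%E.
    by apply/funext => x; rewrite ReD -EFinB; case: (g x).
  exact: integrableB.
have -> : (fun x => (complex.Im (f x - g x))%:E) =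
          (fun x => (complex.Im (f x))%:E - (complex.Im (g x))%:E)%E.
  by apply/funext => x; rewrite ImD -EFinB; case: (g x).
exact: integrableB.
Qed.

Lemma eq_cintegral f g : (forall x, D x -> f x = g x) ->
  cintegral mu D f = cintegral mu D g.
Proof.
by move=> fg; congr Complex; apply: eq_Rintegral => x; rewrite inE => /fg ->.
Qed.

Lemma cintegral_real (h : T -> R) :
  cintegral mu D (fun x => (h x)%:C) = (\int[mu]_(x in D) h x)%:C.
Proof. by rewrite /cintegral /= Rintegral_cst// mul0r. Qed.

End ComplexIntegral.


(** * The size and the oscillation of the kernel *)

Section Stieltjes.
Context {R : realType}.
Variable nu : {measure set (measurableTypeR R) -> \bar R}.
Local Notation D := ([set` `[0, 1]] : set (measurableTypeR R)).
Hypothesis nuD : (nu D < +oo)%E.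
Implicit Types (w : R[i]) (r x : R).

Let mD : measurable D. Proof. exact: measurable_itv. Qed.

Definition resolvent w r : R[i] := (1 - r%:C * w)^-1.
Definition cauchy w : R[i] := cintegral nu D (resolvent w).

(** Up to constants, this function of |1 - w| is the modulus of [cauchy w]. *)
Definition stieltjes x : R := \int[nu]_(r in D) ((1 - r) + x)^-1.

Lemma Re_one_sub w r : complex.Re (1 - r%:C * w) = 1 - r * complex.Re w.
Proof. by case: w => a b /=; rewrite mul0r subr0. Qed.

Lemma Im_one_sub w r : complex.Im (1 - r%:C * w) = - (r * complex.Im w).
Proof. by case: w => a b /=; rewrite mul0r addr0 sub0r. Qed.

Lemma measurable_resolvent w : measurable_fun D (resolvent w).
Proof.
apply: measurable_invc => //; apply: measurable_oneB => //.
by apply: measurable_funMc => //; exact: measurable_real.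
Qed.

Lemma one_sub_ge w r : cabs w <= 1 -> 0 <= r <= 1 ->
  (1 - r) + cabs (1 - w) <= 3 * cabs (1 - r%:C * w).
Proof.
move=> w1 /andP[r0 r1].
have h1 : 1 - r <= cabs (1 - r%:C * w).
  have := cabs_dist 1 (r%:C * w); rewrite cabs1 cabsM cabs_real ger0_norm//.
  by apply: le_trans; rewrite lerD2l lerN2 ler_piMr.
have h2 : cabs (1 - w) <= cabs (1 - r%:C * w) + (1 - r).
  have -> : 1 - w = (1 - r%:C * w) - (1 - r)%:C * w.
    by rewrite (rmorphB (real_complex R)) rmorph1; ring.
  apply: le_trans (cabsB _ _) _; rewrite lerD2l cabsM cabs_real ger0_norm; last lra.
  by rewrite ler_piMr//; lra.
lra.
Qed.

Lemma one_sub_le w r : 0 <= r <= 1 ->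
  cabs (1 - r%:C * w) <= (1 - r) + cabs (1 - w).
Proof.
move=> /andP[r0 r1].
have -> : 1 - r%:C * w = (1 - r)%:C + r%:C * (1 - w).
  by rewrite (rmorphB (real_complex R)) rmorph1; ring.
apply: le_trans (cabsD _ _) _; rewrite cabsM !cabs_real !ger0_norm//; last lra.
by rewrite lerD2l ler_piMl ?cabs_ge0.
Qed.

Lemma one_sub_gt0 w r : cabs w < 1 -> 0 <= r <= 1 -> 0 < cabs (1 - r%:C * w).
Proof.
move=> w1 /andP[r0 r1]; have := cabs_dist 1 (r%:C * w).
rewrite cabs1; apply: lt_le_trans; rewrite subr_gt0 cabsM cabs_real ger0_norm//.
by apply: le_lt_trans w1; rewrite ler_piMl ?cabs_ge0.
Qed.

Lemma one_sub_w_gt0 w : cabs w < 1 -> 0 < cabs (1 - w).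
Proof. by move=> w1; have := @one_sub_gt0 w 1 w1; rewrite mul1r; apply; lra. Qed.

Lemma bounded_integrable (f : R -> R) (M : R) : measurable_fun D f ->
  (forall r, 0 <= r <= 1 -> `|f r| <= M) -> nu.-integrable D (EFin \o f).
Proof.
move=> mf fM; apply: measurable_bounded_integrable => //.
exists M; split; first exact: num_real.
move=> y My r /=; rewrite in_itv/= => /fM h; exact: le_trans h (ltW My).
Qed.

Lemma integrable_cabs_resolvent w : cabs w < 1 ->
  nu.-integrable D (EFin \o (fun r => cabs (resolvent w r))).
Proof.
move=> w1; have w0 := one_sub_w_gt0 w1.
apply: (@bounded_integrable _ (3 / cabs (1 - w))).
  by apply: measurable_cabs => //; exact: measurable_resolvent.
move=> r r01; have := one_sub_ge (ltW w1) r01; have h := one_sub_gt0 w1 r01 => h1.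
rewrite ger0_norm ?cabs_ge0// cabsV ler_pdivlMr// mulrC ler_pdivrMr//.
by move: r01 => /andP[? ?]; lra.
Qed.

Lemma integrable_stieltjes x : 0 < x ->
  nu.-integrable D (EFin \o (fun r => ((1 - r) + x)^-1)).
Proof.
move=> x0; apply: (@bounded_integrable _ x^-1).
  by apply: measurable_inv; apply: measurable_funD => //; apply: measurable_funB.
move=> r /andP[r0 r1]; rewrite ger0_norm ?invr_ge0; last lra.
by rewrite lef_pV2 ?posrE//; lra.
Qed.

Lemma cintegrable_resolvent w : cabs w < 1 -> cintegrable nu D (resolvent w).
Proof.
move=> w1; apply: (@le_cintegrable _ _ _ nu D mD _ (fun r => cabs (resolvent w r))) => //.
- exact: measurable_resolvent.
- exact: integrable_cabs_resolvent.
Qed.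

Lemma resolvent_le w r : cabs w < 1 -> 0 <= r <= 1 ->
  cabs (resolvent w r) <= 3 * ((1 - r) + cabs (1 - w))^-1.
Proof.
move=> w1 r01; have w0 := one_sub_w_gt0 w1.
have h := one_sub_gt0 w1 r01; have h1 := one_sub_ge (ltW w1) r01.
rewrite cabsV ler_pdivlMr; last by move: r01 => /andP[? ?]; lra.
by rewrite mulrC ler_pdivrMr.
Qed.

Lemma int_resolvent_le w : cabs w < 1 ->
  \int[nu]_(r in D) cabs (resolvent w r) <= 3 * stieltjes (cabs (1 - w)).
Proof.
move=> w1; have w0 := one_sub_w_gt0 w1.
rewrite -RintegralZl//; last exact: integrable_stieltjes.
apply: le_Rintegral => //.
- exact: integrable_cabs_resolvent.
- by apply: integrable_scale => //; exact: integrable_stieltjes.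
- by move=> r /=; rewrite in_itv/= => r01; exact: resolvent_le.
Qed.

Lemma int_resolvent_ge w : cabs w < 1 ->
  stieltjes (cabs (1 - w)) <= \int[nu]_(r in D) cabs (resolvent w r).
Proof.
move=> w1; have w0 := one_sub_w_gt0 w1.
apply: le_Rintegral => //.
- exact: integrable_stieltjes.
- exact: integrable_cabs_resolvent.
- move=> r /=; rewrite in_itv/= => r01; rewrite cabsV lef_pV2 ?posrE//.
  + exact: one_sub_le.
  + by move: r01 => /andP[? ?]; lra.
  + exact: one_sub_gt0.
Qed.

(** All values of the integrand lie in one closed quadrant (of positive real
    part, with an imaginary part of the sign of [Im w]), so that no
    cancellation occurs in the integral. *)
Lemma cauchy_ge w : cabs w < 1 ->
  \int[nu]_(r in D) cabs (resolvent w r) <= 2 * cabs (cauchy w).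
Proof.
move=> w1.
have [ir ii] := cintegrable_resolvent w1; have ic := integrable_cabs_resolvent w1.
have Re0 r : 0 <= r <= 1 -> 0 <= complex.Re (resolvent w r).
  move=> r01; rewrite /resolvent ReV divr_ge0 ?sqr_ge0// Re_one_sub.
  move: r01 => /andP[r0 r1]; rewrite subr_ge0.
  have : complex.Re w <= 1.
    by apply: le_trans (ltW w1); apply: le_trans (Re_le_cabs w); exact: ler_norm.
  by move=> h; apply: le_trans (ler_wpM2l r0 h) _; rewrite mulr1.
have ImE r : 0 <= r <= 1 ->
    complex.Im (resolvent w r) = complex.Im w * (r / cabs (1 - r%:C * w) ^+ 2).
  by move=> r01; rewrite /resolvent ImV Im_one_sub opprK; ring.
have pt r : D r -> cabs (resolvent w r) <=
    complex.Re (resolvent w r) + `|complex.Im (resolvent w r)|.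
  rewrite /= in_itv/= => r01; apply: le_trans (cabs_le_ReIm _) _.
  by rewrite ger0_norm// Re0.
have iI : nu.-integrable D (EFin \o (fun r => `|complex.Im (resolvent w r)|)).
  exact: (integrable_abse ii).
apply: (@le_trans _ _ (\int[nu]_(r in D) (complex.Re (resolvent w r) +
    `|complex.Im (resolvent w r)|))).
  by apply: le_Rintegral => //; apply: integrable_add.
rewrite RintegralD// mulr_natl mulr2n; apply: lerD.
  by apply: le_trans (Re_le_cabs _); exact: ler_norm.
apply: le_trans (Im_le_cabs _); rewrite /cauchy /cintegral /=.
have [Iw|Iw] := leP 0 (complex.Im w).
  apply: le_trans (ler_norm _); apply: le_Rintegral => //.
  move=> r /=; rewrite in_itv/= => r01; rewrite ger0_norm// ImE// mulr_ge0//.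
  by rewrite divr_ge0 ?sqr_ge0//; case/andP: r01.
rewrite -normrN; apply: le_trans (ler_norm _).
rewrite -mulN1r -RintegralZl//; apply: le_Rintegral => //.
  exact: integrable_scale.
move=> r /=; rewrite in_itv/= => r01; rewrite mulN1r ler0_norm// ImE//.
rewrite mulr_le0_ge0 ?(ltW Iw)// divr_ge0 ?sqr_ge0//; by case/andP: r01.
Qed.

Lemma cauchy_le w : cabs w < 1 -> cabs (cauchy w) <= 6 * stieltjes (cabs (1 - w)).
Proof.
move=> w1; have := cabs_cintegral_le mD (cintegrable_resolvent w1).
by have := int_resolvent_le w1; rewrite /cauchy; lra.
Qed.

Lemma stieltjes_le_cauchy w : cabs w < 1 ->
  stieltjes (cabs (1 - w)) <= 2 * cabs (cauchy w).
Proof. by move=> w1; apply: le_trans (int_resolvent_ge w1) (cauchy_ge w1). Qed.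

(** By the resolvent identity the increment is r (w - w0) times a product of two
    resolvents, one of which is at most of the order of 1 / |1 - w0|. *)
Lemma cauchy_osc w w0 (e : R) : cabs w < 1 -> cabs w0 < 1 -> e <= 2^-1 ->
  cabs (w - w0) <= e * cabs (1 - w0) ->
  cabs (cauchy w - cauchy w0) <= 24 * e * cabs (cauchy w0).
Proof.
move=> w1 w01 e2 ww; have p0 := one_sub_w_gt0 w01.
have p1 : cabs (1 - w0) <= 2 * cabs (1 - w).
  have : cabs (1 - w0) <= cabs (1 - w) + cabs (w - w0).
    have -> : 1 - w0 = (1 - w) + (w - w0) by ring.
    exact: cabsD.
  have : e * cabs (1 - w0) <= 2^-1 * cabs (1 - w0) by rewrite ler_wpM2r ?cabs_ge0.
  by move: ww; lra.
have e0 : 0 <= e by rewrite -(pmulr_lge0 _ p0); exact: le_trans (cabs_ge0 _) ww.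
have i1 := cintegrable_resolvent w1; have i0 := cintegrable_resolvent w01.
rewrite -cintegralB//; apply: le_trans (cabs_cintegral_le mD (cintegrableB mD i1 i0)) _.
suff : \int[nu]_(r in D) cabs (resolvent w r - resolvent w0 r) <=
    6 * e * \int[nu]_(r in D) cabs (resolvent w0 r).
  have h : e * \int[nu]_(r in D) cabs (resolvent w0 r) <= e * (2 * cabs (cauchy w0)).
    by apply: ler_wpM2l => //; exact: cauchy_ge.
  by lra.
have ic0 := integrable_cabs_resolvent w01.
rewrite -RintegralZl//; apply: le_Rintegral => //.
- exact: cintegrable_cabs (cintegrableB mD i1 i0).
- exact: integrable_scale.
move=> r /=; rewrite in_itv/= => r01.
have q0 := one_sub_gt0 w01 r01; have q1 := one_sub_gt0 w1 r01.
have n0 : 1 - r%:C * w0 != 0 by rewrite -cabs_gt0.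
have n1 : 1 - r%:C * w != 0 by rewrite -cabs_gt0.
have -> : resolvent w r - resolvent w0 r =
    r%:C * (w - w0) * (resolvent w r) * resolvent w0 r.
  by rewrite /resolvent; field; apply/andP.
rewrite !cabsM ler_wpM2r ?cabs_ge0// cabsV ler_pdivrMr//.
have q := one_sub_ge (ltW w1) r01; case/andP: r01 => r0 r1.
have h : cabs (1 - w0) <= 6 * cabs (1 - r%:C * w) by lra.
rewrite cabs_real ger0_norm//.
apply: (@le_trans _ _ (1 * (e * cabs (1 - w0)))).
  by apply: ler_pM; rewrite ?cabs_ge0.
by rewrite mul1r [6 * e]mulrC -mulrA ler_wpM2l.
Qed.

End Stieltjes.


Section ComplexPower.
Context {R : realType}.
Implicit Types (q : R[i]) (g e x : R).

Lemma cabs_cpow q g : cabs (cpow q g) = cabs q `^ g.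
Proof. by rewrite cabsM cabs_expi mulr1 cabs_real ger0_norm ?powR_ge0. Qed.

Lemma polar_atan q : 0 < complex.Re q ->
  q = (cabs q)%:C * expi (atan (complex.Im q / complex.Re q)).
Proof.
move=> q0; set x := _ / _.
have c0 : cabs q = complex.Re q * Num.sqrt (1 + x ^+ 2).
  rewrite -[X in X * _](gtr0_norm q0) -sqrtr_sqr -sqrtrM ?sqr_ge0// cabsE.
  by congr Num.sqrt; rewrite mulrDr mulr1 -exprMn /x mulrC divfK ?gt_eqF.
have s0 : 0 < Num.sqrt (1 + x ^+ 2) by rewrite sqrtr_gt0 ltr_pwDl ?sqr_ge0.
have ec : cos (atan x) = (Num.sqrt (1 + x ^+ 2))^-1 by rewrite cos_atan.
have es : sin (atan x) = x * cos (atan x).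
  by rewrite -[X in X * _](atanK x) /tan divfK// ec invr_neq0// gt_eqF.
have ei : complex.Im q = x * complex.Re q by rewrite /x divfK// gt_eqF.
rewrite /expi es ec c0; apply/eqP; rewrite eq_complex /= ei.
by apply/andP; split; apply/eqP; field; rewrite gt_eqF.
Qed.

Lemma expi_near1 x e : - pi < x < pi -> e < 2^-1 ->
  cabs (expi x - 1) <= 2 * e -> `|x| <= 8 * e.
Proof.
move=> /andP[x1 x2] e2 h; have p0 := @pi_gt0 R.
have hc : `|cos x - 1| <= 2 * e.
  by apply: le_trans h; apply: le_trans (Re_le_cabs _).
have hs : `|sin x| <= 2 * e.
  by apply: le_trans h; apply: le_trans (Im_le_cabs _); rewrite /= subr0.
have xp : `|x| <= pi / 2.
  rewrite leNgt; apply/negP => xp.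
  have : cos `|x| < cos (pi / 2).
    rewrite ltr_cos ?in_itv/= ?normr_ge0 ?ler_norml//=.
      by apply/andP; split; lra.
    by apply/andP; split; lra.
  rewrite cos_norm cos_pihalf; move: hc; rewrite ler_norml => /andP[]; lra.
have : `|x| / 4 <= sin `|x| by apply: sin_ge_quarter; rewrite normr_ge0.
have -> : sin `|x| = `|sin x|.
  have [y0|y0] := ler0P x.
    rewrite sinN ler0_norm// -oppr_ge0 -sinN sin_ge0_pi//.
    by apply/andP; split; lra.
  by rewrite ger0_norm// sin_ge0_pi//; apply/andP; split; lra.
lra.
Qed.

Lemma bernoulli_ge e n : 0 <= e -> e <= 1 -> 1 - n%:R * e <= (1 - e) ^+ n.
Proof.
move=> e0 e1; elim: n => [|n IH]; first by rewrite mul0r subr0 expr0.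
have h : (1 - e) * (1 - n%:R * e) <= (1 - e) ^+ n.+1.
  by rewrite exprS ler_wpM2l//; lra.
apply: le_trans h; rewrite -natr1.
have : 0 <= n%:R * e ^+ 2 by rewrite mulr_ge0 ?sqr_ge0.
lra.
Qed.

Lemma powRN_near1 (s g e : R) n : 0 <= g -> g <= n%:R -> 0 <= e ->
  n%:R * e <= 2^-1 -> e <= 2^-1 -> `|s - 1| <= e ->
  `|s `^ (- g) - 1| <= 2 * n%:R * e.
Proof.
move=> g0 gn e0 ne e2; rewrite ler_norml => /andP[s1 s2].
have b := bernoulli_ge n e0 (le_trans e2 (ltac:(lra) : 2^-1 <= 1 :> R)).
have s0 : 0 < s by lra.
have nn : n%:R * e >= 0 by rewrite mulr_ge0.
rewrite powRN ler_norml; have P0 : 0 < s `^ g by rewrite powR_gt0.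
have [h|h] := leP 1 s.
  have P1 : 1 <= s `^ g by rewrite -[leLHS](powRr0 s) ler_powR.
  have Pn : s `^ g <= s ^+ n by rewrite -powR_mulrn ?(ltW s0)// ler_powR.
  have sn : s ^+ n * (1 - e) ^+ n <= 1.
    by rewrite -exprMn exprn_ile1// ?mulr_ge0//; nra.
  have : s `^ g * (1 - n%:R * e) <= 1.
    apply: le_trans sn; apply: ler_pM => //; lra.
  move=> k; have : 1 - n%:R * e <= (s `^ g)^-1.
    by rewrite -div1r ler_pdivlMr// mulrC.
  have : (s `^ g)^-1 <= 1 by rewrite invf_le1.
  by move=> k1 k2; apply/andP; split; lra.
have P1 : s `^ g <= 1 by rewrite -[leRHS](powRr0 s) ger_powR ?s0 ?(ltW h).
have Pn : (1 - e) ^+ n <= s `^ g.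
  apply: (@le_trans _ _ (s ^+ n)).
    by rewrite lerXn2r ?nnegrE//; lra.
  by rewrite -powR_mulrn ?(ltW s0)// ger_powR ?s0 ?(ltW h).
have k1 : 1 <= (s `^ g)^-1 by rewrite invf_ge1.
have k2 : (s `^ g)^-1 <= 1 + 2 * n%:R * e.
  rewrite -[leLHS]div1r ler_pdivrMr//.
  have : (1 + 2 * n%:R * e) * (1 - n%:R * e) <= (1 + 2 * n%:R * e) * s `^ g.
    by rewrite ler_wpM2l//; lra.
  apply: le_trans; nra.
by apply/andP; split; lra.
Qed.

(** Modulus and argument are perturbed separately; the integer [n] above [g]
    makes Bernoulli's inequality available for the modulus. *)
Lemma cpow_osc q q0 g e n : 0 < complex.Re q -> 0 < complex.Re q0 ->
  0 <= g -> g <= n%:R -> n%:R * e <= 2^-1 -> e < 2^-1 ->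
  cabs (q - q0) <= e * cabs q0 ->
  cabs ((cpow q g)^-1 - (cpow q0 g)^-1) <=
    18 * (n%:R * e) * cabs (cpow q0 g)^-1.
Proof.
move=> q1 q01 g0 gn ne e2 qq.
have c1 : 0 < cabs q.
  by apply: lt_le_trans q1 _; apply: le_trans (Re_le_cabs _); exact: ler_norm.
have c0 : 0 < cabs q0.
  by apply: lt_le_trans q01 _; apply: le_trans (Re_le_cabs _); exact: ler_norm.
have e0 : 0 <= e by rewrite -(pmulr_lge0 _ c0); exact: le_trans (cabs_ge0 _) qq.
set th := atan (complex.Im q / complex.Re q).
set th0 := atan (complex.Im q0 / complex.Re q0).
pose f := th - th0; pose s := cabs q / cabs q0.
have Eq : q = (cabs q)%:C * expi th := polar_atan q1.
have Eq0 : q0 = (cabs q0)%:C * expi th0 := polar_atan q01.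
have cc0 : (cabs q0)%:C != 0 :> R[i] by rewrite -cabs_eq0 cabs_cabs gt_eqF.
have Es : q = q0 * (s%:C * expi f).
  rewrite Eq Eq0 /f /s expiD expiN conj_expi.
  have x0 : expi th0 != 0 :> R[i] by rewrite -cabs_eq0 cabs_expi oner_eq0.
  rewrite (rmorphM (real_complex R)) fmorphV; field.
  by apply/andP.
have hs : `|s - 1| <= e.
  rewrite /s -[X in _ - X](@divff _ (cabs q0)) ?gt_eqF// -mulrBl normrM.
  rewrite normfV (gtr0_norm c0) ler_pdivrMr//; apply: le_trans qq.
  rewrite ler_norml; apply/andP; split; last exact: cabs_dist.
  by have := cabs_dist q0 q; rewrite cabsBC; lra.
have ht : cabs (s%:C * expi f - 1) <= e.
  rewrite -(ler_pM2l c0) -cabsM mulrBr mulr1 -Es mulrC; exact: qq.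
have hf : `|f| <= 8 * e.
  apply: expi_near1 => //.
    have := atan_gtNpi2 (complex.Im q / complex.Re q).
    have := atan_gtNpi2 (complex.Im q0 / complex.Re q0).
    have := atan_ltpi2 (complex.Im q / complex.Re q).
    have := atan_ltpi2 (complex.Im q0 / complex.Re q0).
    by rewrite /f /th /th0; move: (atan _) (atan _) => *; apply/andP; split; lra.
  have -> : expi f - 1 = (s%:C * expi f - 1) - (s - 1)%:C * expi f.
    by rewrite (rmorphB (real_complex R)) rmorph1; ring.
  apply: le_trans (cabsB _ _) _; rewrite cabsM cabs_expi mulr1 cabs_real.
  by lra.
have s0 : 0 < s by rewrite divr_gt0.
have Ec : (cpow q g)^-1 = (cpow q0 g)^-1 * ((s `^ (- g))%:C * expi (- (g * f))).
  rewrite /cpow -/th -/th0.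
  have -> : cabs q `^ g = cabs q0 `^ g * s `^ g.
    by rewrite -powRM ?cabs_ge0 ?(ltW s0)// /s mulrC divfK ?gt_eqF.
  have -> : g * th = g * th0 + g * f by rewrite /f; ring.
  rewrite expiD expiN conj_expi (rmorphM (real_complex R)) powRN fmorphV !invfM.
  by ring.
have hV : cabs ((s `^ (- g))%:C * expi (- (g * f)) - 1) <= 18 * (n%:R * e).
  have -> : (s `^ (- g))%:C * expi (- (g * f)) - 1 =
      (s `^ (- g) - 1)%:C * expi (- (g * f)) + (expi (- (g * f)) - expi 0).
    by rewrite (rmorphB (real_complex R)) rmorph1 expi0; ring.
  apply: le_trans (cabsD _ _) _; rewrite cabsM cabs_expi mulr1 cabs_real.
  have k1 := powRN_near1 g0 gn e0 ne (ltW e2) hs.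
  have k2 := expi_dist (- (g * f)) 0.
  have k3 : `|- (g * f) - 0| <= n%:R * (8 * e).
    by rewrite subr0 normrN normrM (ger0_norm g0); apply: ler_pM.
  lra.
rewrite Ec -[X in _ - X]mulr1 -mulrBr cabsM mulrC.
by rewrite ler_wpM2r ?cabs_ge0.
Qed.

End ComplexPower.

Section Kernel.
Context {R : realType}.
Variable nu : {measure set (measurableTypeR R) -> \bar R}.
Hypothesis nuD : (nu [set` `[0%R, 1%R]] < +oo)%E.
Variable g : R.
Hypothesis g1 : 1 <= g.
Implicit Types (w : R[i]) (x y : R).

Definition kernel w : R[i] := (cpow (1 - w) g)^-1 * cauchy nu w.
(** The order of magnitude of [kernel w] when |1 - w| = x. *)
Definition kernel_size x : R := x `^ (- g) * stieltjes nu x.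

Lemma kernel_le w : cabs w < 1 ->
  cabs (kernel w) <= 6 * kernel_size (cabs (1 - w)).
Proof.
move=> w1; rewrite cabsM cabsV cabs_cpow -powRN /kernel_size mulrCA.
by apply: ler_wpM2l; [exact: powR_ge0|exact: cauchy_le].
Qed.

Lemma kernel_ge w : cabs w < 1 ->
  kernel_size (cabs (1 - w)) <= 2 * cabs (kernel w).
Proof.
move=> w1; rewrite cabsM cabsV cabs_cpow -powRN /kernel_size mulrCA.
by apply: ler_wpM2l; [exact: powR_ge0|exact: stieltjes_le_cauchy].
Qed.

Lemma stieltjes_ge0 x : 0 < x -> 0 <= stieltjes nu x.
Proof.
move=> x0; apply: Rintegral_ge0 => r /=; rewrite in_itv/= => /andP[r0 r1].
by rewrite invr_ge0; lra.
Qed.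

Lemma kernel_size_ge0 x : 0 < x -> 0 <= kernel_size x.
Proof. by move=> x0; rewrite mulr_ge0 ?powR_ge0// stieltjes_ge0. Qed.

Lemma kernel_size_le x y : 0 < x -> x <= y -> kernel_size y <= kernel_size x.
Proof.
move=> x0 xy; apply: ler_pM; rewrite ?powR_ge0//.
- by apply: stieltjes_ge0; lra.
- rewrite !powRN lef_pV2 ?posrE ?powR_gt0//; last lra.
  have g0 : 0 <= g := le_trans ler01 g1.
  by apply: ge0_ler_powR => //; rewrite nnegrE ltW//; lra.
apply: le_Rintegral; [exact: measurable_itv|..].
- by apply: integrable_stieltjes => //; lra.
- exact: integrable_stieltjes.
move=> r /=; rewrite in_itv/= => /andP[r0 r1].
by rewrite lef_pV2 ?posrE; lra.
Qed.

Lemma kernel_size_ge x y : 0 < x -> x <= y ->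
  kernel_size x <= (y / x) `^ (g + 1) * kernel_size y.
Proof.
move=> x0 xy; have y0 : 0 < y by lra.
have yx : 0 < y / x by rewrite divr_gt0.
rewrite /kernel_size powRD ?(gt_eqF yx) ?implybT// powRr1 ?(ltW yx)//.
have -> : (y / x) `^ g * (y / x) * (y `^ (- g) * stieltjes nu y) =
    (y / x) `^ g * y `^ (- g) * (y / x * stieltjes nu y) by ring.
have -> : (y / x) `^ g * y `^ (- g) = x `^ (- g).
  rewrite powRM ?invr_ge0 ?(ltW x0) ?(ltW y0)// mulrAC powRN divff ?mul1r.
    by rewrite -powR_inv1 ?(ltW x0)// -powRrM mulN1r.
  by rewrite gt_eqF// powR_gt0.
apply: ler_wpM2l; first exact: powR_ge0.
rewrite -RintegralZl; [|exact: measurable_itv|exact: integrable_stieltjes].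
apply: le_Rintegral; [exact: measurable_itv|..].
- exact: integrable_stieltjes.
- apply: integrable_scale; [exact: measurable_itv|exact: integrable_stieltjes].
move=> r /=; rewrite in_itv/= => /andP[r0 r1].
rewrite ler_pdivlMr; last by lra.
rewrite mulrC ler_pdivrMr; last by lra.
rewrite mulrAC ler_pdivlMr//.
nra.
Qed.

(** On a neighbourhood of [w0] small with respect to |1 - w0|, the kernel keeps
    almost the same modulus and, more importantly, the same argument. *)
Lemma kernel_osc : exists2 e : R, 0 < e & forall w w0, cabs w < 1 -> cabs w0 < 1 ->
  cabs (w - w0) <= e * cabs (1 - w0) ->
  cabs (kernel w - kernel w0) <= 2^-1 * cabs (kernel w0).
Proof.
pose n := (Num.truncn g).+1.
have gn : g <= n%:R by apply/ltW/truncnS_gt.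
have n1 : 1 <= n%:R :> R by rewrite ler1n.
have n0 : 0 < n%:R :> R by exact: lt_le_trans ltr01 n1.
have h120 : 0 < 120 :> R by rewrite ltr0n.
clearbody n; exists (120 * n%:R)^-1 => [|w w0 w1 w01 ww].
  by rewrite invr_gt0; exact: mulr_gt0.
set e := (120 * n%:R)^-1 in ww *.
have ne : n%:R * e = 120^-1.
  by rewrite /e invfM mulrCA divff ?mulr1 ?gt_eqF.
have e0 : 0 < e by rewrite invr_gt0; exact: mulr_gt0.
have e1 : e <= 120^-1 by rewrite -ne ler_peMl ?(ltW e0).
clearbody e.
have Re0 (v : R[i]) : cabs v < 1 -> 0 < complex.Re (1 - v).
  move=> v1; have : complex.Re v < 1.
    by apply: le_lt_trans v1; apply: le_trans (Re_le_cabs _); exact: ler_norm.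
  by case: v {v1} => a b /=; rewrite subr_gt0.
have h1 : cabs ((cpow (1 - w) g)^-1 - (cpow (1 - w0) g)^-1) <=
    18 * (n%:R * e) * cabs (cpow (1 - w0) g)^-1.
  have g0 : 0 <= g := le_trans ler01 g1.
  apply: cpow_osc => //; [exact: Re0|exact: Re0|lra|lra|].
  have -> : 1 - w - (1 - w0) = w0 - w by ring.
  by rewrite cabsBC.
have h2 : cabs (cauchy nu w - cauchy nu w0) <= 24 * e * cabs (cauchy nu w0).
  by apply: cauchy_osc => //; lra.
set A := (cpow (1 - w) g)^-1 in h1 *; set A0 := (cpow (1 - w0) g)^-1 in h1 *.
have -> : kernel w - kernel w0 =
    (A - A0) * cauchy nu w + A0 * (cauchy nu w - cauchy nu w0).
  by rewrite /kernel -/A -/A0; ring.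
rewrite ne in h1.
have h3 : cabs (cauchy nu w) <= 2 * cabs (cauchy nu w0).
  have : cabs (cauchy nu w) <= cabs (cauchy nu w - cauchy nu w0) + cabs (cauchy nu w0).
    by rewrite -[in leLHS](subrK (cauchy nu w0) (cauchy nu w)) cabsD.
  have : 24 * e * cabs (cauchy nu w0) <= 1 * cabs (cauchy nu w0).
    by rewrite ler_wpM2r ?cabs_ge0//; lra.
  lra.
apply: le_trans (cabsD _ _) _; rewrite !cabsM.
(* the two errors add up to (2 * 18 + 24) / 120 = 1/2 *)
have h4 : cabs (A - A0) * cabs (cauchy nu w) <=
    (18 * 120^-1 * cabs A0) * (2 * cabs (cauchy nu w0)).
  by apply: ler_pM; rewrite ?cabs_ge0.
have h5 : cabs A0 * cabs (cauchy nu w - cauchy nu w0) <=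
    cabs A0 * (24 * 120^-1 * cabs (cauchy nu w0)).
  apply: ler_wpM2l; rewrite ?cabs_ge0//; apply: le_trans h2 _.
  by rewrite ler_wpM2r ?cabs_ge0//; lra.
have := mulr_ge0 (cabs_ge0 A0) (cabs_ge0 (cauchy nu w0)).
rewrite -/A0; lra.
Qed.

End Kernel.


Lemma measurable_param_integral (R : realType) d1 d2 (T1 : measurableType d1)
    (T2 : measurableType d2) (mu : {finite_measure set T2 -> \bar R})
    (D1 : set T1) (D2 : set T2) (H : T1 -> T2 -> R) :
  measurable D1 -> measurable D2 ->
  measurable_fun (D1 `*` D2) (fun w => H w.1 w.2) ->
  measurable_fun D1 (fun z => \int[mu]_(u in D2) H z u).
Proof.
move=> m1 m2 mH; have m12 : measurable (D1 `*` D2) by exact: measurableX.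
pose F : T1 * T2 -> \bar R := (fun w => (H w.1 w.2)%:E) \_ (D1 `*` D2).
have mF : measurable_fun setT F.
  apply: (measurable_restrictT (fun w => (H w.1 w.2)%:E) m12).1.
  exact/measurable_EFinP.
have mp := @measurable_fun_fubini_tonelli_F _ _ T1 T2 R mu (F^\+)%E (measurable_funepos mF) (fun=> funepos_ge0 _ _).
have mn := @measurable_fun_fubini_tonelli_F _ _ T1 T2 R mu (F^\-)%E (measurable_funeneg mF) (fun=> funeneg_ge0 _ _).
have md := emeasurable_funB mp mn.
apply: (@eq_measurable_fun _ _ _ _ _ (fun z => fine (fubini_F mu F^\+ z - fubini_F mu F^\- z)%E)).
  move=> z; rewrite inE => z1; rewrite /Rintegral integral_mkcond; congr fine.
  rewrite [in RHS]integralE /fubini_F; congr (_ - _)%E; apply: eq_integral => u _.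
    by rewrite !funeposE /F /patch in_setX mem_set.
  by rewrite !funenegE /F /patch in_setX mem_set.
apply: measurable_funTS; exact: measurableT_comp (fine_measurable measurableT) md.
Qed.

Section KernelMeasurability.
Context {R : realType}.
Variable nu : {measure set (measurableTypeR R) -> \bar R}.
Local Notation mR := (measurableTypeR R).
Local Notation D := ([set` `[0, 1]] : set (measurableTypeR R)).
Hypothesis nuD : (nu D < +oo)%E.
Hypothesis nuC : nu (~` D) = 0%E.

Let mD : measurable D. Proof. exact: measurable_itv. Qed.

Let nu_fin : fin_num_fun nu.
Proof.
move=> A mA; rewrite ge0_fin_numE//; apply: (@le_lt_trans _ _ (nu D)) => //.
have nT : nu setT = nu D.
  have := measureU nu mD (measurableC mD) (setICr D); rewrite setUv => ->.
  by rewrite [X in (_ + X)%E = _](_ : _ = 0%E) ?adde0//; exact: nuC.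
by rewrite -nT le_measure ?inE.
Qed.

(** A copy of [nu], to carry the structure of finite measure. *)
Let nuF : set mR -> \bar R := nu.
HB.instance Definition _ := Measure.on nuF.
HB.instance Definition _ := @Measure_isFinite.Build _ _ _ nuF nu_fin.

Lemma measurable_cauchy : measurable_fun disc (@cauchy R nu).
Proof.
have mDD : measurable (@disc R `*` D) by exact: measurableX.
have mres : measurable_fun (@disc R `*` D)
    (fun p : R[i] * mR => resolvent p.1 (p.2 : R)).
  apply: measurable_invc => //; apply: measurable_oneB => //.
  apply: measurable_funMc => //; last exact: measurable_funTS.
  by apply: measurable_real => //; apply: measurable_funTS; exact: measurable_snd.
apply/measurable_fun_complexP => //; split.
  by apply: (measurable_param_integral nuF) => //; exact: measurable_fun_Re.
by apply: (measurable_param_integral nuF) => //; exact: measurable_fun_Im.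
Qed.

Lemma measurable_cpow d (T : measurableType d) (E : set T) (f : T -> R[i]) (g : R) :
  measurable E -> measurable_fun E f -> measurable_fun E (fun x => cpow (f x) g).
Proof.
move=> mE mf; rewrite /cpow; apply: measurable_funMc => //.
  apply: measurable_real => //; apply: (measurableT_comp (@measurable_powR R g)).
  exact: measurable_cabs.
have ma : measurable_fun E (fun x => g * atan (complex.Im (f x) / complex.Re (f x))).
  apply: measurable_funM => //.
  apply: (measurableT_comp (continuous_measurable_fun (@continuous_atan R))).
  apply: measurable_funM; first exact: measurable_fun_Im.
  by apply: measurable_inv; exact: measurable_fun_Re.
apply/measurable_fun_complexP => //; split => /=.
  exact: (measurableT_comp (continuous_measurable_fun (@continuous_cos R))).
exact: (measurableT_comp (continuous_measurable_fun (@continuous_sin R))).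
Qed.

Lemma measurable_kernel d (T : measurableType d) (E : set T) (f : T -> R[i]) (g : R) :
  measurable E -> measurable_fun E f -> (forall x, E x -> disc (f x)) ->
  measurable_fun E (fun x => kernel nu g (f x)).
Proof.
move=> mE mf fd; apply: measurable_funMc => //.
  by apply: measurable_invc => //; apply: measurable_cpow => //; exact: measurable_oneB.
have mc : measurable_fun setT (@cauchy R nu \_ disc).
  exact/(measurable_restrictT _ measurable_disc).1/measurable_cauchy.
apply: (@eq_measurable_fun _ _ _ _ _ (fun x => (cauchy nu \_ disc) (f x))).
  by move=> x; rewrite inE => /fd dx; rewrite patchE mem_set.
exact: (measurableT_comp mc).
Qed.

End KernelMeasurability.


(** * Domination over the boxes of the grids *)

Section BoxIndex.
Context {R : realType}.
Variable m : nat.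
Implicit Types (z u : R[i]) (s : bool) (j k n : nat).
Local Notation sd := (@side R m).
Local Notation K := (split m).

Definition box_index s j z : nat := `|Num.floor ((K ^ j)%:R * ang s z)|%N.

Lemma box_indexE s j k z : box m s j k z -> k = box_index s j z.
Proof. by move=> [_ _]; rewrite /box_index floor_angE => /eqP ->. Qed.

Lemma side_anti j n : (0 < m)%N -> sd j < sd n -> (n < j)%N.
Proof.
move=> m0; rewrite ltf_pV2 ?posrE ?ltr0n ?split_gt0// ltr_nat.
by rewrite ltn_exp2l// /split -[X in (X < _)%N](expn0 2) ltn_exp2l.
Qed.

Lemma side_small x : (0 < m)%N -> 0 < x -> exists n, sd n < x.
Proof.
move=> m0 x0; exists (Num.truncn x^-1).+1; set n := _.+1.
have hn : x^-1 < n%:R by exact: truncnS_gt.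
rewrite /side -[ltRHS]invrK ltf_pV2 ?posrE ?invr_gt0 ?ltr0n ?split_gt0//.
apply: (lt_le_trans hn); rewrite ler_nat /split -expnM.
apply: (@leq_trans (2 ^ n)); first by rewrite ltnW// ltn_expl.
by rewrite leq_exp2l// leq_pmull.
Qed.

(** The two points share a box of side at least 1 - |z|, hence of one of the
    first [n] generations. Summing over all candidates spares the choice of that
    box, which would depend on both points. *)
Lemma box_domination z u n (P : R) (c : nat -> R) : (0 < m)%N ->
  disc z -> disc u -> sd n < 1 - cabs z -> (forall j, 0 <= c j) ->
  (forall s j k, box m s j k z -> box m s j k u ->
    sd j <= 6 * K%:R * cabs (1 - z^* * u) -> P <= c j) ->
  P <= \sum_(s : bool) \sum_(j < n) c j * \1_(box m s j (box_index s j z)) u.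
Proof.
move=> m0 dz du nz c0 H.
have [s [j [k [bz bu hj]]]] := common_box m0 dz du.
have jn : (j < n)%N.
  by apply: side_anti => //; apply: (lt_le_trans nz); case: bz => h _ _; lra.
have ck s' : 0 <= \sum_(j < n) c j * \1_(box m s' j (box_index s' j z)) u.
  by apply: sumr_ge0 => i _; rewrite mulr_ge0.
apply: (le_trans (H _ _ _ bz bu hj)).
rewrite (bigD1 s)//= (bigD1 (Ordinal jn))//= -(box_indexE bz) indicE mem_set// mulr1.
rewrite -addrA lerDl addr_ge0//; last by apply: sumr_ge0.
by apply: sumr_ge0 => i _; rewrite mulr_ge0.
Qed.

End BoxIndex.


(** * The kernel on the diagonal *)

Lemma representation_kernel (R : realType) (B : R[i] -> R[i] -> R[i]) :
  admits_representation B ->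
  exists (g : R) (nu : {measure set (measurableTypeR R) -> \bar R}),
    [/\ 1 <= g, (nu [set` `[0%R, 1%R]] < +oo)%E, nu (~` [set` `[0%R, 1%R]]) = 0%E &
      forall z u, disc z -> disc u -> B z u = kernel nu g (z^* * u)].
Proof.
move=> [g [nu [g1 nuC h]]]; exists g, nu.
have E (z u : R[i]) : (fun r : R => (1 - r%:C * z^* * u)^-1) = resolvent (z^* * u).
  by apply/funext => r; rewrite /resolvent mulrA.
split => //; last by move=> z u dz du; have [_ ->] := h z u dz du; rewrite E.
have d0 : @disc R 0 by apply/discE; rewrite cabs0.
have [[/integrableP[_] + _] _] := h 0 0 d0 d0.
under eq_integral do rewrite mulr0 subr0 invr1 /= normr1.
by rewrite integral_cst ?mul1e//; exact: measurable_itv.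
Qed.

Section BergmanKernel.
Context {R : realType}.
Variable om : {finite_measure set (measurableTypeR R) -> \bar R}.
Hypothesis hom : class_R om.
Variables (B : R[i] -> R[i] -> R[i]) (g : R).
Variable nu : {measure set (measurableTypeR R) -> \bar R}.
Local Notation mu := (polar_measure om).
Local Notation W := (bmass om).
Hypothesis hB : is_bergman_kernel mu B.
Hypothesis g1 : 1 <= g.
Hypothesis nuD : (nu [set` `[0%R, 1%R]] < +oo)%E.
Hypothesis nuC : nu (~` [set` `[0%R, 1%R]]) = 0%E.
Hypothesis hK : forall z u, disc z -> disc u -> B z u = kernel nu g (z^* * u).
Local Notation Phi := (kernel_size nu g).

Lemma disc_conjM z u : disc z -> disc u -> cabs (z^* * u) < 1 :> R.
Proof.
by move=> /discE z1 /discE u1; rewrite cabsM cabs_conj mulr_ilt1 ?cabs_ge0.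
Qed.

Lemma cabs_bergman_le z u : disc z -> disc u ->
  cabs (B z u) <= 6 * Phi (cabs (1 - z^* * u)).
Proof. by move=> dz du; rewrite hK//; apply: kernel_le => //; exact: disc_conjM. Qed.

Lemma cabs_bergman_ge z u : disc z -> disc u ->
  Phi (cabs (1 - z^* * u)) <= 2 * cabs (B z u).
Proof. by move=> dz du; rewrite hK//; apply: kernel_ge => //; exact: disc_conjM. Qed.

Lemma measurable_bergman2 d (T : measurableType d) (E : set T) (f h : T -> R[i]) :
  measurable E -> measurable_fun E f -> measurable_fun E h ->
  (forall x, E x -> disc (f x)) -> (forall x, E x -> disc (h x)) ->
  measurable_fun E (fun x => B (f x) (h x)).
Proof.
move=> mE mf mh fd hd.
apply: (@eq_measurable_fun _ _ _ _ _ (fun x => kernel nu g ((f x)^* * h x))).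
  by move=> x; rewrite inE => Ex; rewrite hK//; [exact: fd|exact: hd].
apply: measurable_kernel => //; last first.
  by move=> x Ex; apply/discE/disc_conjM; [exact: fd|exact: hd].
by apply: measurable_funMc => //; exact: measurable_conj.
Qed.

Lemma measurable_bergman z : disc z -> measurable_fun disc (B z).
Proof.
by move=> dz; apply: (measurable_bergman2 (f := cst z) (h := id)) => //.
Qed.

Lemma integrable_sqr_bergman z : disc z ->
  mu.-integrable disc (EFin \o (fun u => cabs (B z u) ^+ 2)).
Proof.
move=> dz; apply/integrableP; split.
  apply/measurable_EFinP; apply: measurable_funX; apply: measurable_cabs => //.
  exact: measurable_bergman.
have [[_]] := hB dz; under [in X in (X -> _)%type]eq_integral do rewrite -[_%:E]gee0_abs ?lee_fin ?sqr_ge0//.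
by [].
Qed.

Lemma bergman_diag z : disc z ->
  B z z = (\int[mu]_(u in disc) (cabs (B z u) ^+ 2))%:C.
Proof.
move=> dz; have [bz rep] := hB dz; rewrite rep// -cintegral_real//.
apply: eq_cintegral => u _.
by rewrite -[RHS]/(_%:C) rmorphXn /= -norm_cabs sqr_normc.
Qed.

Lemma cabs_bergman_diag z : disc z ->
  cabs (B z z) = \int[mu]_(u in disc) (cabs (B z u) ^+ 2).
Proof.
move=> dz; rewrite {1}bergman_diag// cabs_real ger0_norm//.
by apply: Rintegral_ge0 => u _; exact: sqr_ge0.
Qed.

Lemma disc_real (a : R) : 0 <= a -> a < 1 -> disc a%:C.
Proof. by move=> a0 a1; apply/discE; rewrite cabs_real ger0_norm. Qed.

Lemma one_sub_sqr (a : R) : 0 <= a -> a < 1 ->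
  cabs (1 - (a%:C)^* * a%:C) = 1 - a ^+ 2.
Proof.
move=> a0 a1; rewrite conjR -[X in cabs X](_ : (1 - a ^+ 2)%:C = _); last first.
  by rewrite (rmorphB (real_complex R)) rmorph1 rmorphXn.
by rewrite cabs_real ger0_norm// subr_ge0 exprn_ile1// ltW.
Qed.

(** Since the squared norm of the kernel at [a] is its value at [a], and the
    kernel is at least a multiple of that value on the Carleson square under
    [a], the value cannot exceed the inverse of the mass of that square. *)
Lemma kernel_size_le_mass : exists2 C : R, 0 < C &
  forall x, 0 < x -> x <= 1 -> Phi x * (x * W x) <= C.
Proof.
have [c c0 hc] := carleson_mass_ge hom; have p0 := @pi_gt0 R.
have p4 : pi < 4 :> R by have := @pihalf_lt2 R; lra.
have G0 : 0 <= g := le_trans ler01 g1.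
have alg (b r : R) (v : R[i]) :
    1 - b%:C * (r%:C * v) = (1 - b * r)%:C - (b * r)%:C * (v - 1).
  by rewrite (rmorphB (real_complex R)) rmorph1 (rmorphM (real_complex R)); ring.
pose e : R := 18 `^ (g + 1).
have e0 : 0 < e by rewrite powR_gt0// ltr0n.
exists (24 * e ^+ 2 / c) => [|x x0 x1].
  by rewrite divr_gt0// mulr_gt0 ?exprn_gt0// ltr0n.
pose a := 1 - x; have a0 : 0 <= a by rewrite /a; lra.
have a1 : a < 1 by rewrite /a; lra.
have da := disc_real a0 a1.
have P0 := kernel_size_ge0 nu g x0.
have up : cabs (B a%:C a%:C) <= 6 * Phi x.
  apply: (le_trans (cabs_bergman_le da da)); rewrite one_sub_sqr//.
  by rewrite ler_pM2l ?ltr0n//; apply: kernel_size_le => //; rewrite /a; nra.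
pose E := @carleson R 0 x.
have lowE u : E u -> Phi x <= e * (2 * cabs (B a%:C u)).
  move=> Eu; have du := carleson_sub_disc x0 x1 Eu.
  have h18 : cabs (1 - (a%:C)^* * u) <= 18 * x.
    case: Eu => r; rewrite /= in_itv/= => /andP[r1 r2].
    move=> [_ [t /= + <-] <-]; rewrite in_itv/= add0r => /andP[t0 t1].
    have r0 : 0 <= r by lra.
    rewrite conjR.
    rewrite alg -expi0.
    apply: le_trans (cabsB _ _) _; rewrite cabsM !cabs_real.
    have ar1 : a * r <= 1 by rewrite mulr_ile1// ltW.
    rewrite ger0_norm ?subr_ge0// ger0_norm ?mulr_ge0//.
    have h1 : 1 - a * r <= 2 * x by rewrite /a; nra.
    have h2 : cabs (expi t - expi 0) <= 16 * x.
      apply: le_trans (expi_dist _ _) _; rewrite subr0 ger0_norm//.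
      have : 2 * pi * x <= 8 * x by rewrite ler_wpM2r ?(ltW x0)//; lra.
      lra.
    have : a * r * cabs (expi t - expi 0) <= 16 * x.
      by apply: le_trans h2; rewrite ler_piMl ?cabs_ge0.
    lra.
  have := cabs_1B_gt0 da du => q0.
  have /le_trans := kernel_size_ge nuD g x0 (ltac:(lra) : x <= 18 * x).
  rewrite mulfK ?gt_eqF//; apply; rewrite ler_wpM2l ?(ltW e0)//.
  apply: le_trans (cabs_bergman_ge da du).
  by apply: kernel_size_le => //.
have mE : measurable E by exact: measurable_carleson.
have lo : (Phi x / (2 * e)) ^+ 2 * (c * (x * W x)) <= cabs (B a%:C a%:C).
  rewrite cabs_bergman_diag// -lee_fin fineK; last first.
    by apply: integrable_fin_num => //; exact: integrable_sqr_bergman.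
  apply: (@le_trans _ _ (\int[mu]_(u in E) (cst ((Phi x / (2 * e)) ^+ 2)%:E u))%E).
    rewrite integral_cst// EFinM lee_wpmul2l ?lee_fin ?sqr_ge0//.
    exact: hc.
  have mB : measurable_fun disc (fun u => (cabs (B a%:C u) ^+ 2)%:E).
    apply/measurable_EFinP; apply: measurable_funX; apply: measurable_cabs => //.
    exact: measurable_bergman.
  have Ed : E `<=` disc by exact: carleson_sub_disc.
  apply: (@le_trans _ _ (\int[mu]_(u in E) (cabs (B a%:C u) ^+ 2)%:E)%E).
    apply: ge0_le_integral => //.
    - by move=> u _; rewrite lee_fin sqr_ge0.
    - exact: measurable_funS mB.
    have pe : 0 <= Phi x / (2 * e) by apply: divr_ge0 => //; lra.
    move=> u Eu; rewrite lee_fin lerXn2r ?nnegrE ?cabs_ge0//.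
    rewrite ler_pdivrMr ?mulr_gt0//.
    by have := lowE _ Eu; rewrite mulrA mulrC [e * 2]mulrC.
  by apply: ge0_subset_integral => // u _; rewrite lee_fin sqr_ge0.
move: P0; rewrite le_eqVlt => /orP[/eqP <-|P0].
  by rewrite mul0r divr_ge0 ?(ltW c0)// mulr_ge0 ?sqr_ge0// ler0n.
rewrite ler_pdivlMr//.
have := le_trans lo up.
have -> : (Phi x / (2 * e)) ^+ 2 * (c * (x * W x)) =
   Phi x * (Phi x * (x * W x) * c / (4 * e ^+ 2)).
  by field; rewrite gt_eqF.
rewrite [6 * _]mulrC ler_pM2l// ler_pdivrMr ?mulr_gt0 ?exprn_gt0//.
lra.
Qed.

End BergmanKernel.


Section TestFunction.
Context {R : realType}.
Implicit Types (a x : R) (u : R[i]).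

Definition test_fun a N u : R[i] := ((1 - a%:C * u) ^+ N)^-1.

Lemma test_fun_analytic a N : 0 <= a -> a < 1 -> analytic_disc (test_fun a N).
Proof.
move=> a0 a1 z /discE z1; apply: derivableV.
  rewrite expf_neq0// -cabs_gt0; apply: one_sub_gt0 => //.
  by rewrite a0 ltW.
have e : (fun u : R[i]^o => (1 - a%:C * u) ^+ N) =
    ((cst 1 - a%:C *: (id : R[i]^o -> R[i]^o)) ^+ N : R[i]^o -> R[i]^o).
  by apply/funext => u; rewrite exprfctE.
rewrite e; apply: derivableX; apply: derivableB; first exact: derivable_cst.
by apply: derivableZ; exact: derivable_id.
Qed.

Lemma cabs_test_fun a N u : cabs (test_fun a N u) = (cabs (1 - a%:C * u) ^+ N)^-1.
Proof. by rewrite cabsV cabsX. Qed.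

Lemma measurable_test_fun a N : measurable_fun setT (test_fun a N).
Proof.
apply: measurable_invc => //.
elim: N => [|N IH]; first by under eq_fun do rewrite expr0; exact: measurable_cst.
under eq_fun do rewrite exprS; apply: measurable_funMc => //.
apply: measurable_oneB => //; apply: measurable_funMc => //; exact: measurable_id.
Qed.

(** The side lengths decrease geometrically, so that their inverses add up to
    at most twice the last one. *)
Lemma sum_inv_side m n x : (0 < m)%N -> 0 < x ->
  \sum_(j < n) (if x <= side m j then (side m j)^-1 else 0) <= 2 / x.
Proof.
move=> m0 x0; have K2 : 2 <= (split m)%:R :> R.
  by rewrite ler_nat /split -[X in (X <= _)%N](expn1 2) leq_exp2l.
have s0 j : 0 < (side m j)^-1 :> R by rewrite invr_gt0 side_gt0.
have A k : \sum_(j < k) (if x <= side m j then (side m j)^-1 else 0) <= (side m k)^-1 :> R.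
  elim: k => [|k IH]; first by rewrite big_ord0 ltW.
  rewrite big_ord_recr /= sideS invf_div mulrC.
  have : (side m k)^-1 * 2 <= (side m k)^-1 * (split m)%:R :> R.
    by rewrite (ler_pM2l (s0 k)).
  have := s0 k; case: ifP => _; lra.
elim: n => [|n IH]; first by rewrite big_ord0 divr_ge0 ?ltW.
rewrite big_ord_recr /=; case: ifPn => h; last by rewrite addr0.
have : (side m n)^-1 <= x^-1 :> R by rewrite lef_pV2 ?posrE ?side_gt0.
have := A n; lra.
Qed.

Variable om : {finite_measure set (measurableTypeR R) -> \bar R}.
Hypothesis hom : class_R om.
Local Notation mu := (polar_measure om).
Local Notation W := (bmass om).

(** Sorting by the boxes that contain the two points reduces the integral to a
    sum over scales; the power is taken larger than the doubling exponent of the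
    tail for that sum to be of the order of its smallest scale. *)
Lemma test_fun_sqr_int : exists (N : nat) (C : R), 0 < C /\
  forall x, 0 < x -> x <= 1 ->
    (\int[mu]_(u in disc) ((cabs (test_fun (1 - x) N u) ^+ 2)%:E) <=
      (C * (x ^+ N ^+ 2)^-1 * (x * W x))%:E)%E.
Proof.
have [D [N0 [D0 hD]]] := bmass_doubling hom.
pose m := 1%N; have m0 : (0 < m)%N by [].
have p0 := @pi_gt0 R.
pose K : R := 6 * (split m)%:R.
have K0 : 0 < K by rewrite mulr_gt0 ?ltr0n.
pose N := N0.+1.
exists N, (16 * pi * D * K ^+ N ^+ 2); split.
  by rewrite !mulr_gt0 ?exprn_gt0// ltr0n.
move=> x x0 x1; pose a := 1 - x.
have a0 : 0 <= a by rewrite /a; lra.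
have a1 : a < 1 by rewrite /a; lra.
have da := disc_real a0 a1.
have [n hn] := side_small m0 x0.
pose c j : R := if x <= side m j then (K / side m j) ^+ N ^+ 2 else 0.
have c0 j : 0 <= c j by rewrite /c; case: ifP => // _; rewrite sqr_ge0.
have dom u : disc u -> cabs (test_fun a N u) ^+ 2 <=
    \sum_(s : bool) \sum_(j < n) c j * \1_(box m s j (box_index m s j a%:C)) u.
  move=> du; apply: box_domination => //.
    by rewrite cabs_real ger0_norm// /a opprB addrCA subrr addr0.
  move=> s j k [ba _ _] bu; rewrite conjR => hs.
  have ca : cabs a%:C = a by rewrite cabs_real ger0_norm.
  rewrite /c ifT; last by move: ba; rewrite ca /a; lra.
  have s0 := @side_gt0 R m j.
  have q0 : 0 < cabs (1 - a%:C * u).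
    by rewrite -[a%:C]conjR; exact: cabs_1B_gt0.
  rewrite cabs_test_fun -exprVn lerXn2r ?nnegrE ?exprn_ge0 ?invr_ge0 ?(ltW q0)//.
    by rewrite divr_ge0// ltW.
  rewrite lerXn2r ?nnegrE ?invr_ge0 ?(ltW q0)//; first by rewrite divr_ge0// ltW.
  by rewrite -div1r ler_pdivrMr// mulrAC ler_pdivlMr// mul1r.
have mbox s j : measurable (box m s j (box_index m s j a%:C)) by exact: measurable_box.
apply: (@le_trans _ _ (\int[mu]_(u in disc) (\sum_(s : bool) \sum_(j < n)
    (c j * \1_(box m s j (box_index m s j a%:C)) u)%:E))%E).
  apply: ge0_le_integral => //.
  - by move=> u _; rewrite lee_fin sqr_ge0.
  - apply/measurable_EFinP; apply: measurable_funX; apply: measurable_cabs => //.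
    by apply: measurable_funTS; exact: measurable_test_fun.
  - apply: emeasurable_sum => s; apply: emeasurable_sum => j.
    by apply/measurable_EFinP; apply: measurable_funM.
  move=> u du; under eq_bigr do rewrite sumEFin.
  by rewrite sumEFin lee_fin; exact: dom.
have int1 s j : (\int[mu]_(u in disc) (c j * \1_(box m s j (box_index m s j a%:C)) u)%:E <=
    (4 * pi * (c j * (side m j * W (side m j))))%:E)%E.
  under eq_integral do rewrite EFinM.
  have m1 : measurable_fun disc
      (fun u => (\1_(box m s j (box_index m s j a%:C)) u)%:E : \bar R).
    exact/measurable_EFinP.
  rewrite ge0_integralZl ?lee_fin//.
  rewrite integral_indic//.
  apply: (@le_trans _ _ ((c j)%:E * (4 * pi * (side m j * W (side m j)))%:E)%E).
    apply: lee_wpmul2l; rewrite ?lee_fin//.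
    apply: le_trans (box_mass_le om m s j (box_index m s j a%:C)).
    by apply: le_measure; rewrite ?inE//; apply: measurableI.
  by rewrite -EFinM lee_fin mulrCA.
have cbound j : c j * (side m j * W (side m j)) <=
    (D * K ^+ N ^+ 2 * (x ^+ N0 ^+ 2)^-1 * W x) *
    (if x <= side m j then (side m j)^-1 else 0).
  rewrite /c; case: ifPn => [xs|_]; last by rewrite mul0r mulr0.
  have s0 := @side_gt0 R m j; have s1 := @side_le1 R m j.
  have W0 := bmass_gt0 hom x0.
  have := hD _ _ x0 xs s1.
  move: (side m j) xs s0 s1 => t xs t0 t1 hW.
  have tx : 1 <= t / x by rewrite ler_pdivlMr// mul1r.
  have hW' : W t <= D * (t / x) ^+ N0 ^+ 2 * W x.
    apply: (le_trans hW); rewrite ler_wpM2r ?(ltW W0)// ler_wpM2l ?(ltW D0)//.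
    by rewrite expr2 ler_peMl ?exprn_ege1// exprn_ge0// (le_trans ler01).
  have P0 : 0 <= (K / t) ^+ N ^+ 2 * t by rewrite mulr_ge0 ?sqr_ge0 ?ltW.
  rewrite mulrA; apply: (le_trans (ler_wpM2l P0 hW')).
  rewrite le_eqVlt; apply/orP; left; apply/eqP.
  rewrite /N !expr_div_n [t ^+ N0.+1]exprS; have tn : t ^+ N0 != 0 by rewrite expf_neq0// gt_eqF.
  have xn : x ^+ N0 != 0 by rewrite expf_neq0// gt_eqF.
  move: (K ^+ N0.+1) (t ^+ N0) (x ^+ N0) (W x) tn xn => k tN xN w tn xn.
  by field; rewrite tn xn gt_eqF.
apply: (@le_trans _ _ (\sum_(s : bool) \sum_(j < n)
    (4 * pi * (c j * (side m j * W (side m j))))%:E)%E).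
  rewrite ge0_integral_sum//; last 2 first.
  - move=> s; apply: emeasurable_sum => j.
    by apply/measurable_EFinP; apply: measurable_funM.
  - by move=> s u _; apply: sume_ge0 => j _; rewrite lee_fin mulr_ge0.
  apply: lee_sum => s _; rewrite ge0_integral_sum//; last 2 first.
  - by move=> j; apply/measurable_EFinP; apply: measurable_funM.
  - by move=> j u _; rewrite lee_fin mulr_ge0.
  by apply: lee_sum => j _.
under eq_bigr do rewrite sumEFin.
rewrite sumEFin lee_fin big_bool /= -mulr2n -mulr_sumr.
set A := D * K ^+ N ^+ 2 * (x ^+ N0 ^+ 2)^-1 * W x in cbound.
have A0 : 0 <= A.
  by rewrite /A !mulr_ge0 ?invr_ge0 ?exprn_ge0 ?(ltW D0) ?(ltW K0) ?(ltW x0) ?(ltW (bmass_gt0 hom x0)).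
have S : \sum_(i < n) c i * (side m i * W (side m i)) <= A * (2 / x).
  apply: (@le_trans _ _ (\sum_(i < n) (A * (if x <= side m i then (side m i)^-1 else 0)))).
    by apply: ler_sum => i _; exact: cbound.
  by rewrite -mulr_sumr ler_wpM2l// sum_inv_side.
rewrite -[leLHS]mulr_natr.
apply: (@le_trans _ _ (4 * pi * (A * (2 / x)) * 2)).
  by rewrite ler_wpM2r// ler_wpM2l//; lra.
rewrite le_eqVlt; apply/orP; left; apply/eqP.
rewrite /A /N [x ^+ N0.+1]exprS.
have xn : x ^+ N0 != 0 by rewrite expf_neq0// gt_eqF.
move: (x ^+ N0) (K ^+ N0.+1) (W x) pi xn => xN k w q xn.
by field; rewrite xn gt_eqF.
Qed.

End TestFunction.


Section DiagonalLower.
Context {R : realType}.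
Variable om : {finite_measure set (measurableTypeR R) -> \bar R}.
Hypothesis hom : class_R om.
Variables (B : R[i] -> R[i] -> R[i]) (g : R).
Variable nu : {measure set (measurableTypeR R) -> \bar R}.
Local Notation mu := (polar_measure om).
Local Notation W := (bmass om).
Hypothesis hB : is_bergman_kernel mu B.
Hypothesis g1 : 1 <= g.
Hypothesis nuD : (nu [set` `[0%R, 1%R]] < +oo)%E.
Hypothesis nuC : nu (~` [set` `[0%R, 1%R]]) = 0%E.
Hypothesis hK : forall z u, disc z -> disc u -> B z u = kernel nu g (z^* * u).
Local Notation Phi := (kernel_size nu g).

(** The value of the kernel at [a] is the supremum of |f(a)|^2 over the unit
    ball; a high power of 1 / (1 - a u) is a competitor. *)
Lemma kernel_size_ge_mass : exists2 c : R, 0 < c &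
  forall x, 0 < x -> x <= 1 -> c <= Phi x * (x * W x).
Proof.
have [N [C [C0 hC]]] := test_fun_sqr_int hom.
exists (24 * C * 2 ^+ N ^+ 2)^-1 => [|x x0 x1].
  by rewrite invr_gt0 !mulr_gt0 ?exprn_gt0 ?ltr0n.
have W0 := bmass_gt0 hom x0.
pose a := 1 - x; have a0 : 0 <= a by rewrite /a; lra.
have a1 : a < 1 by rewrite /a; lra.
have da := disc_real a0 a1.
pose f := test_fun a N.
have mf : measurable_fun disc f by apply: measurable_funTS; exact: measurable_test_fun.
have fb : bergman_space mu f.
  split; first exact: test_fun_analytic.
  exact: le_lt_trans (hC _ x0 x1) (ltry _).
have [_ rep] := hB da; have fa := rep _ fb.
have iB := integrable_sqr_bergman hB nuD nuC hK da.
have mB := measurable_bergman nuD nuC hK da.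
have if2 : mu.-integrable disc (EFin \o (fun u => cabs (f u) ^+ 2)).
  apply/integrableP; split.
    by apply/measurable_EFinP; apply: measurable_funX; exact: measurable_cabs.
  case: fb => _; apply: le_lt_trans; rewrite le_eqVlt; apply/orP; left; apply/eqP.
  by apply: eq_integral => u _; rewrite gee0_abs// lee_fin sqr_ge0.
pose F := C * (x ^+ N ^+ 2)^-1 * (x * W x).
have F0 : 0 < F by rewrite !mulr_gt0 ?invr_gt0 ?exprn_gt0.
have fF : \int[mu]_(u in disc) (cabs (f u) ^+ 2) <= F.
  rewrite -lee_fin fineK; last exact: integrable_fin_num.
  exact: hC.
pose b := cabs (B a%:C a%:C).
have bE : b = \int[mu]_(u in disc) (cabs (B a%:C u) ^+ 2).
  exact: (cabs_bergman_diag hB da).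
have b6 : b <= 6 * Phi x.
  apply: (le_trans (cabs_bergman_le nuD hK da da)); rewrite one_sub_sqr//.
  by rewrite ler_pM2l ?ltr0n//; apply: kernel_size_le => //; rewrite /a; nra.
(* the Cauchy-Schwarz inequality, with the parameter to be optimized *)
have key t : 0 < t -> cabs (f a%:C) <= t * F + b / t.
  move=> t0; rewrite fa.
  pose h u := t / 2 * cabs (f u) ^+ 2 + (2 * t)^-1 * cabs (B a%:C u) ^+ 2.
  have ih : mu.-integrable disc (EFin \o h).
    by apply: integrable_add => //; apply: integrable_scale.
  have fh u : cabs (f u * (B a%:C u)^*) <= h u.
    rewrite cabsM cabs_conj /h; move: (cabs (f u)) (cabs (B a%:C u)) => p q.
    have : 0 <= (t * p - q) ^+ 2 / (2 * t) by rewrite divr_ge0 ?sqr_ge0// mulr_ge0// ltW.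
    have -> : (t * p - q) ^+ 2 / (2 * t) = t / 2 * p ^+ 2 + (2 * t)^-1 * q ^+ 2 - p * q.
      by field; rewrite gt_eqF.
    by rewrite subr_ge0.
  have ci : cintegrable mu disc (fun u => f u * (B a%:C u)^*).
    apply: (@le_cintegrable _ _ _ mu disc _ _ h) => //.
    by apply: measurable_funMc => //; exact: measurable_conj.
  apply: (le_trans (cabs_cintegral_le _ ci)) => //.
  have : \int[mu]_(u in disc) cabs (f u * (B a%:C u)^*) <= \int[mu]_(u in disc) h u.
    apply: le_Rintegral => //; exact: (cintegrable_cabs _ ci).
  rewrite /h RintegralD//; last 2 first.
  - exact: integrable_scale.
  - exact: integrable_scale.
  rewrite !RintegralZl// -bE => h1.
  apply: (@le_trans _ _ (2 * (t / 2 * F + (2 * t)^-1 * b))).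
    rewrite ler_pM2l//; apply: (le_trans h1); rewrite lerD2r.
    by apply: ler_wpM2l => //; rewrite divr_ge0 ?(ltW t0).
  by rewrite le_eqVlt; apply/orP; left; apply/eqP; field; rewrite gt_eqF.
pose v := ((2 * x) ^+ N)^-1.
have v0 : 0 < v by rewrite invr_gt0 exprn_gt0// mulr_gt0.
have fv : v <= cabs (f a%:C).
  rewrite cabs_test_fun -[X in 1 - X * _](conjR a) one_sub_sqr//.
  have q0 : 0 < 1 - a ^+ 2 by rewrite /a; nra.
  rewrite lef_pV2 ?posrE ?exprn_gt0 ?mulr_gt0//.
  by rewrite lerXn2r ?nnegrE ?(ltW q0)// /a; [lra|nra].
have gen (p q r y : R) : 0 < p -> 0 < q -> p <= y ->
    y <= p / (2 * q) * q + r / (p / (2 * q)) -> p ^+ 2 <= 4 * q * r.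
  move=> p0 q0 py hy; have := le_trans py hy.
  have -> : p / (2 * q) * q = p / 2 by field; rewrite gt_eqF.
  have -> : r / (p / (2 * q)) = (2 * q * r) / p by field; rewrite !gt_eqF.
  move=> k3; have : p / 2 <= 2 * q * r / p by lra.
  by rewrite ler_pdivlMr// expr2; lra.
have k2 : v ^+ 2 <= 4 * F * b.
  by apply: (gen _ _ _ _ v0 F0 fv); apply: key; apply: divr_gt0 => //; apply: mulr_gt0.
have k3 : v ^+ 2 <= 24 * F * Phi x.
  apply: (le_trans k2); apply: (@le_trans _ _ (4 * F * (6 * Phi x))).
    by apply: ler_wpM2l => //; apply: mulr_ge0 => //; exact: ltW.
  have r4 (q ph : R) : 4 * q * (6 * ph) <= 24 * q * ph.
    by rewrite le_eqVlt; apply/orP; left; apply/eqP; ring.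
  exact: r4.
rewrite -div1r ler_pdivrMr ?mulr_gt0 ?exprn_gt0 ?ltr0n//.
have x2 : 0 < x ^+ N ^+ 2 by rewrite !exprn_gt0.
have y2 : 0 < 2 ^+ N ^+ 2 :> R by rewrite !exprn_gt0 ?ltr0n.
have fin (p q A X : R) : 0 < p -> 0 < q -> (q * p)^-1 <= 24 * (C / p * A) * X ->
    1 <= X * A * (24 * C * q).
  move=> p0 q0; have qp := mulr_gt0 q0 p0; have qn : q * p != 0 by rewrite gt_eqF.
  move=> h; have := ler_wpM2r (ltW qp) h; rewrite mulVf//.
  move/le_trans; apply; rewrite le_eqVlt; apply/orP; left; apply/eqP.
  by field; rewrite gt_eqF.
apply: (fin _ _ _ _ x2 y2); apply: le_trans k3.
by rewrite /v exprMn exprVn exprMn.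
Qed.

End DiagonalLower.


(** * A Carleson embedding on trees *)

Section Young.
Context {R : realType}.
Variables p q : R.
Hypothesis p1 : 1 < p.
Hypothesis pq : p^-1 + q^-1 = 1.
Implicit Types a b x y : R.

Lemma conj_gt1 : 1 < q.
Proof.
have p0 : 0 < p := lt_trans ltr01 p1.
have qV : q^-1 = 1 - p^-1 by rewrite -pq addrAC subrr add0r.
have : 0 < q^-1 by rewrite qV subr_gt0 invf_lt1.
rewrite invr_gt0 => q0; rewrite -(invf_lt1 q0) qV.
by rewrite ltrBlDl ltrDr invr_gt0.
Qed.

Lemma conj_mul : p * q = p + q.
Proof.
have p0 : p != 0 by rewrite gt_eqF// (lt_trans ltr01).
have q0 : q != 0 by rewrite gt_eqF// (lt_trans ltr01)// conj_gt1.
rewrite -[LHS]mulr1 -pq mulrDr mulrAC divff// mul1r -mulrA divff// mulr1.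
by rewrite addrC.
Qed.

Lemma conj_div : (p - 1) * q = p.
Proof. by rewrite mulrBl mul1r conj_mul addrK. Qed.

Lemma powR_conj x : 0 <= x -> (x `^ (p - 1)) `^ q = x `^ p.
Proof. by move=> x0; rewrite -powRrM conj_div. Qed.

Lemma young x y : 0 <= x -> 0 <= y -> x * y <= x `^ p / p + y `^ q / q.
Proof.
move=> x0 y0; apply: conjugate_powR => //; first exact: lt_trans ltr01 p1.
exact: lt_trans ltr01 conj_gt1.
Qed.

Lemma powR_split x : 0 <= x -> x `^ (p - 1) * x = x `^ p.
Proof.
rewrite le_eqVlt => /orP[/eqP <-|x0].
  rewrite mulr0 powR0// gt_eqF//; exact: lt_trans ltr01 p1.
by rewrite -{2}(powRr1 (ltW x0)) -powRD ?subrK// (gt_eqF x0) implybT.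
Qed.

End Young.

Lemma ratio_powR (R : realType) (p V s m : R) : 1 < p -> 0 < m -> 0 <= s ->
  V / m * (s / m) `^ (p - 1) = V * s `^ (p - 1) / m `^ p.
Proof.
move=> p1 M0 s0; have Mi : 0 <= m^-1 by rewrite invr_ge0 ltW.
rewrite (powRM _ s0 Mi) -(powR_split p1 (ltW M0)) -(powR_inv1 (ltW M0)).
rewrite -(powRAC m) !(powR_inv1) ?powR_ge0 ?(ltW M0)//.
have Mq : m `^ (p - 1) != 0 by rewrite gt_eqF// powR_gt0.
by field; rewrite Mq gt_eqF.
Qed.

Lemma sum_mul (R : realType) (m n : nat) (F : nat -> R) :
  \sum_(l < m * n) F l = \sum_(i < m) \sum_(l < n) F (i * n + l)%N.
Proof.
elim: m => [|m IH]; first by rewrite mul0n !big_ord0.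
by rewrite mulSnr big_split_ord /= IH big_ord_recr.
Qed.

Section TreeMaximal.
Context {R : realType}.
Variables (p q : R) (K : nat).
Hypothesis p1 : 1 < p.
Hypothesis pq : p^-1 + q^-1 = 1.

(** [X j k] stands for the node [k] of generation [j], with children
    [K * k + i] in the next one, and [X'] for its part outside the children. *)
Variables (m a b m' a' b' : nat -> nat -> R).
Hypothesis mS : forall j k, m j k = m' j k + \sum_(i < K) m j.+1 (K * k + i)%N.
Hypothesis aS : forall j k, a j k = a' j k + \sum_(i < K) a j.+1 (K * k + i)%N.
Hypothesis bS : forall j k, b j k = b' j k + \sum_(i < K) b j.+1 (K * k + i)%N.
Hypothesis m0 : forall j k, (k < K ^ j)%N -> 0 < m j k.
Hypothesis a0 : forall j k, 0 <= a j k.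
Hypothesis ineq : forall j k l, 0 <= l ->
  p * q * l `^ (p - 1) * a j k <= q `^ p * b j k + (p - 1) * l `^ p * m j k.
Hypothesis ineq' : forall j k l, 0 <= l ->
  p * q * l `^ (p - 1) * a' j k <= q `^ p * b' j k + (p - 1) * l `^ p * m' j k.
Hypothesis m_ge0 : forall j k, 0 <= m j k.

Let h j k := m' j k * (a j k / m j k) `^ p.
Let Y n j k := \sum_(i < n) \sum_(l < K ^ i) h (j + i)%N (K ^ i * k + l)%N.
Let G j k l := q `^ p * b j k + p * l `^ p * m j k - p * q * l `^ (p - 1) * a j k.

Let YS n j k : Y n.+1 j k = h j k + \sum_(i < K) Y n j.+1 (K * k + i)%N.
Proof.
rewrite /Y big_ord_recl /= big_ord1 addn0 mul1n addn0; congr +%R.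
rewrite exchange_big /=; apply: eq_bigr => i _.
rewrite /bump /= add1n.
have := sum_mul K (K ^ i) (fun l => h (j + i.+1)%N (K ^ i.+1 * k + l)%N).
rewrite -expnS => ->; apply: eq_bigr => i' _; apply: eq_bigr => l _.
congr h; first by rewrite addnS addSn.
by rewrite expnS; ring.
Qed.

(** Bellman function argument: the sum over the tree below a node is dominated
    by [G j k l] for every [l]; the expression [G] is additive over children
    and is minimal at the average. *)
Let tree_bound n : forall j k l, (k < K ^ j)%N -> 0 <= l -> Y n j k <= G j k l.
Proof.
have p0 : 0 < p := lt_trans ltr01 p1.
have q1 : 1 < q := conj_gt1 p1 pq.
have q0 : 0 < q := lt_trans ltr01 q1.
elim: n => [|n IH] j k l kj l0.
  rewrite /Y big_ord0 /G subr_ge0; apply: le_trans (ineq j k l0) _.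
  rewrite lerD2l ler_wpM2r// ler_wpM2r ?powR_ge0//; lra.
set f := a j k / m j k.
have mp := m0 kj.
have f0 : 0 <= f by rewrite divr_ge0 ?a0// ltW.
apply: (@le_trans _ _ (G j k f)).
  have -> : G j k f = (q `^ p * b' j k + p * f `^ p * m' j k - p * q * f `^ (p - 1) * a' j k)
      + \sum_(i < K) G j.+1 (K * k + i)%N f.
    rewrite /G mS aS bS !big_split /= sumrN -!mulr_sumr; ring.
  rewrite YS; apply: lerD; last first.
    apply: ler_sum => i _; apply: IH => //.
    rewrite expnS; apply: (@leq_trans (K * k + K)); first by rewrite ltn_add2l.
    by rewrite addnC -mulnS leq_mul2l kj orbT.
  by rewrite /h -/f; have := ineq' j k f0; lra.
have af : a j k = f * m j k by rewrite /f divfK// gt_eqF.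
rewrite /G af.
have -> : p * q * f `^ (p - 1) * (f * m j k) = p * q * f `^ p * m j k.
  by rewrite -(powR_split p1 f0); ring.
have yg := young p1 pq f0 (powR_ge0 l (p - 1)); rewrite powR_conj// in yg.
have : p * q * (f * l `^ (p - 1)) <= q * f `^ p + p * l `^ p.
  apply: le_trans (ler_wpM2l _ yg) _; first by rewrite mulr_ge0 ?ltW.
  rewrite le_eqVlt; apply/orP; left; apply/eqP.
  by move: (f `^ p) (l `^ p) => x y; field; rewrite !gt_eqF.
have e := conj_mul p1 pq.
move=> /(ler_wpM2r (ltW mp)).
have -> : p * q * f `^ p * m j k = (p + q) * f `^ p * m j k by rewrite e.
rewrite -[p * q * l `^ (p - 1) * _]/(p * q * l `^ (p - 1) * _).
have -> : p * q * l `^ (p - 1) * (f * m j k) = p * q * (f * l `^ (p - 1)) * m j k by ring.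
lra.
Qed.

(** When [m] is a measure on the nodes, [a] the integrals of a function with
    respect to it and [b] those of the p-th power, this is the dyadic maximal
    theorem, in the form of Carleson's embedding for the sequence [m']. *)
Lemma tree_embedding n :
  \sum_(j < n) \sum_(k < K ^ j) m' j k * (a j k / m j k) `^ p <= q `^ p * b 0 0.
Proof.
have := @tree_bound n 0 0 0 (ltn0Sn 0) (lexx 0).
rewrite /G !powR0 ?gt_eqF ?subr_gt0//; last exact: lt_trans ltr01 p1.
rewrite !mulr0 !mul0r addr0 subr0 /Y; apply: le_trans.
rewrite le_eqVlt; apply/orP; left; apply/eqP.
by apply: eq_bigr => i _; apply: eq_bigr => l _; rewrite muln0 add0n.
Qed.

End TreeMaximal.


Section SparseForm.
Context {R : realType}.
Implicit Types p q : R.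

(** The power of [s] left over by the testing condition is nonpositive for
    p >= 2, so that the total mass may be replaced there by that of the top
    part. *)
Lemma node_bound_ge2 p q (Q M c v s v' s' : R) : 2 <= p -> p^-1 + q^-1 = 1 ->
  0 < c -> 0 < M -> 0 < v' -> v' <= v -> 0 < s' -> s' <= s ->
  v * s `^ (p - 1) <= Q * M `^ p ->
  c * M <= v' `^ p^-1 * s' `^ q^-1 ->
  s * v <= Q * (c^-1 `^ (p - 1)) * M * (v' `^ q^-1 * s' `^ p^-1).
Proof.
move=> p2 pq c0 M0 v0 vv s0 ss hQ hM.
have p1 : 1 < p by lra.
have p0 : 0 < p by lra.
have q0 : 0 < q := lt_trans ltr01 (conj_gt1 p1 pq).
have sp : 0 < s by lra.
have Q0 : 0 <= Q.
  rewrite -(pmulr_lge0 _ (powR_gt0 p M0)); apply: le_trans hQ.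
  by rewrite mulr_ge0 ?powR_ge0//; lra.
have e1 : s * v = v * s `^ (p - 1) * s `^ (2 - p).
  rewrite -mulrA -powRD; last by rewrite (gt_eqF sp) implybT.
  by rewrite (_ : p - 1 + (2 - p) = 1); [rewrite powRr1 ?(ltW sp)// mulrC | ring].
have e2 : s `^ (2 - p) <= s' `^ (2 - p).
  have -> : 2 - p = - (p - 2) by ring.
  rewrite !powRN lef_pV2 ?posrE ?powR_gt0//.
  by apply: ge0_ler_powR; rewrite ?nnegrE; lra.
rewrite e1; apply: (@le_trans _ _ (Q * M `^ p * s' `^ (2 - p))).
  by apply: ler_pM e2 => //; [apply: mulr_ge0; rewrite ?powR_ge0//; lra | exact: powR_ge0].
have hM' : M `^ (p - 1) <= c^-1 `^ (p - 1) * (v' `^ q^-1 * s' `^ (p^-1 - (2 - p))).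
  have -> : v' `^ q^-1 * s' `^ (p^-1 - (2 - p)) = (v' `^ p^-1 * s' `^ q^-1) `^ (p - 1).
    rewrite powRM ?powR_ge0// -!powRrM.
    have qV : q^-1 = 1 - p^-1 by rewrite -pq addrAC subrr add0r.
    congr (_ `^ _ * _ `^ _); rewrite qV; field; rewrite gt_eqF//.
  have -> : M = c^-1 * (c * M) by rewrite mulrA mulVf ?mul1r// gt_eqF.
  have ci : 0 <= c^-1 by rewrite invr_ge0 ltW.
  have cM : 0 <= c * M by rewrite mulr_ge0// ltW.
  rewrite (powRM _ ci cM).
  rewrite ler_wpM2l ?powR_ge0//; apply: ge0_ler_powR; rewrite ?nnegrE//; first lra.
  by rewrite mulr_ge0 ?powR_ge0.
rewrite -(powR_split p1 (ltW M0)).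
have e3 : s' `^ p^-1 = s' `^ (p^-1 - (2 - p)) * s' `^ (2 - p).
  by rewrite -powRD ?subrK// (gt_eqF s0) implybT.
rewrite e3.
have -> : Q * (M `^ (p - 1) * M) * s' `^ (2 - p) =
  (Q * M * s' `^ (2 - p)) * M `^ (p - 1) by ring.
have -> : Q * c^-1 `^ (p - 1) * M * (v' `^ q^-1 * (s' `^ (p^-1 - (2 - p)) * s' `^ (2 - p))) =
  (Q * M * s' `^ (2 - p)) * (c^-1 `^ (p - 1) * (v' `^ q^-1 * s' `^ (p^-1 - (2 - p)))) by ring.
by apply: ler_wpM2l => //; rewrite !mulr_ge0 ?powR_ge0 ?(ltW M0).
Qed.

(** The exponent max(1, 1/(p-1)) arises here: for p < 2 the roles of the
    weight and its dual are exchanged. *)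
Lemma node_bound p q (c : R) : 1 < p -> p^-1 + q^-1 = 1 -> 0 < c ->
  exists2 D : R, 0 < D & forall Q M v s v' s' : R,
  0 < M -> 0 < v' -> v' <= v -> 0 < s' -> s' <= s ->
  0 <= Q -> v * s `^ (p - 1) <= Q * M `^ p ->
  c * M <= v' `^ p^-1 * s' `^ q^-1 ->
  s * v <= D * Q `^ (Num.max 1 (p - 1)^-1) * M * (v' `^ q^-1 * s' `^ p^-1).
Proof.
move=> p1 pq c0; have [p2|p2] := leP 2 p.
  exists (c^-1 `^ (p - 1)); first by rewrite powR_gt0 ?invr_gt0.
  move=> Q M v s v' s' M0 v0 vv s0 ss Q0 hQ hM.
  rewrite max_l ?powRr1//; last by rewrite invf_le1; lra.
  rewrite [_ * Q]mulrC; exact: node_bound_ge2 hQ hM.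
have q1 := conj_gt1 p1 pq.
have qp : q - 1 = (p - 1)^-1.
  have p10 : p - 1 != 0 by rewrite gt_eqF ?subr_gt0.
  apply: (mulfI p10); rewrite divff// mulrBr mulr1 (conj_div p1 pq); ring.
have q2 : 2 <= q.
  have : 1 <= (p - 1)^-1 by rewrite invf_ge1; lra.
  by rewrite -qp; lra.
exists (c^-1 `^ (q - 1)); first by rewrite powR_gt0 ?invr_gt0.
move=> Q M v s v' s' M0 v0 vv s0 ss Q0 hQ hM.
have v1 : 0 < v by lra. have s1 : 0 < s by lra.
rewrite max_r -qp; last by rewrite qp invf_ge1; lra.
rewrite [s * v]mulrC [c^-1 `^ _ * _]mulrC [v' `^ _ * _]mulrC.
apply: (@node_bound_ge2 q p) => //.
- by rewrite addrC.
- have h : (v * s `^ (p - 1)) `^ (q - 1) <= (Q * M `^ p) `^ (q - 1).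
    apply: ge0_ler_powR; rewrite ?nnegrE ?mulr_ge0 ?powR_ge0//; lra.
  move: h; rewrite !powRM ?powR_ge0 ?(ltW v1)// -!powRrM.
  have -> : (p - 1) * (q - 1) = 1 by rewrite qp divff// gt_eqF// subr_gt0.
  have -> : p * (q - 1) = q by rewrite mulrBr mulr1 (conj_mul p1 pq); ring.
  by rewrite powRr1 ?(ltW s1)// mulrC.
- by rewrite [leRHS]mulrC.
Qed.

Section Form.
Variables (p q : R) (K : nat).
Hypothesis p1 : 1 < p.
Hypothesis pq : p^-1 + q^-1 = 1.
Variables (s v f g bf bg s' v' f' g' bf' bg' : nat -> nat -> R) (M : nat -> R).
Hypothesis sS : forall j k, s j k = s' j k + \sum_(i < K) s j.+1 (K * k + i)%N.
Hypothesis vS : forall j k, v j k = v' j k + \sum_(i < K) v j.+1 (K * k + i)%N.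
Hypothesis fS : forall j k, f j k = f' j k + \sum_(i < K) f j.+1 (K * k + i)%N.
Hypothesis gS : forall j k, g j k = g' j k + \sum_(i < K) g j.+1 (K * k + i)%N.
Hypothesis bfS : forall j k, bf j k = bf' j k + \sum_(i < K) bf j.+1 (K * k + i)%N.
Hypothesis bgS : forall j k, bg j k = bg' j k + \sum_(i < K) bg j.+1 (K * k + i)%N.
Hypothesis s0 : forall j k, 0 <= s j k.
Hypothesis v0 : forall j k, 0 <= v j k.
Hypothesis f0 : forall j k, 0 <= f j k.
Hypothesis g0 : forall j k, 0 <= g j k.
Hypothesis M0 : forall j, 0 < M j.
Hypothesis s'0 : forall j k, (k < K ^ j)%N -> 0 < s' j k.
Hypothesis v'0 : forall j k, (k < K ^ j)%N -> 0 < v' j k.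
Hypothesis fi : forall j k (l : R), 0 <= l ->
  p * q * l `^ (p - 1) * f j k <= q `^ p * bf j k + (p - 1) * l `^ p * s j k.
Hypothesis fi' : forall j k (l : R), 0 <= l ->
  p * q * l `^ (p - 1) * f' j k <= q `^ p * bf' j k + (p - 1) * l `^ p * s' j k.
Hypothesis gi : forall j k (l : R), 0 <= l ->
  q * p * l `^ (q - 1) * g j k <= p `^ q * bg j k + (q - 1) * l `^ q * v j k.
Hypothesis gi' : forall j k (l : R), 0 <= l ->
  q * p * l `^ (q - 1) * g' j k <= p `^ q * bg' j k + (q - 1) * l `^ q * v' j k.
Variable D : R.
Hypothesis D0 : 0 <= D.
Hypothesis node : forall j k, (k < K ^ j)%N ->
  s j k * v j k <= D * M j * (v' j k `^ q^-1 * s' j k `^ p^-1).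

(** Young's inequality splits each term into one contribution for each weight,
    and each sum is a Carleson embedding; the exponents in [node] are those
    which make the two contributions match. *)
Lemma sparse_form n (t : R) : 0 < t ->
  \sum_(j < n) \sum_(k < K ^ j) f j k * g j k / M j <=
  D * (t `^ p * (q `^ p * bf 0 0) + t^-1 `^ q * (p `^ q * bg 0 0)).
Proof.
move=> t0; have p0 : 0 < p := lt_trans ltr01 p1.
have q1 := conj_gt1 p1 pq; have q0 : 0 < q := lt_trans ltr01 q1.
have qp : q^-1 + p^-1 = 1 by rewrite addrC.
have sp j k : (k < K ^ j)%N -> 0 < s j k.
  move=> kj; rewrite sS ltr_pwDl ?s'0//; exact: sumr_ge0.
have vp j k : (k < K ^ j)%N -> 0 < v j k.
  move=> kj; rewrite vS ltr_pwDl ?v'0//; exact: sumr_ge0.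
have h1 := tree_embedding p1 pq sS fS bfS sp f0 fi fi' s0 n.
have h2 := tree_embedding q1 qp vS gS bgS vp g0 gi gi' v0 n.
apply: (@le_trans _ _ (\sum_(j < n) \sum_(k < K ^ j)
    D * (t `^ p * (s' j k * (f j k / s j k) `^ p) +
         t^-1 `^ q * (v' j k * (g j k / v j k) `^ q)))); last first.
  under eq_bigr do rewrite -mulr_sumr big_split /= -!mulr_sumr.
  rewrite -mulr_sumr big_split /= -!mulr_sumr ler_wpM2l//.
  by apply: lerD; apply: ler_wpM2l; rewrite ?powR_ge0.
apply: ler_sum => j _; apply: ler_sum => k _.
have kj : (k < K ^ j)%N by [].
have S0 := sp _ _ kj; have V0 := vp _ _ kj; have N := node kj.
have S'0 := s'0 kj; have V'0 := v'0 kj; have F0 := f0 j k; have G0 := g0 j k.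
have MM := M0 j.
move: (s j k) (v j k) (f j k) (g j k) (s' j k) (v' j k) (M j) S0 V0 N S'0 V'0 F0 G0 MM.
move=> S V F G S' V' MM S0 V0 N S'0 V'0 F0 G0 MM0.
pose X := F / S * S' `^ p^-1; pose Z := G / V * V' `^ q^-1.
have FS : 0 <= F / S by rewrite divr_ge0// ltW.
have GV : 0 <= G / V by rewrite divr_ge0// ltW.
have X0 : 0 <= X by rewrite mulr_ge0 ?powR_ge0.
have Z0 : 0 <= Z by rewrite mulr_ge0 ?powR_ge0.
have XZ : F * G / MM <= D * (X * Z).
  have -> : F * G / MM = (F / S) * (G / V) * (S * V / MM).
    by field; rewrite !gt_eqF.
  have -> : D * (X * Z) = (F / S) * (G / V) * (D * (V' `^ q^-1 * S' `^ p^-1)).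
    by rewrite /X /Z; ring.
  apply: ler_wpM2l; first by rewrite mulr_ge0.
  by rewrite ler_pdivrMr// mulrAC.
apply: (le_trans XZ); apply: ler_wpM2l => //.
have XZ' : X * Z = (t * X) * (t^-1 * Z).
  by rewrite [RHS]mulrACA divff ?mul1r// gt_eqF.
rewrite XZ'.
have yg := young p1 pq (mulr_ge0 (ltW t0) X0) (mulr_ge0 (ltW ((ltac:(by rewrite invr_gt0)) : 0 < t^-1)) Z0).
apply: (le_trans yg).
have Xp : X `^ p = S' * (F / S) `^ p.
  by rewrite /X powRM ?powR_ge0// -(powRrM S') mulVf ?gt_eqF// powRr1 ?(ltW S'0)// mulrC.
have Zq : Z `^ q = V' * (G / V) `^ q.
  by rewrite /Z powRM ?powR_ge0// -(powRrM V') mulVf ?gt_eqF// powRr1 ?(ltW V'0)// mulrC.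
have ti : 0 <= t^-1 by rewrite invr_ge0 ltW.
rewrite (powRM _ (ltW t0) X0) (powRM _ ti Z0) Xp Zq; apply: lerD.
  by rewrite ler_piMr ?invf_le1 ?(ltW p1)// !mulr_ge0 ?powR_ge0 ?(ltW S'0).
by rewrite ler_piMr ?invf_le1 ?(ltW q1)// !mulr_ge0 ?powR_ge0 ?(ltW V'0).
Qed.

(** Self-improvement: when the quantity to be bounded controls its own dual
    factor, Young's inequality with a suitable parameter absorbs it. *)
Lemma sparse_form_self n (N : R) : 0 < D -> bg 0 0 = N ->
  N = \sum_(j < n) \sum_(k < K ^ j) f j k * g j k / M j ->
  N <= (2 * D * q * p) `^ p * bf 0 0.
Proof.
move=> Dp gN NE; have p0 : 0 < p := lt_trans ltr01 p1.
have q1 := conj_gt1 p1 pq; have q0 : 0 < q := lt_trans ltr01 q1.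
pose A := 2 * D * p `^ q.
have A0 : 0 < A by rewrite !mulr_gt0 ?powR_gt0.
pose t := A `^ q^-1; have t0 : 0 < t by rewrite powR_gt0.
have := sparse_form n t0; rewrite -NE gN.
have tq : t^-1 `^ q = A^-1.
  by rewrite -(powR_inv1 (ltW t0)) -powRrM mulN1r powRN /t -powRrM mulVf ?gt_eqF// powRr1 ?(ltW A0).
have tp : t `^ p = A `^ (p - 1).
  rewrite /t -powRrM; congr (_ `^ _).
  by rewrite -[in LHS](conj_div p1 pq) mulrC mulfK// gt_eqF.
rewrite tq tp.
have -> : D * (A `^ (p - 1) * (q `^ p * bf 0 0) + A^-1 * (p `^ q * N)) =
    D * A `^ (p - 1) * q `^ p * bf 0 0 + N / 2.
  by rewrite /A; field; rewrite !gt_eqF ?powR_gt0.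
move=> h; have : N <= 2 * D * A `^ (p - 1) * q `^ p * bf 0 0 by lra.
move/le_trans; apply; rewrite le_eqVlt; apply/orP; left; apply/eqP.
rewrite /A [in LHS]powRM ?powR_ge0 ?mulr_ge0 ?(ltW Dp)// -powRrM.
rewrite [q * (p - 1)]mulrC (conj_div p1 pq).
rewrite [in RHS]powRM ?mulr_ge0 ?(ltW Dp) ?(ltW p0) ?(ltW q0)//.
rewrite [in RHS]powRM ?mulr_ge0 ?(ltW Dp) ?(ltW p0) ?(ltW q0)//.
rewrite -[(2 * D) `^ p](powR_split p1) ?mulr_ge0 ?(ltW Dp)//.
ring.
Qed.

End Form.
End SparseForm.


(** * Integrals of products of weights *)

Section RealIntegral.
Context {R : realType} d (T : measurableType d).
Variable mu : {measure set T -> \bar R}.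
Variable D : set T.
Hypothesis mD : measurable D.
Implicit Types h : T -> R.

Lemma Rintegral_mul_indic h (A : set T) : A `<=` D ->
  \int[mu]_(x in D) (h x * \1_A x) = \int[mu]_(x in A) h x.
Proof.
move=> AD; rewrite -[in RHS](setIidr AD) Rintegral_mkcondr.
by apply: eq_Rintegral => x _; rewrite patch_indic.
Qed.

Lemma integrable_mul_indic h (A : set T) : measurable A ->
  mu.-integrable D (EFin \o h) -> mu.-integrable D (EFin \o (fun x => h x * \1_A x)).
Proof.
move=> mA ih; have mh := measurable_int mu ih.
apply: le_integrable ih => //.
  apply/measurable_EFinP/measurable_funM; first exact/measurable_EFinP.
  exact: measurable_indic.
move=> x _; rewrite lee_fin normrM indicE normr_nat.
by rewrite ler_piMr// lern1 leq_b1.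
Qed.

Lemma Rintegral_bigsum (I : Type) (r : seq I) (F : I -> T -> R) :
  (forall i, mu.-integrable D (EFin \o F i)) ->
  mu.-integrable D (EFin \o (fun x => \sum_(i <- r) F i x)) /\
  \int[mu]_(x in D) (\sum_(i <- r) F i x) = \sum_(i <- r) \int[mu]_(x in D) F i x.
Proof.
move=> iF; elim: r => [|i r [ir IH]].
  rewrite big_nil; under eq_Rintegral do rewrite big_nil.
  rewrite Rintegral_cst// mul0r; split => //.
  rewrite (_ : _ \o _ = cst 0%E); first exact: integrable0.
  by apply/funext => x /=; rewrite big_nil.
rewrite [X in _ /\ _ = X]big_cons -IH -RintegralD//.
split; last by apply: eq_Rintegral => x _; rewrite big_cons.
rewrite (_ : _ \o _ = EFin \o (fun x => F i x + \sum_(j <- r) F j x)).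
  by apply: integrable_add => //; exact: iF.
by apply/funext => x /=; rewrite big_cons.
Qed.

Lemma Rintegral_le2 (A : set T) (a b c : R) (h1 h2 h3 : T -> R) :
  measurable A -> A `<=` D ->
  mu.-integrable D (EFin \o h1) -> mu.-integrable D (EFin \o h2) ->
  mu.-integrable D (EFin \o h3) ->
  (forall x, D x -> a * h1 x <= b * h2 x + c * h3 x) ->
  a * \int[mu]_(x in A) h1 x <=
  b * \int[mu]_(x in A) h2 x + c * \int[mu]_(x in A) h3 x.
Proof.
move=> mA AD i1 i2 i3 h.
have S f : mu.-integrable D f -> mu.-integrable A f.
  exact: integrableS.
have {}i1 := S _ i1; have {}i2 := S _ i2; have {}i3 := S _ i3.
rewrite -!RintegralZl// -RintegralD//; last 2 first.
- exact: integrable_scale.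
- exact: integrable_scale.
apply: le_Rintegral => //; first exact: integrable_scale.
  by apply: integrable_add => //; exact: integrable_scale.
by move=> x /AD /h.
Qed.

Lemma integrable_bounded h (k : T -> R) (C : R) : measurable_fun D k ->
  (forall x, D x -> `|k x| <= C) ->
  mu.-integrable D (EFin \o h) -> mu.-integrable D (EFin \o (fun x => k x * h x)).
Proof.
move=> mk kC ih; have mh := measurable_int mu ih.
apply: le_integrable (integrable_scale mD C ih) => //.
  by apply/measurable_EFinP/measurable_funM => //; exact/measurable_EFinP.
move=> x Dx; rewrite lee_fin !normrM ler_wpM2r//.
exact: (le_trans (kC _ Dx) (ler_norm _)).
Qed.

End RealIntegral.

Section PointwiseYoung.
Context {R : realType}.
Variables p q : R.
Hypothesis p1 : 1 < p.
Hypothesis pq : p^-1 + q^-1 = 1.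
Implicit Types f g l v t : R.

Let p0 : 0 < p := lt_trans ltr01 p1.
Let q0 : 0 < q := lt_trans ltr01 (conj_gt1 p1 pq).

Definition dual_weight v : R := v `^ (- (q / p)).

Lemma dual_weight_gt0 v : 0 < v -> 0 < dual_weight v.
Proof. exact: powR_gt0. Qed.

(** This form of Young's inequality is linear in [f], in [f `^ p * v] and in the
    dual weight, hence can be integrated over any set. *)
Lemma young_weight f l v : 0 <= f -> 0 <= l -> 0 < v ->
  p * q * l `^ (p - 1) * f <= q `^ p * (f `^ p * v) + (p - 1) * l `^ p * dual_weight v.
Proof.
move=> f0 l0 v0; have pp := p0; have qq := q0.
have vp : 0 <= v `^ p^-1 by exact: powR_ge0.
have vm : 0 <= v `^ (- p^-1) by exact: powR_ge0.
have qf : 0 <= q * f by rewrite mulr_ge0// ltW.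
have lp := powR_ge0 l (p - 1).
have := young p1 pq (mulr_ge0 qf vp) (mulr_ge0 lp vm).
rewrite (powRM _ qf vp) (powRM _ (ltW qq) f0) (powRM _ lp vm) (powR_conj p1 pq l0).
rewrite -!powRrM mulVf ?gt_eqF// (powRr1 (ltW v0)).
have -> : - p^-1 * q = - (q / p) by rewrite mulNr mulrC.
rewrite -/(dual_weight v).
have -> : q * f * v `^ p^-1 * (l `^ (p - 1) * v `^ (- p^-1)) =
  q * f * l `^ (p - 1) * (v `^ p^-1 / v `^ p^-1).
  by rewrite powRN; ring.
rewrite divff ?mulr1; last by rewrite gt_eqF// powR_gt0.
rewrite -(ler_pM2l pp) => /le_trans.
have -> : p * q * l `^ (p - 1) * f = p * (q * f * l `^ (p - 1)) by ring.
apply; rewrite mulrDr lerD//.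
  by rewrite mulrC divfK ?gt_eqF// mulrA.
have -> : p * (l `^ p * dual_weight v / q) = (p / q) * l `^ p * dual_weight v by ring.
rewrite -[X in X / q](conj_div p1 pq) mulfK//; by rewrite gt_eqF.
Qed.

Lemma young_one t v : 0 < t -> 0 < v ->
  1 <= t `^ p / p * v + t^-1 `^ q / q * dual_weight v.
Proof.
move=> t0 v0; have pp := p0; have qq := q0.
have vp : 0 <= v `^ p^-1 by exact: powR_ge0.
have vm : 0 <= v `^ (- p^-1) by exact: powR_ge0.
have ti : 0 <= t^-1 by rewrite invr_ge0 ltW.
have := young p1 pq (mulr_ge0 (ltW t0) vp) (mulr_ge0 ti vm).
rewrite (powRM _ (ltW t0) vp) (powRM _ ti vm) -(powRrM v) -(powRrM v).
rewrite mulVf ?gt_eqF// (powRr1 (ltW v0)).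
have -> : - p^-1 * q = - (q / p) by rewrite mulNr mulrC.
rewrite mulrACA divff ?gt_eqF// mul1r [v `^ (- p^-1)]powRN divff ?gt_eqF ?powR_gt0//.
by rewrite [_ * v / p]mulrAC [_ * _ / q]mulrAC.
Qed.

Lemma young_weight_dual f l v : 0 <= f -> 0 <= l -> 0 <= v ->
  q * p * l `^ (q - 1) * (f * v) <= p `^ q * (f `^ q * v) + (q - 1) * l `^ q * v.
Proof.
move=> f0 l0 v0; have pp := p0; have qq := q0.
have q1 := conj_gt1 p1 pq; have qp : q^-1 + p^-1 = 1 by rewrite addrC.
have pf : 0 <= p * f by rewrite mulr_ge0// ltW.
have := young q1 qp pf (powR_ge0 l (q - 1)).
rewrite (powRM _ (ltW pp) f0) (powR_conj q1 qp l0) -(ler_pM2l qq).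
move=> /(ler_wpM2r v0) /le_trans h.
have -> : q * p * l `^ (q - 1) * (f * v) = q * (p * f * l `^ (q - 1)) * v by ring.
apply: h; rewrite mulrDr mulrDl lerD//.
  by rewrite [q * _]mulrC divfK ?gt_eqF// mulrA.
have -> : q * (l `^ q / p) * v = (q / p) * l `^ q * v by ring.
by rewrite -[X in X / p](conj_div q1 qp) mulfK// gt_eqF.
Qed.

(** Optimizing Young's inequality in its parameter yields Hoelder's. *)
Lemma young_optimize (m a b : R) : 0 < m -> 0 <= a -> 0 <= b ->
  (forall t, 0 < t -> m <= t `^ p / p * a + t^-1 `^ q / q * b) ->
  [/\ 0 < a, 0 < b & m <= a `^ p^-1 * b `^ q^-1].
Proof.
move=> m0 a0 b0 H; have pp := p0; have qq := q0.
have a1 : 0 < a.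
  rewrite lt_def a0 andbT; apply/eqP => aE; rewrite aE in H.
  pose x := b / (q * m) + 1.
  have x1 : 0 < x.
    apply: ltr_wpDl => //; exact: divr_ge0 b0 (ltW (mulr_gt0 qq m0)).
  have t0 : 0 < x `^ q^-1 by rewrite powR_gt0.
  have := H _ t0; rewrite mulr0 add0r -(powR_inv1 (ltW t0)) -!powRrM.
  rewrite (_ : q^-1 * (-1 * q) = -1); last by field; rewrite gt_eqF.
  rewrite (powR_inv1 (ltW x1)) -mulrA ler_pdivlMl// => h.
  suff : x * m = q^-1 * b + m by lra.
  by rewrite /x; field; rewrite !gt_eqF.
have b1 : 0 < b.
  rewrite lt_def b0 andbT; apply/eqP => bE; rewrite bE in H.
  pose x := a / (p * m) + 1.
  have x1 : 0 < x.
    apply: ltr_wpDl => //; exact: divr_ge0 a0 (ltW (mulr_gt0 pp m0)).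
  have t0 : 0 < (x^-1) `^ p^-1 by rewrite powR_gt0 ?invr_gt0.
  have := H _ t0; rewrite mulr0 addr0 -!powRrM mulVf ?gt_eqF//.
  rewrite powRr1 ?invr_ge0 ?(ltW x1)// -mulrA ler_pdivlMl// => h.
  suff : x * m = p^-1 * a + m by lra.
  by rewrite /x; field; rewrite !gt_eqF.
split => //.
have ap : 0 < a `^ (p^-1 * q^-1) by rewrite powR_gt0.
have bp : 0 < b `^ (p^-1 * q^-1) by rewrite powR_gt0.
set t := b `^ (p^-1 * q^-1) / a `^ (p^-1 * q^-1).
have t0 : 0 < t by rewrite divr_gt0.
have tp : t `^ p = b `^ q^-1 / a `^ q^-1.
  rewrite /t powRM ?invr_ge0 ?(ltW ap) ?(ltW bp)//.
  rewrite -(powR_inv1 (ltW ap)) -!powRrM.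
  have -> : p^-1 * q^-1 * p = q^-1 by field; rewrite !gt_eqF.
  have -> : p^-1 * q^-1 * (-1 * p) = - q^-1 by field; rewrite !gt_eqF.
  by rewrite powRN.
have tq : t^-1 `^ q = a `^ p^-1 / b `^ p^-1.
  rewrite /t invf_div powRM ?invr_ge0 ?(ltW ap) ?(ltW bp)//.
  rewrite -(powR_inv1 (ltW bp)) -!powRrM.
  have -> : p^-1 * q^-1 * q = p^-1 by field; rewrite !gt_eqF.
  have -> : p^-1 * q^-1 * (-1 * q) = - p^-1 by field; rewrite !gt_eqF.
  by rewrite powRN.
have := H t t0; rewrite tp tq => /le_trans; apply.
have eq1 x : 0 < x -> x `^ p^-1 * x `^ q^-1 = x.
  by move=> x0; rewrite -powRD ?pq ?(powRr1 (ltW x0))// oner_eq0.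
have ea := eq1 _ a1; have eb := eq1 _ b1.
have Ap : 0 < a `^ p^-1 by rewrite powR_gt0.
have Aq : 0 < a `^ q^-1 by rewrite powR_gt0.
have Bp : 0 < b `^ p^-1 by rewrite powR_gt0.
have Bq : 0 < b `^ q^-1 by rewrite powR_gt0.
rewrite -{2}ea -{3}eb le_eqVlt; apply/orP; left; apply/eqP.
move: (a `^ p^-1) (a `^ q^-1) (b `^ p^-1) (b `^ q^-1) Ap Aq Bp Bq => A1 A2 B1 B2 *.
rewrite -[RHS]mul1r -pq; field; by rewrite !gt_eqF.
Qed.

End PointwiseYoung.


(** * The testing condition on squares and boxes *)

Lemma integral_gt0 (R : realType) d (T : measurableType d)
    (mu : {measure set T -> \bar R}) (A : set T) (h : T -> R) :
  measurable A -> measurable_fun A h -> (forall x, A x -> 0 < h x) ->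
  (0 < mu A)%E -> (0 < \int[mu]_(x in A) (h x)%:E)%E.
Proof.
move=> mA mh h0 A0; rewrite lt_neqAle; apply/andP; split; last first.
  by apply: integral_ge0 => x Ax; rewrite lee_fin ltW// h0.
apply/eqP => E; have mh' : measurable_fun A (EFin \o h) by exact/measurable_EFinP.
have E' : (\int[mu]_(x in A) `|(EFin \o h) x| = 0)%E.
  rewrite [RHS]E; apply: eq_integral => x; rewrite inE => Ax /=.
  by rewrite ger0_norm// ltW// h0.
have [N [mN N0 hN]] := (ae_eq_integral_abs mu mA mh').1 E'.
have : (mu A <= mu N)%E.
  apply: le_measure; rewrite ?inE// => x Ax; apply: hN => /= /(_ Ax) [] hx.
  by have := h0 _ Ax; rewrite hx ltxx.
by rewrite N0 leNgt A0.
Qed.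

Section Testing.
Context {R : realType}.
Variable om : {finite_measure set (measurableTypeR R) -> \bar R}.
Hypothesis hom : class_R om.
Local Notation mu := (polar_measure om).
Local Notation W := (bmass om).
Variable p : R.
Hypothesis p1 : 1 < p.
Local Notation q := (conj_exp p).
Implicit Types v f : R[i] -> R.

Lemma conj_expE : p^-1 + q^-1 = 1.
Proof. by rewrite /conj_exp invrK subrKC. Qed.

Lemma conj_exp_div : p / q = p - 1.
Proof.
have pq := conj_expE; have q1 := conj_gt1 p1 pq.
have q0 : q != 0 by rewrite gt_eqF// (lt_trans ltr01).
by rewrite -[X in X / q](conj_div p1 pq) mulfK.
Qed.

Lemma measurable_powR_comp d (T : measurableType d) (D : set T) (h : T -> R) (r : R) :
  measurable_fun D h -> measurable_fun D (fun x => h x `^ r).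
Proof. by move=> mh; exact: measurableT_comp (measurable_powR r) mh. Qed.

Lemma weight_measurable v : is_weight mu v -> measurable_fun disc v.
Proof. by move=> [_ /measurable_int/measurable_EFinP]. Qed.

Lemma carleson_mass_gt0 a l : 0 < l -> l <= 1 -> (0 < mu (carleson a l))%E.
Proof.
move=> l0 l1; have [c c0 hc] := carleson_mass_ge hom.
apply: lt_le_trans (hc a l l0 l1); rewrite lte_fin !mulr_gt0//.
exact: bmass_gt0.
Qed.

(** The integral of the dual weight is finite because that of the positive
    function [v] does not vanish. *)
Lemma bekolle_square v a l : is_weight mu v -> bekolle_class mu p v ->
  0 < l -> l <= 1 ->
  mu.-integrable (carleson a l) (EFin \o (fun z => dual_weight p q (v z))) /\
  (\int[mu]_(z in carleson a l) v z) *
  (\int[mu]_(z in carleson a l) dual_weight p q (v z)) `^ (p - 1) <=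
  fine (bekolle mu p v) * fine (mu (carleson a l)) `^ p.
Proof.
move=> wv bv l0 l1; set S := carleson a l.
have p0 : 0 < p := lt_trans ltr01 p1.
have mS : measurable S by exact: measurable_carleson.
have Sd : S `<=` disc by exact: carleson_sub_disc.
have mv : measurable_fun S v by apply: measurable_funS (weight_measurable wv).
have v0 z : S z -> 0 < v z by move=> /Sd; exact: wv.1.
have muS0 : (0 < mu S)%E by exact: carleson_mass_gt0.
have muSf : mu S \is a fin_num by exact: fin_num_measure.
have iv : mu.-integrable S (EFin \o v) by apply: integrableS wv.2.
have V0 : (0 < \int[mu]_(z in S) (v z)%:E)%E by exact: integral_gt0.
have Vf : (\int[mu]_(z in S) (v z)%:E)%E \is a fin_num.
  by exact: integrable_fin_num.
have ms : measurable_fun S (fun z => dual_weight p q (v z)).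
  exact: measurable_powR_comp.
set X := (\int[mu]_(z in S) (dual_weight p q (v z))%:E)%E.
have X0 : (0 <= X)%E.
  by apply: integral_ge0 => z /v0 ?; rewrite lee_fin ltW// dual_weight_gt0.
have leB : ((\int[mu]_(z in S) (v z)%:E) / mu S * (X / mu S) `^ (p / q) <=
    bekolle mu p v)%E.
  by apply: ereal_sup_ubound; exists S => //; exists a, l.
have muE : mu S = (fine (mu S))%:E by rewrite fineK.
have VE : (\int[mu]_(z in S) (v z)%:E)%E = (\int[mu]_(z in S) v z)%:E by rewrite fineK.
have M0 : 0 < fine (mu S) by rewrite fine_gt0// muS0 ltey_eq muSf.
move: V0; rewrite VE lte_fin => V0.
rewrite muE VE inver gt_eqF// conj_exp_div -EFinM in leB.
have VM : 0 < \int[mu]_(z in S) v z / fine (mu S) by rewrite divr_gt0.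
have Xf : X \is a fin_num.
  rewrite ge0_fin_numE// ltNge leye_eq; apply/eqP => XE; move: leB.
  rewrite XE gt0_mulye ?lte_fin ?invr_gt0// poweRyr ?gt_eqF ?subr_gt0// gt0_muley ?lte_fin//.
  by rewrite leye_eq => /eqP bE; move: bv; rewrite /bekolle_class bE ltxx.
have iS : mu.-integrable S (EFin \o (fun z => dual_weight p q (v z))).
  apply/integrableP; split; first exact/measurable_EFinP.
  rewrite (eq_integral (fun z => (dual_weight p q (v z))%:E)); last first.
    by move=> z; rewrite inE => /v0 vz /=; rewrite ger0_norm// ltW// dual_weight_gt0.
  by rewrite -/X ltey_eq Xf.
split => //; rewrite -[\int[mu]_(z in S) dual_weight p q (v z)]/(fine X).
have bf : bekolle mu p v \is a fin_num.
  rewrite ge0_fin_numE//; apply: le_trans leB.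
  by rewrite mule_ge0 ?poweR_ge0 ?lee_fin ?ltW.
have XE : X = (fine X)%:E by rewrite fineK.
have bE : bekolle mu p v = (fine (bekolle mu p v))%:E by rewrite fineK.
rewrite bE XE -[((fine X)%:E * _)%E]EFinM poweR_EFin -EFinM lee_fin in leB; move: leB.
have X1 : 0 <= fine X by exact: fine_ge0.
move: (fine X) (fine (mu S)) (\int[mu]_(z in S) v z) (fine (bekolle mu p v)) X1 M0 V0.
move=> x M V b x0 M0 V0.
by rewrite ratio_powR// ler_pdivrMr// powR_gt0.
Qed.

Lemma carleson_disc : carleson 0 1 = @disc R.
Proof.
apply/seteqP; split; first by apply: carleson_sub_disc => //; exact: lexx.
have := @box_sub_carleson R 1 false 0 0.
by rewrite box0 /cut mul0r mulr0 addr0 side0.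
Qed.

Lemma dual_weight_integrable v : is_weight mu v -> bekolle_class mu p v ->
  mu.-integrable disc (EFin \o (fun z => dual_weight p q (v z))).
Proof.
by move=> wv bv; rewrite -carleson_disc; have [] := bekolle_square 0 wv bv ltr01 (lexx 1).
Qed.

Lemma bekolle_ge0 v : is_weight mu v -> (0 <= bekolle mu p v)%E.
Proof.
move=> wv; apply: le_ereal_sup_tmp; eexists.
  by exists (carleson 0 1) => //; exists 0, 1.
rewrite mule_ge0 ?poweR_ge0//; apply: mule_ge0; rewrite ?inve_ge0//.
by apply: integral_ge0 => z; rewrite carleson_disc => dz; rewrite lee_fin ltW// wv.1.
Qed.

Section Boxes.
Variable m : nat.
Local Notation M j := (side m j * W (side m j)).
Variable c : R.
Hypothesis c0 : 0 < c.
Hypothesis hc : forall s j k, (k < split m ^ j)%N ->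
  ((c * M j)%:E <= mu (topbox m s j k))%E.

Lemma box_scale_gt0 j : 0 < M j.
Proof. by rewrite mulr_gt0 ?side_gt0// bmass_gt0// side_gt0. Qed.

Lemma weight_box v s j k : is_weight mu v -> bekolle_class mu p v ->
  (\int[mu]_(z in box m s j k) v z) *
  (\int[mu]_(z in box m s j k) dual_weight p q (v z)) `^ (p - 1) <=
  fine (bekolle mu p v) * (4 * pi) `^ p * M j `^ p.
Proof.
move=> wv bv; have iS := dual_weight_integrable wv bv.
pose a : R := cut s + 2 * pi * (k%:R * side m j).
have l0 := @side_gt0 R m j; have l1 := @side_le1 R m j.
have [_ h] := bekolle_square a wv bv l0 l1.
have sub := @box_sub_carleson R m s j k; rewrite -/a in sub.
have mb := @measurable_box R m s j k.
have mS : measurable (carleson a (side m j)) by exact: measurable_carleson.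
have Sd : carleson a (side m j) `<=` disc by exact: carleson_sub_disc.
have mono (h' : R[i] -> R) : mu.-integrable disc (EFin \o h') ->
    (forall z, disc z -> 0 <= h' z) ->
    0 <= \int[mu]_(z in box m s j k) h' z <= \int[mu]_(z in carleson a (side m j)) h' z.
  move=> ih h0; apply/andP; split.
    by apply: Rintegral_ge0 => z /sub/Sd/h0.
  apply: fine_le.
  - by apply: integrable_fin_num => //; apply: integrableS ih => // z /sub/Sd.
  - by apply: integrable_fin_num => //; apply: integrableS ih.
  apply: ge0_subset_integral => //.
    by apply: measurable_int; apply: integrableS ih.
  by move=> z /Sd/h0; rewrite lee_fin.
have /andP[v0 v1] := mono _ wv.2 (fun z dz => ltW (wv.1 z dz)).
have /andP[s0 s1] := mono _ iS (fun z dz => ltW (dual_weight_gt0 p q (wv.1 z dz))).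
have p10 : 0 <= p - 1 by rewrite subr_ge0 ltW.
have sp := ge0_ler_powR p10 s0 (le_trans s0 s1) s1.
apply: le_trans (ler_pM v0 (powR_ge0 _ _) v1 sp) _; apply: (le_trans h).
have muf : mu (carleson a (side m j)) \is a fin_num by exact: fin_num_measure.
have b0 : 0 <= fine (bekolle mu p v).
  exact/fine_ge0/bekolle_ge0.
rewrite -mulrA; apply: ler_wpM2l => //.
have M0 := box_scale_gt0 j; have pi0 := @pi_gt0 R.
have p40 : 0 <= 4 * pi :> R by rewrite mulr_ge0// ltW.
rewrite -(powRM _ p40 (ltW M0)).
apply: ge0_ler_powR; rewrite ?nnegrE.
- exact: le_trans ler01 (ltW p1).
- exact: fine_ge0.
- by rewrite mulr_ge0// ltW.
by rewrite -lee_fin fineK//; exact: carleson_mass_le.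
Qed.

(** Hoelder's inequality for the constant function 1, as a product of powers of
    the weight and of its dual. *)
Lemma weight_topbox v s j k : is_weight mu v -> bekolle_class mu p v ->
  (k < split m ^ j)%N ->
  let v' := \int[mu]_(z in topbox m s j k) v z in
  let s' := \int[mu]_(z in topbox m s j k) dual_weight p q (v z) in
  [/\ 0 < v', 0 < s' & c * M j <= v' `^ p^-1 * s' `^ q^-1].
Proof.
move=> wv bv kj v' s'; have iS := dual_weight_integrable wv bv.
have mt := @measurable_topbox R m s j k.
have td : topbox m s j k `<=` @disc R by move=> z [bz _]; exact: box_sub_disc bz.
apply: (young_optimize p1 conj_expE).
- by rewrite mulr_gt0// box_scale_gt0.
- by apply: Rintegral_ge0 => z /td dz; rewrite ltW// wv.1.
- by apply: Rintegral_ge0 => z /td dz; rewrite ltW// dual_weight_gt0// wv.1.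
move=> t t0.
have muf : mu (topbox m s j k) \is a fin_num by exact: fin_num_measure.
apply: (@le_trans _ _ (fine (mu (topbox m s j k)))).
  by rewrite -lee_fin fineK//; exact: hc.
have := @Rintegral_le2 R _ _ mu disc _ (topbox m s j k) 1
  (t `^ p / p) (t^-1 `^ q / q) (cst 1) v (fun z => dual_weight p q (v z)) mt td.
rewrite Rintegral_cst// !mul1r; apply => //.
- exact: finite_measure_integrable_cst.
- exact: wv.2.
move=> z dz; rewrite mul1r; apply: (young_one p1 conj_expE) => //.
exact: wv.1.
Qed.

End Boxes.
End Testing.


(** * Dyadic averaging operators *)

Section BoxIntegral.
Context {R : realType}.
Variable m : nat.
Local Notation K := (split m).
Variable mu : {measure set R[i] -> \bar R}.
Implicit Types (h : R[i] -> R) (s : bool) (j k n : nat).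

Lemma box_indic s j k (z : R[i]) : \1_(box m s j k) z =
  \1_(topbox m s j k) z + \sum_(i < K) \1_(box m s j.+1 (K * k + i)%N) z :> R.
Proof.
have [bz|bz] := pselect (box m s j k z); last first.
  rewrite indicE memNset// indicE memNset; last first.
    by move=> tz; apply: bz; apply/box_splitE; left.
  rewrite add0r big1// => i _; rewrite indicE memNset// => cz; apply: bz.
  by apply/box_splitE; right; exists i.
rewrite indicE mem_set//; have [tz|[i iK ci]] := (box_splitE _ _ _ _ _).1 bz.
  rewrite indicE mem_set// big1 ?addr0// => i _; rewrite indicE memNset//.
  exact: topbox_child_disj tz.
rewrite indicE memNset; last by move=> tz; exact: topbox_child_disj tz ci.
rewrite add0r (bigD1 (Ordinal iK))//= indicE mem_set// big1 ?addr0// => i' ii'.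
rewrite indicE memNset// => ci'; move/eqP : ii'; apply.
by apply: val_inj => /=; apply/eqP; rewrite -(eqn_add2l (K * k)); apply/eqP; exact: box_inj ci' ci.
Qed.

Lemma box_integral_split h s j k : mu.-integrable disc (EFin \o h) ->
  \int[mu]_(z in box m s j k) h z = \int[mu]_(z in topbox m s j k) h z +
  \sum_(i < K) \int[mu]_(z in box m s j.+1 (K * k + i)%N) h z.
Proof.
move=> ih; have md := @measurable_disc R.
have bd j' k' : box m s j' k' `<=` @disc R by exact: box_sub_disc.
have td : topbox m s j k `<=` @disc R by move=> z [/bd].
rewrite -(Rintegral_mul_indic _ _ (bd j k)) -(Rintegral_mul_indic _ _ td).
under [in RHS]eq_bigr do rewrite -(Rintegral_mul_indic _ _ (bd _ _)).
have [i1 <-] := @Rintegral_bigsum R _ _ mu disc md _ (index_enum 'I_K)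
  (fun i z => h z * \1_(box m s j.+1 (K * k + i)%N) z)
  (fun i => integrable_mul_indic md (@measurable_box R m s j.+1 (K * k + i)) ih).
rewrite -RintegralD//; last exact: integrable_mul_indic (@measurable_topbox _ _ _ _ _) ih.
by apply: eq_Rintegral => z _; rewrite box_indic mulrDr mulr_sumr.
Qed.

Lemma box_integral_ge0 h s j k : (forall z, disc z -> 0 <= h z) ->
  0 <= \int[mu]_(z in box m s j k) h z.
Proof. by move=> h0; apply: Rintegral_ge0 => z /box_sub_disc; exact: h0. Qed.

End BoxIntegral.

Section Averages.
Context {R : realType}.
Variable om : {finite_measure set (measurableTypeR R) -> \bar R}.
Hypothesis hom : class_R om.
Local Notation mu := (polar_measure om).
Local Notation W := (bmass om).
Variable p : R.
Hypothesis p1 : 1 < p.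
Local Notation q := (conj_exp p).
Variable m : nat.
Local Notation K := (split m).
Local Notation M j := (side m j * W (side m j)).
Variable c : R.
Hypothesis c0 : 0 < c.
Hypothesis hc : forall s j k, (k < split m ^ j)%N ->
  ((c * M j)%:E <= mu (topbox m s j k))%E.
Implicit Types (v f : R[i] -> R) (s : bool) (j k n : nat).

(** A sparse operator, truncated at generation [n] so that it is bounded and all
    norms are finite before they are estimated. The quantity [M j] stands for
    the mass of a box, to which it is comparable. *)
Definition avg n s f (z : R[i]) : R :=
  \sum_(j < n) \sum_(k < K ^ j)
    (\int[mu]_(u in box m s j k) f u) / M j * \1_(box m s j k) z.

Section Bounded.
Variables (n : nat) (s : bool) (f : R[i] -> R).
Hypothesis f0 : forall z, disc z -> 0 <= f z.

Let coef_ge0 j k : 0 <= (\int[mu]_(u in box m s j k) f u) / M j.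
Proof.
by rewrite divr_ge0 ?box_integral_ge0// ltW//; exact: box_scale_gt0.
Qed.

Lemma avg_ge0 z : 0 <= avg n s f z.
Proof.
apply: sumr_ge0 => j _; apply: sumr_ge0 => k _.
by rewrite mulr_ge0.
Qed.

Lemma avg_le z : avg n s f z <=
  \sum_(j < n) \sum_(k < K ^ j) (\int[mu]_(u in box m s j k) f u) / M j.
Proof.
apply: ler_sum => j _; apply: ler_sum => k _.
by rewrite ler_piMr// indicE lern1 leq_b1.
Qed.

Lemma measurable_avg : measurable_fun disc (avg n s f).
Proof.
apply: measurable_sum => j; apply: measurable_sum => k.
apply: measurable_funM => //; apply: measurable_indic; exact: measurable_box.
Qed.

Lemma integrable_powR_avg (h : R[i] -> R) (r : R) : 0 <= r ->
  mu.-integrable disc (EFin \o h) ->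
  mu.-integrable disc (EFin \o (fun z => avg n s f z `^ r * h z)).
Proof.
move=> r0 ih.
pose S := \sum_(j < n) \sum_(k < K ^ j) (\int[mu]_(u in box m s j k) f u) / M j.
apply: (@integrable_bounded _ _ _ _ _ _ _ _ (S `^ r)) => //.
  by apply: measurable_powR_comp; exact: measurable_avg.
move=> z dz; rewrite ger0_norm ?powR_ge0//.
have A0 := avg_ge0 z; have A1 := avg_le z.
exact: ge0_ler_powR r0 _ _ A0 (le_trans A0 A1) A1.
Qed.

Lemma avg_pairing (h : R[i] -> R) : mu.-integrable disc (EFin \o h) ->
  \int[mu]_(z in disc) (avg n s f z * h z) =
  \sum_(j < n) \sum_(k < K ^ j) (\int[mu]_(u in box m s j k) f u) *
     (\int[mu]_(u in box m s j k) h u) / M j.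
Proof.
move=> ih; have md := @measurable_disc R.
pose F j k z := (\int[mu]_(u in box m s j k) f u) / M j * (h z * \1_(box m s j k) z).
have iF j k : mu.-integrable disc (EFin \o F j k).
  apply: integrable_scale => //; apply: integrable_mul_indic => //.
  exact: measurable_box.
have iG j := Rintegral_bigsum md (index_enum 'I_(K ^ j)) (fun k : 'I_(K ^ j) => iF j k).
have [_ e] := Rintegral_bigsum md (index_enum 'I_n) (fun j : 'I_n => (iG j).1).
rewrite (@eq_Rintegral _ _ _ _ _ (fun z => \sum_(j < n) \sum_(k < K ^ j) F j k z)).
  rewrite e; apply: eq_bigr => j _; rewrite (iG j).2; apply: eq_bigr => k _.
  rewrite RintegralZl//; last by apply: integrable_mul_indic => //; exact: measurable_box.
  rewrite Rintegral_mul_indic; last exact: box_sub_disc.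
  by rewrite mulrAC.
move=> z _; rewrite mulr_suml; apply: eq_bigr => j _; rewrite mulr_suml.
by apply: eq_bigr => k _; rewrite /F [h z * _]mulrC mulrA.
Qed.

End Bounded.

(** Hoelder's inequality between the weight and its dual. *)
Lemma weighted_integrable v f : is_weight mu v -> bekolle_class mu p v ->
  measurable_fun disc f -> (forall z, disc z -> 0 <= f z) ->
  mu.-integrable disc (EFin \o (fun z => f z `^ p * v z)) ->
  mu.-integrable disc (EFin \o f).
Proof.
move=> wv bv mf f0 ifv; have md := @measurable_disc R.
have iS := dual_weight_integrable hom p1 wv bv.
have pq := conj_expE p; have p0 : 0 < p := lt_trans ltr01 p1.
have q0 : 0 < q := lt_trans ltr01 (conj_gt1 p1 pq).
have i1 := integrable_scale md (q `^ p) ifv.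
have i2 := integrable_scale md (p - 1) iS.
have i3 := integrable_scale md (p * q)^-1 (integrable_add md i1 i2).
apply: le_integrable i3 => //; first exact/measurable_EFinP.
move=> z dz; rewrite lee_fin ger0_norm ?f0//; apply: le_trans (ler_norm _).
rewrite mulrC ler_pdivlMr ?mulr_gt0//.
have := young_weight p1 pq (f0 z dz) (ler01 : 0 <= 1 :> R) (wv.1 z dz).
by rewrite !powR1 !mulr1 mulrC.
Qed.

(** Pairing the average with its own power p - 1 gives back the integral to be
    bounded, so that the estimate of the bilinear form closes on itself. *)
Lemma avg_bound : exists2 C : R, 0 < C & forall v f n s,
  is_weight mu v -> bekolle_class mu p v ->
  measurable_fun disc f -> (forall z, disc z -> 0 <= f z) ->
  mu.-integrable disc (EFin \o (fun z => f z `^ p * v z)) ->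
  \int[mu]_(z in disc) (avg n s f z `^ p * v z) <=
  (C * fine (bekolle mu p v) `^ Num.max 1 (p - 1)^-1) `^ p *
    \int[mu]_(z in disc) (f z `^ p * v z).
Proof.
have pq := conj_expE p; have p0 : 0 < p := lt_trans ltr01 p1.
have q1 := conj_gt1 p1 pq; have q0 : 0 < q := lt_trans ltr01 q1.
have p10 : 0 < p - 1 by rewrite subr_gt0.
have pi0 : 0 <= 4 * pi :> R by rewrite mulr_ge0 ?pi_ge0.
have [D D0 hD] := node_bound p1 pq c0.
set e := Num.max _ _; have md := @measurable_disc R.
pose P : R := ((4 * pi) `^ p) `^ e.
have P0 : 0 < P by rewrite !powR_gt0// mulr_gt0 ?pi_gt0.
exists (2 * (D * P) * q * p) => [|v f n s wv bv mf f0 ifv]; first by rewrite !mulr_gt0.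
have iS := dual_weight_integrable hom p1 wv bv; have iV := wv.2.
have iF := weighted_integrable wv bv mf f0 ifv.
have v0 z : disc z -> 0 < v z by exact: wv.1.
set Q := fine _; pose A := avg n s f.
have A0 z : 0 <= A z by exact: avg_ge0.
have iG : mu.-integrable disc (EFin \o (fun z => A z `^ (p - 1) * v z)).
  by apply: integrable_powR_avg => //; exact: ltW.
have iN : mu.-integrable disc (EFin \o (fun z => A z `^ p * v z)).
  by apply: integrable_powR_avg => //; exact: ltW.
have bd j k : box m s j k `<=` @disc R by exact: box_sub_disc.
have mb j k := @measurable_box R m s j k.
have mt j k := @measurable_topbox R m s j k.
have td j k : topbox m s j k `<=` @disc R by move=> z [/bd].
pose I (h : R[i] -> R) j k := \int[mu]_(z in box m s j k) h z.
pose I' (h : R[i] -> R) j k := \int[mu]_(z in topbox m s j k) h z.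
have IS h : mu.-integrable disc (EFin \o h) ->
    forall j k, I h j k = I' h j k + \sum_(i < K) I h j.+1 (K * k + i)%N.
  by move=> ih j k; exact: box_integral_split.
have I0 h : (forall z, disc z -> 0 <= h z) -> forall j k, 0 <= I h j k.
  by move=> h0 j k; exact: box_integral_ge0.
pose S z := dual_weight p q (v z).
have S0 z : disc z -> 0 <= S z by move=> dz; rewrite ltW// dual_weight_gt0// v0.
have V0 z : disc z -> 0 <= v z by move=> /v0/ltW.
have G0 z : disc z -> 0 <= A z `^ (p - 1) * v z by move=> dz; rewrite mulr_ge0 ?powR_ge0 ?V0.
have top j k (kj : (k < K ^ j)%N) := @weight_topbox _ _ hom p p1 m c c0 hc v s j k wv bv kj.
have v'0 j k : (k < K ^ j)%N -> 0 < I' v j k by move=> /top[].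
have s'0 j k : (k < K ^ j)%N -> 0 < I' S j k by move=> /top[].
have M0 j : 0 < M j by exact: box_scale_gt0.
have Vl j k : I' v j k <= I v j k.
  by rewrite (IS _ iV) lerDl; apply: sumr_ge0 => i _; exact: I0.
have Sl j k : I' S j k <= I S j k.
  by rewrite (IS _ iS) lerDl; apply: sumr_ge0 => i _; exact: I0.
have Q0 : 0 < Q * (4 * pi) `^ p.
  have := @weight_box _ _ hom p p1 m v s 0 0 wv bv; rewrite -/Q => h.
  have : 0 < Q * (4 * pi) `^ p * M 0 `^ p.
    apply: lt_le_trans h; rewrite mulr_gt0 ?powR_gt0//.
      by apply: lt_le_trans (v'0 0 0 _) (Vl 0 0); rewrite expn0.
    by apply: lt_le_trans (s'0 0 0 _) (Sl 0 0); rewrite expn0.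
  by rewrite pmulr_lgt0// powR_gt0.
pose D' := D * (Q * (4 * pi) `^ p) `^ e.
have D'0 : 0 < D' by rewrite mulr_gt0// powR_gt0.
have node j k : (k < K ^ j)%N ->
    I S j k * I v j k <= D' * M j * (I' v j k `^ q^-1 * I' S j k `^ p^-1).
  move=> kj; have [_ _ h] := top j k kj.
  apply: hD => //; [exact: v'0|exact: s'0|exact: ltW|].
  exact: weight_box.
have gq z : (A z `^ (p - 1)) `^ q * v z = A z `^ p * v z by rewrite powR_conj.
have NE : \int[mu]_(z in disc) (A z `^ p * v z) =
   \sum_(j < n) \sum_(k < K ^ j) I f j k * I (fun z => A z `^ (p - 1) * v z) j k / M j.
  rewrite -avg_pairing//; apply: eq_Rintegral => z _.
  by rewrite -/(A z) -(powR_split p1 (A0 z)) mulrA [A z * _]mulrC.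
have fi (h0 : set R[i]) (h0d : measurable h0) (h0s : h0 `<=` @disc R) (l : R) : 0 <= l ->
    p * q * l `^ (p - 1) * \int[mu]_(z in h0) f z <=
    q `^ p * \int[mu]_(z in h0) (f z `^ p * v z) + (p - 1) * l `^ p * \int[mu]_(z in h0) S z.
  move=> l0; apply: (Rintegral_le2 md) => // z dz.
  by apply: young_weight => //; [exact: f0|exact: v0].
have gi (h0 : set R[i]) (h0d : measurable h0) (h0s : h0 `<=` @disc R) (l : R) : 0 <= l ->
    q * p * l `^ (q - 1) * \int[mu]_(z in h0) (A z `^ (p - 1) * v z) <=
    p `^ q * \int[mu]_(z in h0) (A z `^ p * v z) + (q - 1) * l `^ q * \int[mu]_(z in h0) v z.
  move=> l0; apply: (Rintegral_le2 md) => // z dz; rewrite -gq.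
  by apply: young_weight_dual => //; [exact: powR_ge0|exact: V0].
have := @sparse_form_self R p q K p1 pq (I S) (I v) (I f)
  (I (fun z => A z `^ (p - 1) * v z)) (I (fun z => f z `^ p * v z))
  (I (fun z => A z `^ p * v z)) (I' S) (I' v) (I' f)
  (I' (fun z => A z `^ (p - 1) * v z)) (I' (fun z => f z `^ p * v z))
  (I' (fun z => A z `^ p * v z)) (fun j => M j)
  (IS _ iS) (IS _ iV) (IS _ iF) (IS _ iG) (IS _ ifv) (IS _ iN)
  (I0 _ S0) (I0 _ V0) (I0 _ f0) (I0 _ G0) M0 s'0 v'0
  (fun j k => fi _ (mb j k) (bd j k)) (fun j k => fi _ (mt j k) (td j k))
  (fun j k => gi _ (mb j k) (bd j k)) (fun j k => gi _ (mt j k) (td j k))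
  D' (ltW D'0) node n _ D'0 (erefl _).
have I00 h : I h 0 0 = \int[mu]_(z in disc) h z by rewrite /I box0.
rewrite !I00 => /(_ NE); rewrite -/A.
have -> // : 2 * D' * q * p = 2 * (D * P) * q * p * Q `^ e.
rewrite /D' powRM ?powR_ge0//; last by rewrite -(pmulr_lge0 _ (powR_gt0 p (ltac:(by rewrite mulr_gt0 ?pi_gt0) : 0 < 4 * pi :> R))) ltW.
by rewrite -/P; ring.
Qed.

End Averages.


(** * The maximal projection under the testing condition *)

Section MaximalProjection.
Context {R : realType}.
Variable om : {finite_measure set (measurableTypeR R) -> \bar R}.
Hypothesis hom : class_R om.
Variables (B : R[i] -> R[i] -> R[i]) (g : R).
Variable nu : {measure set (measurableTypeR R) -> \bar R}.
Local Notation mu := (polar_measure om).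
Local Notation W := (bmass om).
Hypothesis hB : is_bergman_kernel mu B.
Hypothesis g1 : 1 <= g.
Hypothesis nuD : (nu [set` `[0%R, 1%R]] < +oo)%E.
Hypothesis nuC : nu (~` [set` `[0%R, 1%R]]) = 0%E.
Hypothesis hK : forall z u, disc z -> disc u -> B z u = kernel nu g (z^* * u).
Local Notation Phi := (kernel_size nu g).
Variable m : nat.
Hypothesis m0 : (0 < m)%N.
Local Notation K := (split m).
Local Notation M j := (side m j * W (side m j)).
Implicit Types (z u : R[i]) (f v : R[i] -> R) (s : bool) (j k n : nat).

(** Two points share a box, of either grid, comparable in size to their
    distance, and there the kernel is of the order of the inverse mass. A box
    that contains [z] has side at least 1 - |z|, so that finitely many
    generations matter. *)
Lemma kernel_domination : exists2 C : R, 0 < C & forall n z u,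
  disc z -> disc u -> side m n < 1 - cabs z ->
  cabs (B z u) <= C * \sum_(s : bool) \sum_(j < n) \sum_(k < K ^ j)
    ((M j)^-1 * \1_(box m s j k) z * \1_(box m s j k) u).
Proof.
have [C1 C10 hC1] := kernel_size_le_mass hom hB g1 nuD nuC hK.
have K1 : 1 <= K%:R :> R.
  by rewrite ler1n; have := split_gt0 m 1; rewrite expn1.
pose a : R := 6 * K%:R; have a1 : 1 <= a by rewrite /a; lra.
have a0 : 0 < a by lra.
have ag : 0 < a `^ (g + 1) by rewrite powR_gt0.
exists (6 * a `^ (g + 1) * C1) => [|n z u dz du nz]; first by rewrite !mulr_gt0.
have [s [j [k [bz bu hj]]]] := common_box m0 dz du.
have jn : (j < n)%N.
  by apply: (@side_anti R m) => //; apply: (lt_le_trans nz); case: bz => h _ _; lra.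
have kj := box_lt bz.
have Mp j' : 0 < M j' by exact: box_scale_gt0.
have T0 s' j' k' : 0 <= (M j')^-1 * \1_(box m s' j' k') z * \1_(box m s' j' k') u.
  by rewrite !mulr_ge0// invr_ge0 ltW.
apply: (@le_trans _ _ (6 * a `^ (g + 1) * C1 * (M j)^-1)); last first.
  apply: ler_wpM2l; first by rewrite !mulr_ge0// ltW.
  rewrite (bigD1 s)//= (bigD1 (Ordinal jn))//= (bigD1 (Ordinal kj))//=.
  rewrite !indicE !mem_set// !mulr1 -!addrA lerDl !addr_ge0//.
  - by apply: sumr_ge0.
  - by apply: sumr_ge0 => i _; apply: sumr_ge0.
  - by apply: sumr_ge0 => s' _; apply: sumr_ge0 => i _; apply: sumr_ge0.
have x0 := cabs_1B_gt0 dz du; have s0 := @side_gt0 R m j.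
set x := cabs _ in x0 hj *.
pose y := side m j / a; have y0 : 0 < y by rewrite divr_gt0.
have yx : y <= x by rewrite ler_pdivrMr// mulrC.
apply: (le_trans (cabs_bergman_le nuD hK dz du)); rewrite -/x -!mulrA ler_pM2l ?ltr0n//.
apply: (le_trans (kernel_size_le nuD g1 y0 yx)).
have ys : y <= side m j by rewrite ler_pdivrMr// ler_peMr// ltW.
apply: (le_trans (kernel_size_ge nuD g y0 ys)).
have -> : side m j / y = a by rewrite /y; field; rewrite !gt_eqF.
rewrite ler_pM2l// ler_pdivlMr//; exact: hC1 s0 (@side_le1 R m j).
Qed.

Section FixedFunction.
Variable f : R[i] -> R.
Hypothesis f0 : forall z, disc z -> 0 <= f z.
Hypothesis fi : mu.-integrable disc (EFin \o f).

Let md := @measurable_disc R.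

Lemma bergman_bounded z : disc z -> exists C : R, forall u, disc u -> cabs (B z u) <= C.
Proof.
move=> dz; exists (6 * Phi (1 - cabs z)) => u du.
apply: (le_trans (cabs_bergman_le nuD hK dz du)); rewrite ler_pM2l ?ltr0n//.
apply: kernel_size_le => //; first by move/discE: dz; lra.
exact: cabs_1B_radius.
Qed.

Lemma bergman_integrable z : disc z ->
  mu.-integrable disc (EFin \o (fun u => f u * cabs (B z u))).
Proof.
move=> dz; have [C hC] := bergman_bounded dz.
have mB : measurable_fun disc (fun u => cabs (B z u)).
  by apply: measurable_cabs => //; exact: (measurable_bergman nuD nuC hK).
have h u : disc u -> `|cabs (B z u)| <= C.
  by move=> du; rewrite ger0_norm ?cabs_ge0//; exact: hC.
have := integrable_bounded md mB h fi.
by congr (_.-integrable _ _); apply/funext => u /=; rewrite mulrC.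
Qed.

Definition max_op f z : R := \int[mu]_(u in disc) (f u * cabs (B z u)).

Lemma max_op_ge0 z : disc z -> 0 <= max_op f z.
Proof.
by move=> dz; apply: Rintegral_ge0 => u du; rewrite mulr_ge0 ?cabs_ge0// f0.
Qed.

Lemma measurable_max_op : measurable_fun disc (max_op f).
Proof.
apply: measurable_param_integral => //; apply: measurable_funM.
  have mf : measurable_fun disc f by exact/measurable_EFinP/(measurable_int mu).
  apply: (measurable_comp md) mf _; first by move=> _ [[z u] [/= _ du] <-].
  exact: measurable_funTS (@measurable_snd _ _ _ _).
apply: measurable_cabs; first exact: measurableX.
apply: (measurable_bergman2 nuD nuC hK) => //.
- exact: measurableX.
- exact: measurable_funTS (@measurable_fst _ _ _ _).
- exact: measurable_funTS (@measurable_snd _ _ _ _).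
- by move=> [z u] [].
- by move=> [z u] [].
Qed.

End FixedFunction.

Lemma max_op_domination : exists2 C : R, 0 < C & forall f n z,
  (forall z, disc z -> 0 <= f z) -> mu.-integrable disc (EFin \o f) ->
  disc z -> side m n < 1 - cabs z ->
  max_op f z <= C * (avg om m n true f z + avg om m n false f z).
Proof.
have [C C0 hC] := kernel_domination; have md := @measurable_disc R.
exists C => // f n z f0 fi dz nz.
pose F s j k u := (M j)^-1 * \1_(box m s j k) z * (f u * \1_(box m s j k) u).
have iF s j k : mu.-integrable disc (EFin \o F s j k).
  apply: integrable_scale => //; apply: integrable_mul_indic => //.
  exact: measurable_box.
have iG s j := Rintegral_bigsum md (index_enum 'I_(K ^ j)) (fun k : 'I_(K ^ j) => iF s j k).
have iH s := Rintegral_bigsum md (index_enum 'I_n) (fun j : 'I_n => (iG s j).1).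
have iS := Rintegral_bigsum md (index_enum bool) (fun s => (iH s).1).
have E s : \int[mu]_(u in disc) (\sum_(j < n) \sum_(k < K ^ j) F s j k u) = avg om m n s f z.
  rewrite (iH s).2; apply: eq_bigr => j _; rewrite (iG s j).2; apply: eq_bigr => k _.
  rewrite RintegralZl//; last by apply: integrable_mul_indic => //; exact: measurable_box.
  rewrite Rintegral_mul_indic; last exact: box_sub_disc.
  by rewrite mulrC mulrA.
have -> : avg om m n true f z + avg om m n false f z =
    \int[mu]_(u in disc) (\sum_(s : bool) \sum_(j < n) \sum_(k < K ^ j) F s j k u).
  by rewrite iS.2 big_bool -!E.
rewrite -RintegralZl//; last exact: iS.1.
apply: le_Rintegral => //.
- exact: bergman_integrable.
- by apply: integrable_scale => //; exact: iS.1.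
move=> u du; apply: (le_trans (ler_wpM2l (f0 u du) (hC n z u dz du nz))).
rewrite mulrCA ler_pM2l// mulr_sumr; apply: ler_sum => s _.
rewrite mulr_sumr; apply: ler_sum => j _.
rewrite mulr_sumr; apply: ler_sum => k _.
by rewrite mulrCA.
Qed.

End MaximalProjection.


(** * From the testing condition to the strong bound *)

Section LpNorm.
Context {R : realType}.
Variable om : {finite_measure set (measurableTypeR R) -> \bar R}.
Local Notation mu := (polar_measure om).
Variable p : R.
Hypothesis p1 : 1 < p.
Implicit Types (f h : R[i] -> R[i]) (v : R[i] -> R).

Let p0 : 0 < p := lt_trans ltr01 p1.

Lemma lp_integrand_ge0 v f z : is_weight mu v -> disc z -> 0 <= cabs (f z) `^ p * v z.
Proof. by move=> wv dz; rewrite mulr_ge0 ?powR_ge0// ltW// wv.1. Qed.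

Lemma lp_integrand_measurable v f : is_weight mu v -> measurable_fun disc f ->
  measurable_fun disc (fun z => cabs (f z) `^ p * v z).
Proof.
move=> wv mf; apply: measurable_funM; last exact: weight_measurable wv.
by apply: measurable_powR_comp; exact: measurable_cabs.
Qed.

Lemma in_lpP v f : is_weight mu v -> in_lp mu p v f <->
  measurable_fun disc f /\ mu.-integrable disc (EFin \o (fun z => cabs (f z) `^ p * v z)).
Proof.
move=> wv.
have E : (\int[mu]_(z in disc) `|(EFin \o (fun z => cabs (f z) `^ p * v z)%R) z| =
    \int[mu]_(z in disc) (cabs (f z) `^ p * v z)%R%:E)%E.
  apply: eq_integral => z; rewrite inE => dz /=.
  by rewrite ger0_norm//; exact: lp_integrand_ge0.
split=> [[mf lf]|[mf /integrableP[_]]].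
  split => //; apply/integrableP; split.
    by apply/measurable_EFinP; exact: lp_integrand_measurable.
  by rewrite E; apply: lty_poweRy lf; rewrite gt_eqF// invr_gt0.
by rewrite E => lf; split => //; exact: poweR_lty.
Qed.

Lemma lpnorm_ge0 v f : (0 <= lpnorm mu p v f)%E.
Proof. exact: poweR_ge0. Qed.

Lemma lpnormE v f : is_weight mu v -> in_lp mu p v f ->
  lpnorm mu p v f = ((\int[mu]_(z in disc) (cabs (f z) `^ p * v z)) `^ p^-1)%:E.
Proof.
move=> wv /(in_lpP _ wv)[mf lf]; rewrite /lpnorm -poweR_EFin fineK//.
exact: integrable_fin_num.
Qed.

Lemma lpnorm_bound v f h (A : R) : is_weight mu v -> in_lp mu p v f ->
  measurable_fun disc h -> 0 <= A ->
  (\int[mu]_(z in disc) (cabs (h z) `^ p * v z)%:E <=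
    (A `^ p * \int[mu]_(z in disc) (cabs (f z) `^ p * v z))%:E)%E ->
  in_lp mu p v h /\ (lpnorm mu p v h <= A%:E * lpnorm mu p v f)%E.
Proof.
move=> wv lf mh A0 le.
have I0 : 0 <= \int[mu]_(z in disc) (cabs (f z) `^ p * v z).
  by apply: Rintegral_ge0 => z dz; exact: lp_integrand_ge0.
have H : (lpnorm mu p v h <= A%:E * lpnorm mu p v f)%E.
  rewrite (lpnormE wv lf) -EFinM /lpnorm.
  have -> : A * (\int[mu]_(z in disc) (cabs (f z) `^ p * v z)) `^ p^-1 =
     (A `^ p * \int[mu]_(z in disc) (cabs (f z) `^ p * v z)) `^ p^-1.
    by rewrite powRM ?powR_ge0// -powRrM mulfV ?gt_eqF// powRr1.
  rewrite -poweR_EFin; apply: gt0_ler_poweR le; rewrite ?invr_ge0 ?ltW//.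
    rewrite in_itv/= leey andbT; apply: integral_ge0 => z dz.
    by rewrite lee_fin; exact: lp_integrand_ge0.
  have := mulr_ge0 (powR_ge0 A p) I0; move: (A `^ p * _) => t t0.
  by rewrite in_itv/= leey andbT lee_fin.
split; last exact: H.
split; first exact: mh.
apply: (le_lt_trans H).
by rewrite (lpnormE wv lf) -EFinM ltry.
Qed.

Lemma lp_dominated v f h (A : R) : is_weight mu v -> in_lp mu p v f ->
  measurable_fun disc h -> 0 <= A ->
  (forall z, disc z -> cabs (h z) <= A * cabs (f z)) ->
  in_lp mu p v h /\ (lpnorm mu p v h <= A%:E * lpnorm mu p v f)%E.
Proof.
move=> wv lf mh A0 hf; have [mf fi] := (in_lpP f wv).1 lf.
apply: lpnorm_bound => //; rewrite -RintegralZl//.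
have ifA := integrable_scale (@measurable_disc R) (A `^ p) fi.
rewrite [leRHS]fineK; last exact: integrable_fin_num.
apply: ge0_le_integral => //.
- by move=> z dz; rewrite lee_fin mulr_ge0 ?powR_ge0// ltW// wv.1.
- by apply/measurable_EFinP; exact: lp_integrand_measurable wv mh.
- exact: measurable_int ifA.
move=> z dz; rewrite lee_fin mulrA ler_wpM2r ?(ltW (wv.1 z dz))//.
rewrite -powRM ?cabs_ge0//; apply: (ge0_ler_powR (ltW p0)); rewrite ?nnegrE ?cabs_ge0//.
  by rewrite mulr_ge0 ?cabs_ge0.
exact: hf.
Qed.

End LpNorm.

Section Operators.
Context {R : realType}.
Variable om : {finite_measure set (measurableTypeR R) -> \bar R}.
Hypothesis hom : class_R om.
Variables (B : R[i] -> R[i] -> R[i]) (g : R).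
Variable nu : {measure set (measurableTypeR R) -> \bar R}.
Local Notation mu := (polar_measure om).
Local Notation W := (bmass om).
Hypothesis hB : is_bergman_kernel mu B.
Hypothesis g1 : 1 <= g.
Hypothesis nuD : (nu [set` `[0%R, 1%R]] < +oo)%E.
Hypothesis nuC : nu (~` [set` `[0%R, 1%R]]) = 0%E.
Hypothesis hK : forall z u, disc z -> disc u -> B z u = kernel nu g (z^* * u).
Variable p : R.
Hypothesis p1 : 1 < p.
Local Notation q := (conj_exp p).
Implicit Types (z u : R[i]) (f : R[i] -> R[i]) (v : R[i] -> R) (L : R[i] -> R[i] -> R[i]).

Let p0 : 0 < p := lt_trans ltr01 p1.
Let md := @measurable_disc R.

(** The common features of the kernels of the two projections. *)
Definition bergman_like L := measurable_fun (disc `*` disc) (fun w => L w.1 w.2) /\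
  forall z u, cabs (L z u) = cabs (B z u).

Lemma measurable_bergman_pair :
  measurable_fun (disc `*` disc) (fun w : R[i] * R[i] => B w.1 w.2).
Proof.
apply: (measurable_bergman2 nuD nuC hK).
- exact: measurableX.
- exact: measurable_funTS (@measurable_fst _ _ _ _).
- exact: measurable_funTS (@measurable_snd _ _ _ _).
- by move=> [z u] [].
- by move=> [z u] [].
Qed.

Lemma bergman_like_max : bergman_like (max_proj_kernel B).
Proof.
split=> [|z u]; last exact: cabs_cabs.
apply: (@eq_measurable_fun _ _ _ _ _ (fun w => (cabs (B w.1 w.2))%:C)).
  by move=> w _; rewrite /max_proj_kernel norm_cabs.
apply: measurableT_comp; first exact: measurable_real.
by apply: measurable_cabs; [exact: measurableX|exact: measurable_bergman_pair].
Qed.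

Lemma bergman_like_proj : bergman_like (proj_kernel B).
Proof.
split=> [|z u]; last exact: cabs_conj.
by apply: measurable_conj; [exact: measurableX|exact: measurable_bergman_pair].
Qed.

Lemma bergman_like_section L z : bergman_like L -> disc z -> measurable_fun disc (L z).
Proof.
move=> [mL _] dz.
apply: (measurable_comp (F := disc `*` disc) (E := disc) (g := fun u => (z, u)) _ _ mL).
- exact: measurableX.
- by move=> _ [u du <-].
- exact: measurable_funTS (pair1_measurable _).
Qed.

Lemma measurable_integral_op L f : bergman_like L -> measurable_fun disc f ->
  measurable_fun disc (integral_op mu L f).
Proof.
move=> [mL _] mf.
have mF : measurable_fun (disc `*` disc) (fun w : R[i] * R[i] => f w.2 * L w.1 w.2).
  apply: measurable_funMc => //; first exact: measurableX.
  apply: (measurable_comp md) mf _; first by move=> _ [[z u] [/= _ du] <-].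
  exact: measurable_funTS (@measurable_snd _ _ _ _).
apply/measurable_fun_complexP => //; split; apply: measurable_param_integral => //.
  by apply: measurable_fun_Re => //; exact: measurableX.
by apply: measurable_fun_Im => //; exact: measurableX.
Qed.

Lemma cintegrable_op L f z : bergman_like L -> measurable_fun disc f ->
  mu.-integrable disc (EFin \o (fun z => cabs (f z))) -> disc z ->
  cintegrable mu disc (fun u => f u * L z u).
Proof.
move=> bL mf fi dz.
apply: (@le_cintegrable _ _ _ _ _ md _ (fun u => cabs (f u) * cabs (B z u))).
- by apply: measurable_funMc => //; exact: bergman_like_section.
- by move=> u _; rewrite cabsM bL.2.
- exact: (bergman_integrable g1 nuD nuC hK).
Qed.

Lemma cabs_integral_op_le L f z : bergman_like L -> measurable_fun disc f ->
  mu.-integrable disc (EFin \o (fun z => cabs (f z))) -> disc z ->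
  cabs (integral_op mu L f z) <= 2 * max_op om B (fun u => cabs (f u)) z.
Proof.
move=> bL mf fi dz; apply: (le_trans (cabs_cintegral_le md (cintegrable_op bL mf fi dz))).
rewrite ler_pM2l// le_eqVlt; apply/orP; left; apply/eqP; apply: eq_Rintegral => u _.
by rewrite cabsM bL.2.
Qed.

Section Grid.
Variable m : nat.
Hypothesis m0 : (0 < m)%N.
Local Notation M j := (side m j * W (side m j)).
Variable c : R.
Hypothesis c0 : 0 < c.
Hypothesis hc : forall s j k, (k < split m ^ j)%N ->
  ((c * M j)%:E <= mu (topbox m s j k))%E.

Lemma two_terms (a b I : R) : 0 <= a -> 0 <= b -> 0 <= I ->
  a `^ p * (b `^ p * I + b `^ p * I) <= (2 * (a * b)) `^ p * I.
Proof.
move=> a0 b0 I0; rewrite !powRM ?mulr_ge0//.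
have -> : a `^ p * (b `^ p * I + b `^ p * I) = 2 * (a `^ p * b `^ p * I) by ring.
rewrite -[leRHS]mulrA; apply: ler_wpM2r; first by rewrite !mulr_ge0 ?powR_ge0.
by apply: le1r_powR; rewrite ?ler1n// ltW.
Qed.

(** The bounds of the truncated averages are uniform in the truncation, and the
    sets where [n] generations suffice exhaust the disc. *)
Lemma max_op_bound : exists2 C : R, 0 < C & forall v (f : R[i] -> R),
  is_weight mu v -> bekolle_class mu p v ->
  measurable_fun disc f -> (forall z, disc z -> 0 <= f z) ->
  mu.-integrable disc (EFin \o (fun z => f z `^ p * v z)) ->
  (\int[mu]_(z in disc) (max_op om B f z `^ p * v z)%:E <=
  ((C * fine (bekolle mu p v) `^ Num.max 1 (p - 1)^-1) `^ p *
    \int[mu]_(z in disc) (f z `^ p * v z))%:E)%E.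
Proof.
have [C1 C10 hC1] := max_op_domination hom hB g1 nuD nuC hK m0.
have [C2 C20 hC2] := avg_bound hom p1 c0 hc.
exists (4 * C1 * C2) => [|v f wv bv mf f0 ifv]; first by rewrite !mulr_gt0.
have {hC2} hA n s := hC2 v f n s wv bv mf f0 ifv.
have X0 := powR_ge0 (fine (bekolle mu p v)) (Num.max 1 (p - 1)^-1).
move: (fine (bekolle mu p v) `^ Num.max 1 (p - 1)^-1) X0 hA => X X0 hA.
set I := \int[mu]_(z in disc) (f z `^ p * v z).
have I0 : 0 <= I.
  by apply: Rintegral_ge0 => z dz; rewrite mulr_ge0 ?powR_ge0// ltW// wv.1.
have fi := weighted_integrable hom p1 wv bv mf f0 ifv.
have T0 z : disc z -> 0 <= max_op om B f z by exact: max_op_ge0.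
have mT : measurable_fun disc (fun z => max_op om B f z `^ p * v z).
  apply: measurable_funM; last exact: weight_measurable wv.
  by apply: measurable_powR_comp; exact: measurable_max_op nuD nuC hK _ fi.
pose F n := disc `&` [set z : R[i] | side m n < 1 - cabs z].
have mF n : measurable (F n).
  rewrite (_ : F n = disc `&` (setT `&` cabs @^-1` `]-oo, 1 - side m n[)).
    by apply: measurableI => //; exact: measurable_cabs_id.
  apply/seteqP; split => z /=; rewrite in_itv/=.
    by move=> [? /= ?]; do 2?[split => //]; lra.
  by move=> [? [_ ?]]; split => //=; lra.
have Fd n : F n `<=` @disc R by move=> z [].
have nF : nondecreasing_seq F.
  apply/nondecreasing_seqP => n; apply/subsetPset => z [dz /= h]; split => //=.
  apply: le_lt_trans h; rewrite sideS ler_pdivrMr ?ltr0n; last first.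
    by have := split_gt0 m 1; rewrite expn1.
  rewrite ler_peMr ?(ltW (side_gt0 _ _))// ler1n.
  by have := split_gt0 m 1; rewrite expn1.
have bF : \bigcup_n F n = disc.
  apply/seteqP; split=> [z [n _ []]//|z dz].
  have z1 : 0 < 1 - cabs z by rewrite subr_gt0; exact/discE.
  by have [n hn] := side_small m0 z1; exists n.
have cv := @ge0_nondecreasing_set_cvg_integral _ _ R F
  (fun z => (max_op om B f z `^ p * v z)%:E) mu nF mF.
have {cv} := cv _ _; rewrite bF => cv.
have {cv} cvI : (\int[mu]_(z in F n) (max_op om B f z `^ p * v z)%:E @[n --> \oo] -->
    \int[mu]_(z in disc) (max_op om B f z `^ p * v z)%:E)%E.
  apply: cv => n; first by apply: measurable_funS (Fd n) _ => //; exact/measurable_EFinP.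
  by move=> z [dz _]; rewrite lee_fin mulr_ge0 ?powR_ge0// ltW// wv.1.
rewrite -(cvg_lim (@ereal_hausdorff R) cvI); apply: lime_le; first by apply/cvg_ex; eexists; exact: cvI.
apply: nearW => n.
pose A s := avg om m n s f.
have A0 s z : 0 <= A s z by exact: avg_ge0.
have iA s : mu.-integrable disc (EFin \o (fun z => A s z `^ p * v z)).
  by apply: integrable_powR_avg => //; [exact: ltW|exact: wv.2].
have pC : 0 <= (2 * C1) `^ p by exact: powR_ge0.
have iB : mu.-integrable disc (EFin \o (fun z => (2 * C1) `^ p * (A true z `^ p * v z + A false z `^ p * v z))).
  by apply: integrable_scale => //; exact: integrable_add.
have step z : F n z -> max_op om B f z `^ p * v z <=
    (2 * C1) `^ p * (A true z `^ p * v z + A false z `^ p * v z).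
  move=> [dz nz]; have h := hC1 f n z f0 fi dz nz; rewrite -/(A true z) -/(A false z) in h.
  have a0 := A0 true z; have b0 := A0 false z.
  rewrite -mulrDl mulrA ler_wpM2r ?(ltW (wv.1 z dz))//.
  have [ab|ab] := leP (A true z) (A false z).
    apply: (@le_trans _ _ ((2 * C1 * A false z) `^ p)).
      apply: (ge0_ler_powR (ltW p0)); rewrite ?nnegrE ?T0//.
        by rewrite !mulr_ge0// ltW.
      by apply: (le_trans h); nra.
    by rewrite powRM// ?mulr_ge0 ?(ltW C10)// ler_wpM2l// lerDr powR_ge0.
  apply: (@le_trans _ _ ((2 * C1 * A true z) `^ p)).
    apply: (ge0_ler_powR (ltW p0)); rewrite ?nnegrE ?T0//.
      by rewrite !mulr_ge0// ltW.
    by apply: (le_trans h); nra.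
  by rewrite powRM// ?mulr_ge0 ?(ltW C10)// ler_wpM2l// lerDl powR_ge0.
have G0 z : disc z -> 0 <= (2 * C1) `^ p * (A true z `^ p * v z + A false z `^ p * v z).
  by move=> dz; rewrite mulr_ge0// addr_ge0// mulr_ge0 ?powR_ge0// ltW// wv.1.
apply: (@le_trans _ _ (\int[mu]_(z in F n)
   ((2 * C1) `^ p * (A true z `^ p * v z + A false z `^ p * v z))%:E)%E).
  apply: ge0_le_integral => //.
  - by move=> z [dz _]; rewrite lee_fin mulr_ge0 ?powR_ge0// ltW// wv.1.
  - by apply: measurable_funS (Fd n) _ => //; exact/measurable_EFinP.
  - by apply: measurable_funS (Fd n) _ => //; exact: measurable_int iB.
apply: (@le_trans _ _ (\int[mu]_(z in disc)
   ((2 * C1) `^ p * (A true z `^ p * v z + A false z `^ p * v z))%:E)%E).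
  by apply: ge0_subset_integral => //; exact: measurable_int iB.
rewrite -[leLHS]fineK; last exact: integrable_fin_num.
rewrite lee_fin -/(Rintegral mu disc (fun z => _ * _)) RintegralZl//; last exact: integrable_add.
rewrite RintegralD//.
have := lerD (hA n true) (hA n false); rewrite -/(A true) -/(A false) -/X -/I => hh.
apply: (le_trans (ler_wpM2l pC hh)).
have -> : 4 * C1 * C2 * X = 2 * ((2 * C1) * (C2 * X)) by ring.
by apply: two_terms => //; rewrite mulr_ge0// ltW.
Qed.

Lemma max_strong_bound : exists2 C : R, 0 < C & forall v,
  is_weight mu v -> bekolle_class mu p v ->
  strong_bound mu (max_proj_kernel B) p v
    (C * fine (bekolle mu p v) `^ Num.max 1 (p - 1)^-1).
Proof.
have [C C0 hC] := max_op_bound; exists (2 * C) => [|v wv bv]; first by rewrite mulr_gt0.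
have X0 := powR_ge0 (fine (bekolle mu p v)) (Num.max 1 (p - 1)^-1).
have {}hC := hC v _ wv bv.
move: (fine (bekolle mu p v) `^ Num.max 1 (p - 1)^-1) X0 hC => X X0 hC.
split=> [|f lf]; first by rewrite !mulr_ge0// ltW.
have [mf ifv] := (in_lpP p1 f wv).1 lf.
have mcf : measurable_fun disc (fun z => cabs (f z)) by exact: measurable_cabs.
have cf0 z : disc z -> 0 <= cabs (f z) by rewrite cabs_ge0.
have fi := weighted_integrable hom p1 wv bv mcf cf0 ifv.
have bL := bergman_like_max.
have mG := measurable_integral_op bL mf.
have CX : 0 <= C * X by rewrite mulr_ge0// ltW.
pose T z : R[i] := (max_op om B (fun u => cabs (f u)) z)%:C.
have cT z : disc z -> cabs (T z) = max_op om B (fun u => cabs (f u)) z.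
  by move=> dz; rewrite cabs_real ger0_norm//; exact: max_op_ge0.
have mT : measurable_fun disc T.
  by apply: measurable_real => //; exact: measurable_max_op nuD nuC hK _ fi.
have [lT nT] : in_lp mu p v T /\ (lpnorm mu p v T <= (C * X)%:E * lpnorm mu p v f)%E.
  apply: lpnorm_bound => //; apply: le_trans (hC _ mcf cf0 ifv).
  rewrite le_eqVlt; apply/orP; left; apply/eqP; apply: eq_integral => z.
  by rewrite inE => dz; rewrite cT.
have [h1 h2] : in_lp mu p v (integral_op mu (max_proj_kernel B) f) /\
    (lpnorm mu p v (integral_op mu (max_proj_kernel B) f) <= 2%:E * lpnorm mu p v T)%E.
  apply: (lp_dominated p1 wv lT mG (ler0n _ 2)) => z dz; rewrite cT//.
  exact: cabs_integral_op_le.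
split; [by move=> z dz; exact: cintegrable_op|exact: h1|apply: (le_trans h2)].
by rewrite -mulrA EFinM -muleA; apply: lee_wpmul2l.
Qed.

End Grid.
End Operators.


(** * From the maximal projection to the weak-type bound *)

Section Forward.
Context {R : realType}.
Variable om : {finite_measure set (measurableTypeR R) -> \bar R}.
Local Notation mu := (polar_measure om).
Variables (B : R[i] -> R[i] -> R[i]) (g : R).
Variable nu : {measure set (measurableTypeR R) -> \bar R}.
Hypothesis nuD : (nu [set` `[0%R, 1%R]] < +oo)%E.
Hypothesis nuC : nu (~` [set` `[0%R, 1%R]]) = 0%E.
Hypothesis hK : forall z u, disc z -> disc u -> B z u = kernel nu g (z^* * u).
Variable p : R.
Hypothesis p1 : 1 < p.
Implicit Types (f h : R[i] -> R[i]) (v : R[i] -> R) (L : R[i] -> R[i] -> R[i]).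

Let p0 : 0 < p := lt_trans ltr01 p1.
Let md := @measurable_disc R.

(** Applied to the modulus of a function, the maximal projection dominates the
    projection pointwise, up to a factor 2. *)
Lemma max_bounded_proj_bounded v : is_weight mu v ->
  strong_bounded mu (max_proj_kernel B) p v -> strong_bounded mu (proj_kernel B) p v.
Proof.
move=> wv [M [M0 HM]]; exists (2 * M); split=> [|f lf]; first exact: mulr_ge0.
have mf := lf.1.
pose h z : R[i] := (cabs (f z))%:C.
have ch z : cabs (h z) = cabs (f z) by exact: cabs_cabs.
have mh : measurable_fun disc h.
  by apply: measurableT_comp; [exact: measurable_real|exact: measurable_cabs].
have [lh nh] : in_lp mu p v h /\ (lpnorm mu p v h <= 1%:E * lpnorm mu p v f)%E.
  by apply: lp_dominated => // z _; rewrite ch mul1r.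
have [od lT nT] := HM h lh.
have bP := bergman_like_proj nuD nuC hK.
have cd z : disc z -> cintegrable mu disc (fun u => f u * proj_kernel B z u).
  move=> dz; have ic := cintegrable_cabs md (od z dz).
  apply: (le_cintegrable md _ _ ic).
    by apply: measurable_funMc => //; exact: (bergman_like_section bP dz).
  by move=> u _; rewrite !cabsM ch bP.2 cabs_cabs.
have TE z : cabs (integral_op mu (max_proj_kernel B) h z) =
    \int[mu]_(u in disc) (cabs (f u) * cabs (B z u)).
  rewrite /integral_op (@eq_cintegral _ _ _ mu disc _ (fun u => (cabs (f u) * cabs (B z u))%:C)).
    rewrite (cintegral_real mu md) cabs_real ger0_norm//.
    by apply: Rintegral_ge0 => u _; rewrite mulr_ge0 ?cabs_ge0.
  by move=> u _; rewrite /h /max_proj_kernel norm_cabs (rmorphM (real_complex R)).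
have mP : measurable_fun disc (integral_op mu (proj_kernel B) f).
  exact: measurable_integral_op bP mf.
have [lP nP] : in_lp mu p v (integral_op mu (proj_kernel B) f) /\
  (lpnorm mu p v (integral_op mu (proj_kernel B) f) <=
    2%:E * lpnorm mu p v (integral_op mu (max_proj_kernel B) h))%E.
  apply: lp_dominated => // z dz; rewrite TE.
  apply: (le_trans (cabs_cintegral_le md (cd z dz))).
  rewrite ler_pM2l// le_eqVlt; apply/orP; left; apply/eqP; apply: eq_Rintegral => u _.
  by rewrite cabsM bP.2.
split; [exact: cd|exact: lP|apply: (le_trans nP)].
rewrite EFinM -muleA; apply: lee_wpmul2l; first by rewrite lee_fin.
apply: (le_trans nT); apply: lee_wpmul2l; first by rewrite lee_fin.
by rewrite mul1e in nh.
Qed.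

(** Chebyshev's inequality. *)
Lemma strong_bounded_weak_bounded v L : is_weight mu v ->
  strong_bounded mu L p v -> weak_bounded mu L p v.
Proof.
move=> wv [M [M0 HM]]; exists (M `^ p); split=> [|f lf]; first exact: powR_ge0.
have [od lG nG] := HM f lf; have [mG iG] := (in_lpP p1 _ wv).1 lG.
split; [exact: od|exact: mG|move=> l l0].
set G := integral_op mu L f in lG nG mG iG *.
pose E := disc `&` [set z : R[i] | l < cabs (G z)].
have mE : measurable E.
  rewrite (_ : E = disc `&` (fun z => cabs (G z)) @^-1` `]l, +oo[).
    by apply: measurable_cabs => //; exact: measurable_itv.
  by apply/seteqP; split => z /=; rewrite in_itv/= andbT.
have Ed : E `<=` @disc R by move=> z [].
have mv : measurable_fun E (fun z => (v z)%:E).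
  by apply: measurable_funS (measurable_int _ wv.2).
have v0 z : disc z -> (0 <= (v z)%:E)%E by move=> dz; rewrite lee_fin ltW// wv.1.
have l0' : (0 <= (l `^ p)%:E)%E by rewrite lee_fin powR_ge0.
rewrite -/E -(ge0_integralZl mu mE mv (fun z Ez => v0 z (Ed z Ez)) l0').
apply: (@le_trans _ _ (\int[mu]_(z in E) (cabs (G z) `^ p * v z)%:E)%E).
  apply: ge0_le_integral => //.
  - by move=> z Ez; rewrite mule_ge0// v0//; exact: Ed.
  - exact: measurable_funeM.
  - by apply: measurable_funS (measurable_int _ iG).
  move=> z [dz /= lz]; rewrite -EFinM lee_fin ler_wpM2r ?(ltW (wv.1 z dz))//.
  by apply: (ge0_ler_powR (ltW p0)); rewrite ?nnegrE ?cabs_ge0 ?ltW.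
apply: (@le_trans _ _ (\int[mu]_(z in disc) (cabs (G z) `^ p * v z)%:E)%E).
  apply: ge0_subset_integral => //; first exact: measurable_int iG.
  by move=> z dz; rewrite lee_fin mulr_ge0 ?powR_ge0// ltW// wv.1.
have GE := lpnormE p1 wv lG; have fE := lpnormE p1 wv lf.
rewrite [leLHS](_ : _ = (lpnorm mu p v G `^ p)%E); last first.
  rewrite /lpnorm -poweRrM mulVf ?gt_eqF// poweRe1//.
  by apply: integral_ge0 => z dz; rewrite lee_fin mulr_ge0 ?powR_ge0// ltW// wv.1.
rewrite -poweR_EFin -poweRM ?lee_fin ?lpnorm_ge0//.
apply: gt0_ler_poweR nG; rewrite ?(ltW p0)//.
  by rewrite in_itv/= leey andbT lpnorm_ge0.
by rewrite in_itv/= leey andbT mule_ge0 ?lpnorm_ge0.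
Qed.

End Forward.


(** * Testing the weak-type bound *)

Lemma Re_conj_ge (R : realType) (b x : R[i]) : cabs (x - b) <= 2^-1 * cabs b ->
  cabs b ^+ 2 / 2 <= complex.Re (b * x^*).
Proof.
move=> h; have := cabs_dist b (b - x); rewrite subKr [cabs (b - x)]cabsBC => hx.
have b0 := cabs_ge0 b; have d0 := cabs_ge0 (x - b); have x0 := cabs_ge0 x.
have -> : complex.Re (b * x^*) =
    (cabs b ^+ 2 + cabs x ^+ 2 - cabs (x - b) ^+ 2) / 2.
  by rewrite !sqr_cabs; case: b {h hx b0 d0} => b1 b2; case: x {x0} => x1 x2 /=; field.
nra.
Qed.

Section WeakTesting.
Context {R : realType}.
Variable om : {finite_measure set (measurableTypeR R) -> \bar R}.
Local Notation mu := (polar_measure om).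
Variables (B : R[i] -> R[i] -> R[i]) (g : R).
Variable nu : {measure set (measurableTypeR R) -> \bar R}.
Hypothesis hK : forall z u, disc z -> disc u -> B z u = kernel nu g (z^* * u).
Variable p : R.
Hypothesis p1 : 1 < p.
Local Notation q := (conj_exp p).
Variable v : R[i] -> R.
Hypothesis wv : is_weight mu v.
Variable C : R.
Hypothesis C0 : 0 <= C.
Hypothesis weak : forall f, in_lp mu p v f ->
  [/\ op_defined mu (proj_kernel B) f,
      measurable_fun disc (integral_op mu (proj_kernel B) f) &
      forall l : R, 0 < l ->
        ((l `^ p)%:E *
          \int[mu]_(z in disc `&` [set z | (l < cabs (integral_op mu (proj_kernel B) f z))%R])
            (v z)%:E
         <= C%:E * lpnorm mu p v f `^ p)%E].
Variable e : R.
Hypothesis osc : forall w w0 : R[i], cabs w < 1 -> cabs w0 < 1 ->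
  cabs (w - w0) <= e * cabs (1 - w0) ->
  cabs (kernel nu g w - kernel nu g w0) <= 2^-1 * cabs (kernel nu g w0).
Implicit Types (Z E : set R[i]) (w : R[i]).

Let p0 : 0 < p := lt_trans ltr01 p1.
Let md := @measurable_disc R.

(** For [z] in [Z] and [u] in [E] the kernel stays close to its value at the
    single point [w]. *)
Definition near_point Z E w := cabs w < 1 /\
  forall z u, Z z -> E u -> cabs (z^* * u - w) <= e * cabs (1 - w).

(** The values of the kernel have almost the same argument, so that there is
    no cancellation in the integral. *)
Lemma proj_lower Z E w (h : R[i] -> R) z :
  Z `<=` disc -> near_point Z E w ->
  (forall u, disc u -> 0 <= h u) -> (forall u, disc u -> ~ E u -> h u = 0) ->
  mu.-integrable disc (EFin \o h) ->
  cintegrable mu disc (fun u => (h u)%:C * proj_kernel B z u) -> Z z ->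
  cabs (kernel nu g w) ^+ 2 / 2 * \int[mu]_(u in disc) h u <=
  cabs (kernel nu g w) * cabs (integral_op mu (proj_kernel B) (fun u => (h u)%:C) z).
Proof.
move=> Zd [w1 close] h0 hE ih ic Zz; have dz := Zd z Zz.
set b := kernel nu g w; rewrite -cabsM /integral_op -(cintegralZl md b ic).
have ib := cintegrableZl md b ic.
apply: le_trans (le_trans (ler_norm _) (Re_le_cabs _)).
rewrite /cintegral /= -RintegralZl//; apply: le_Rintegral => //.
- exact: integrable_scale.
- exact: ib.1.
move=> u du; have [Eu|Eu] := pselect (E u); last first.
  by rewrite hE// mulr0 (rmorph0 (real_complex R)) mul0r mulr0.
have zu := disc_conjM dz du.
have := osc zu w1 (close z u Zz Eu); rewrite -hK// -/b => hd.
have Re_b := Re_conj_ge hd.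
rewrite [X in _ <= X](_ : _ = h u * complex.Re (b * (B z u)^*)); last first.
  by rewrite mulrCA /proj_kernel; move: (b * _) => [x y] /=; rewrite mul0r subr0.
by rewrite mulrC; apply: ler_wpM2l => //; exact: h0.
Qed.

Lemma weak_test Z E w (h : R[i] -> R) :
  measurable Z -> Z `<=` disc -> near_point Z E w ->
  (forall u, disc u -> 0 <= h u) -> (forall u, disc u -> ~ E u -> h u = 0) ->
  mu.-integrable disc (EFin \o h) ->
  mu.-integrable disc (EFin \o (fun u => h u `^ p * v u)) ->
  (cabs (kernel nu g w) / 4 * \int[mu]_(u in disc) h u) `^ p *
    \int[mu]_(z in Z) v z <= C * \int[mu]_(u in disc) (h u `^ p * v u).
Proof.
move=> mZ Zd near h0 hE ih ihv.
set k := cabs _; set I := \int[mu]_(u in disc) h u.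
have k0 : 0 <= k by exact: cabs_ge0.
have I0 : 0 <= I by exact: Rintegral_ge0.
have J0 : 0 <= \int[mu]_(u in disc) (h u `^ p * v u).
  by apply: Rintegral_ge0 => u du; rewrite mulr_ge0 ?powR_ge0// ltW// wv.1.
have iV : mu.-integrable Z (EFin \o v) by apply: integrableS wv.2.
have [l0|l0] := ltP 0 (k / 4 * I); last first.
  have -> : k / 4 * I = 0.
    by apply/eqP; rewrite eq_le l0 mulr_ge0// divr_ge0.
  by rewrite powR0 ?mul0r ?mulr_ge0// gt_eqF.
pose f u : R[i] := (h u)%:C.
have fh u : disc u -> cabs (f u) = h u by move=> du; rewrite cabs_real ger0_norm// h0.
have lf : in_lp mu p v f.
  apply/(in_lpP p1 f wv); split.
    apply: measurableT_comp; first exact: measurable_real.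
    exact/measurable_EFinP/(measurable_int mu).
  by apply: eq_integrable ihv => // u; rewrite inE => du /=; rewrite fh.
have [od mP hP] := weak lf; have := hP _ l0.
have -> : (lpnorm mu p v f `^ p = (\int[mu]_(u in disc) (h u `^ p * v u))%:E)%E.
  rewrite (lpnormE p1 wv lf) poweR_EFin -powRrM mulVf ?gt_eqF// powRr1.
    rewrite (@eq_Rintegral _ _ _ mu disc (fun u => h u `^ p * v u))// => u.
    by rewrite inE => du; rewrite (fh u du).
  by apply: Rintegral_ge0 => u du; rewrite mulr_ge0 ?powR_ge0// ltW// wv.1.
rewrite -EFinM -lee_fin => /(le_trans _); apply.
rewrite EFinM; apply: lee_wpmul2l; first by rewrite lee_fin powR_ge0.
rewrite fineK; last exact: integrable_fin_num.
set S := disc `&` _.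
have mS : measurable S.
  rewrite (_ : S = disc `&` (fun z => cabs (integral_op mu (proj_kernel B) f z)) @^-1` `]k / 4 * I, +oo[).
    by apply: measurable_cabs => //; exact: measurable_itv.
  by apply/seteqP; split => z /=; rewrite in_itv/= andbT.
apply: ge0_subset_integral => //.
- by apply: measurable_funS (measurable_int _ wv.2) => // z [].
- by move=> z [dz _]; rewrite lee_fin ltW// wv.1.
move=> z Zz; split; first exact: Zd.
have dz := Zd z Zz.
have lo := proj_lower Zd near h0 hE ih (od z dz) Zz; rewrite -/k -/I -/(f _) in lo.
have kp : 0 < k.
  by rewrite lt_def k0 andbT; apply: contraTneq l0 => ->; rewrite !mul0r ltxx.
have : k / 2 * I <= cabs (integral_op mu (proj_kernel B) f z).
  rewrite -(ler_pM2l kp); apply: le_trans lo.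
  by rewrite le_eqVlt; apply/orP; left; apply/eqP; field.
apply: lt_le_trans; have := l0; move: (k) (I) => a b; nra.
Qed.

Lemma weak_test_mass Z E w : measurable Z -> Z `<=` disc ->
  measurable E -> E `<=` disc -> near_point Z E w ->
  (cabs (kernel nu g w) / 4 * fine (mu E)) `^ p * \int[mu]_(z in Z) v z <=
  C * \int[mu]_(z in E) v z.
Proof.
move=> mZ Zd mE Ed near.
have i1 : mu.-integrable disc (EFin \o (\1_E : R[i] -> R)).
  have := integrable_mul_indic md mE (finite_measure_integrable_cst mu 1 md : mu.-integrable disc (EFin \o cst 1)).
  by congr (_.-integrable _ _); apply/funext => u /=; rewrite mul1r.
have pE u : (\1_E u : R) `^ p * v u = v u * \1_E u.
  rewrite indicE mulrC; case: (u \in E); rewrite ?powR1// powR0// gt_eqF//.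
have iv : mu.-integrable disc (EFin \o (fun u => (\1_E u : R) `^ p * v u)).
  have := integrable_mul_indic md mE wv.2.
  by congr (_.-integrable _ _); apply/funext => u /=; rewrite pE.
have := weak_test mZ Zd near _ _ i1 iv.
rewrite (@eq_Rintegral _ _ _ mu disc (fun u => v u * \1_E u) (fun u => \1_E u `^ p * v u)); last first.
  by move=> u _; rewrite pE.
rewrite Rintegral_mul_indic//.
rewrite (@eq_Rintegral _ _ _ mu disc (fun u => 1 * \1_E u) (fun u => \1_E u)); last first.
  by move=> u _; rewrite mul1r.
rewrite (Rintegral_mul_indic mu (cst 1)) // Rintegral_cst// mul1r; apply => // u du Eu.
by rewrite indicE memNset.
Qed.

(** The truncations of the dual weight [s] serve as test functions: they satisfy
    s^p v = s, and the resulting bounds do not depend on the level of truncation,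
    which also yields the integrability of [s]. *)
Lemma weak_test_dual Z E w : measurable Z -> Z `<=` disc ->
  measurable E -> E `<=` disc -> near_point Z E w ->
  0 < cabs (kernel nu g w) -> 0 < \int[mu]_(z in Z) v z ->
  mu.-integrable E (EFin \o (fun z => dual_weight p q (v z))) /\
  (cabs (kernel nu g w) / 4) `^ p * \int[mu]_(z in Z) v z *
    (\int[mu]_(z in E) dual_weight p q (v z)) `^ (p - 1) <= C.
Proof.
move=> mZ Zd mE Ed near; set k := cabs _ / 4 => k4 V0.
have k0 : 0 < k by rewrite divr_gt0.
set V := \int[mu]_(z in Z) v z in V0 *.
pose s z := dual_weight p q (v z).
have sp z : disc z -> 0 < s z by move=> dz; rewrite dual_weight_gt0// wv.1.
have ms : measurable_fun disc s.
  exact: measurable_powR_comp (weight_measurable wv).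
have pq := conj_expE p; have q1 := conj_gt1 p1 pq.
have q0 : 0 < q := lt_trans ltr01 q1.
have qp : q^-1 + p^-1 = 1 by rewrite addrC.
have sv z : disc z -> s z `^ p * v z = s z.
  move=> dz; have vz := wv.1 z dz; rewrite /s /dual_weight -powRrM.
  rewrite -[X in _ * X](powRr1 (ltW vz)) -powRD; last by rewrite (gt_eqF vz) implybT.
  congr (_ `^ _); rewrite mulNr divfK ?gt_eqF//.
  by rewrite -[in RHS](conj_div q1 qp) mulfK ?gt_eqF// opprB addrC.
pose F n := E `&` [set z | s z <= n%:R].
have mF n : measurable (F n).
  rewrite (_ : F n = E `&` (disc `&` s @^-1` `]-oo, n%:R])).
    by apply: measurableI => //; apply: ms => //; exact: measurable_itv.
  by apply/seteqP; split => z /=; rewrite in_itv/=; [move=> [Ez ?]; split=> //; split => //; exact: Ed|move=> [? [? ?]]].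
have FE n : F n `<=` E by move=> z [].
have Fd n : F n `<=` disc by move=> z /FE /Ed.
have isF n : mu.-integrable (F n) (EFin \o s).
  have := @integrable_bounded R _ _ mu (F n) (mF n) (cst 1) s n%:R _ _ (finite_measure_integrable_cst mu 1 (mF n)).
  move=> H; have {H} := H (measurable_funS md (Fd n) ms) _.
  under eq_fun do rewrite /= mulr1.
  by apply => z [Ez /= sz]; rewrite ger0_norm// ltW// sp//; exact: Ed.
pose h n z := (s \_ (F n)) z.
have hin n z : F n z -> h n z = s z by move=> Fz; rewrite /h patchE mem_set.
have hout n z : ~ F n z -> h n z = 0 by move=> Fz; rewrite /h patchE memNset.
have ih n : mu.-integrable disc (EFin \o h n).
  have := (integrable_restrict mu (mF n) md (EFin \o s)).1.
  rewrite setIidr//= => /(_ (isF n)); congr (_.-integrable _ _).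
  by rewrite restrict_EFin.
have hp n z : disc z -> h n z `^ p * v z = h n z.
  move=> dz; have [Fz|Fz] := pselect (F n z); first by rewrite hin// sv.
  by rewrite hout// powR0 ?mul0r// gt_eqF.
have hI n : \int[mu]_(z in disc) h n z = \int[mu]_(z in F n) s z.
  by rewrite -[in RHS](setIidr (Fd n)) Rintegral_mkcondr.
pose T := (C / (k `^ p * V)) `^ (p - 1)^-1.
have kV : 0 < k `^ p * V by rewrite mulr_gt0 ?powR_gt0.
have p10 : 0 < p - 1 by rewrite subr_gt0.
have bound n : \int[mu]_(z in F n) s z <= T.
  have := weak_test mZ Zd near _ _ (ih n) _.
  rewrite (@eq_Rintegral _ _ _ mu disc (h n) (fun z => h n z `^ p * v z)); last first.
    by move=> z; rewrite inE => dz; rewrite hp.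
  rewrite hI -/k -/V.
  have I0 : 0 <= \int[mu]_(z in F n) s z.
    by apply: Rintegral_ge0 => z /Fd /sp /ltW.
  move: (\int[mu]_(z in F n) s z) I0 => a a0 H.
  have {H} : (k * a) `^ p * V <= C * a.
    apply: H.
    - move=> u du; have [Fu|Fu] := pselect (F n u); first by rewrite hin// ltW// sp.
      by rewrite hout.
    - by move=> u du Eu; rewrite hout// => /FE.
    - by apply: eq_integrable (ih n) => // z; rewrite inE => dz /=; rewrite hp.
  move: a0; rewrite le_eqVlt => /orP[/eqP <- _|a0]; first exact: powR_ge0.
  rewrite (powRM _ (ltW k0) (ltW a0)) -(powR_split p1 (ltW a0)) => H.
  have {}H : a `^ (p - 1) <= C / (k `^ p * V).
    rewrite ler_pdivlMr// -(ler_pM2r a0); apply: le_trans H.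
    by rewrite le_eqVlt; apply/orP; left; apply/eqP; ring.
  rewrite -[leLHS](powRr1 (ltW a0)) -(mulfV (lt0r_neq0 p10)) powRrM.
  by apply: ge0_ler_powR H; rewrite ?nnegrE ?powR_ge0 ?invr_ge0 ?(ltW p10)// divr_ge0// ltW.
have nF : nondecreasing_seq F.
  apply/nondecreasing_seqP => n; apply/subsetPset => z [Ez /= h1]; split => //=.
  by apply: (le_trans h1); rewrite ler_nat.
have bF : \bigcup_n F n = E.
  apply/seteqP; split=> [z [n _ []]//|z Ez].
  exists (Num.truncn (s z)).+1 => //; split => //=.
  by apply/ltW/truncnS_gt.
have cv := @ge0_nondecreasing_set_cvg_integral _ _ R F (EFin \o s) mu nF mF _ _.
rewrite bF in cv.
have le : (\int[mu]_(z in E) (s z)%:E <= T%:E)%E.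
  have {}cv := cv (fun n => measurable_int _ (isF n)) (fun n z Fz => ltW (sp z (Fd n z Fz)) : (0 <= (s z)%:E)%E).
  rewrite -(cvg_lim (@ereal_hausdorff R) cv); apply: lime_le; first by apply/cvg_ex; eexists; exact: cv.
  apply: nearW => n; rewrite -[leLHS]fineK; last exact: integrable_fin_num.
  by rewrite lee_fin; exact: bound.
have iE : mu.-integrable E (EFin \o s).
  apply/integrableP; split; first by apply/measurable_EFinP; exact: measurable_funS ms.
  rewrite (eq_integral (fun z => (s z)%:E)); first exact: le_lt_trans le (ltry _).
  by move=> z; rewrite inE => Ez /=; rewrite ger0_norm// ltW// sp//; exact: Ed.
split => //.
rewrite -[X in _ <= X](mulfVK (lt0r_neq0 kV)) [X in _ <= X]mulrC.
apply: ler_wpM2l; first exact: ltW.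
have TE : T `^ (p - 1) = C / (k `^ p * V).
  rewrite /T -powRrM mulVf ?gt_eqF// powRr1// divr_ge0// ltW//.
rewrite -TE; apply: ge0_ler_powR; rewrite ?nnegrE ?powR_ge0 ?(ltW p10)//.
  by apply: Rintegral_ge0 => z /Ed /sp /ltW.
by rewrite -lee_fin fineK//; exact: integrable_fin_num.
Qed.

End WeakTesting.


(** * From the weak-type bound to the testing condition *)

Lemma integrable_cover (R : realType) d (T : measurableType d)
    (mu : {measure set T -> \bar R}) (D : set T) (I : finType) (F : I -> set T)
    (s : T -> R) : measurable D -> (forall i, measurable (F i)) ->
  (forall i, F i `<=` D) -> (forall x, D x -> exists i, F i x) ->
  measurable_fun D s -> (forall i, mu.-integrable (F i) (EFin \o s)) ->
  mu.-integrable D (EFin \o s).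
Proof.
move=> mD mF FD cover ms iF.
pose S i := (fun x => `|s x|) \_ (F i).
have iS i : mu.-integrable D (EFin \o S i).
  have := (integrable_restrict mu (mF i) mD (EFin \o (fun x => `|s x|))).1.
  rewrite setIidr// => /(_ (integrable_abse (iF i))).
  by congr (_.-integrable _ _); rewrite restrict_EFin.
have S0 i x : 0 <= S i x by rewrite /S patchE; case: ifP.
have [iT _] := Rintegral_bigsum mD (index_enum I) iS.
apply: le_integrable iT => //; first exact/measurable_EFinP.
move=> x Dx; have [i Fx] := cover x Dx; rewrite lee_fin; apply: le_trans (ler_norm _).
by rewrite (bigD1 i)//= {1}/S patchE mem_set// lerDl; apply: sumr_ge0.
Qed.

(** The weight of the second square cancels between the two tests. *)
Lemma two_squares (R : realType) (p C c c2 x t V V' m m' k1 k2 : R) :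
  1 < p -> 0 < x -> 0 < c -> 0 < c2 -> 0 <= C -> 0 <= t -> 0 < V -> 0 < V' ->
  c2 * x <= m -> c2 * x <= m' -> c <= k1 * x -> c <= k2 * x ->
  (k2 / 4) `^ p * V' * t `^ (p - 1) <= C ->
  (k1 / 4 * m') `^ p * V <= C * V' ->
  V * t `^ (p - 1) / m `^ p <= C ^+ 2 / ((c * c2 / 4) `^ p) ^+ 2.
Proof.
move=> p1 x0 c0 c20 C0 t0 V0 V'0 hm hm' hk1 hk2 tb ta.
have p0 : 0 <= p by lra.
have cx : 0 < c2 * x by rewrite mulr_gt0.
have m0 : 0 < m := lt_le_trans cx hm.
have k20 : 0 < k2 by rewrite -(pmulr_lgt0 _ x0); exact: lt_le_trans hk2.
have k10 : 0 < k1 by rewrite -(pmulr_lgt0 _ x0); exact: lt_le_trans hk1.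
have A0 : 0 < (c * c2 / 4) `^ p by rewrite powR_gt0// divr_gt0// mulr_gt0.
set A := _ `^ p in A0 *.
have h1 : A <= (k1 / 4 * m') `^ p.
  apply: ge0_ler_powR; rewrite ?nnegrE //.
  - by rewrite divr_ge0// mulr_ge0// ltW.
  - by rewrite mulr_ge0 ?divr_ge0 ?(ltW k10)// (le_trans (ltW cx)).
  have : c * c2 <= k1 * m'.
    apply: (@le_trans _ _ (k1 * x * c2)); first by rewrite ler_wpM2r// ltW.
    by rewrite -mulrA ler_wpM2l ?(ltW k10)// mulrC.
  lra.
have h2 : A <= (k2 / 4) `^ p * m `^ p.
  rewrite -powRM ?divr_ge0 ?(ltW k20) ?(ltW m0)//.
  apply: ge0_ler_powR; rewrite ?nnegrE //.
  - by rewrite divr_ge0// mulr_ge0// ltW.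
  - by rewrite mulr_ge0 ?divr_ge0 ?(ltW k20)// ltW.
  have : c * c2 <= k2 * m.
    apply: (@le_trans _ _ (k2 * x * c2)); first by rewrite ler_wpM2r// ltW.
    by rewrite -mulrA ler_wpM2l ?(ltW k20)// mulrC.
  lra.
have T0 : 0 <= t `^ (p - 1) := powR_ge0 _ _.
have K0 : 0 <= (k2 / 4) `^ p := powR_ge0 _ _.
have Mp : 0 < m `^ p by rewrite powR_gt0.
move: (t `^ (p - 1)) ((k2 / 4) `^ p) (m `^ p) ((k1 / 4 * m') `^ p) T0 K0 Mp h1 h2 tb ta.
clearbody A; move=> T K P H T0 K0 P0 h1 h2 tb ta.
have a1 : A * V <= C * V' by apply: le_trans ta; rewrite ler_wpM2r// ltW.
have a2 : A * (V' * T) <= C * P.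
  apply: (@le_trans _ _ (K * P * (V' * T))).
    by rewrite ler_wpM2r// mulr_ge0// ltW.
  have -> : K * P * (V' * T) = K * V' * T * P by ring.
  by rewrite ler_wpM2r// ltW.
rewrite ler_pdivlMr ?exprn_gt0// mulrAC ler_pdivrMr//.
have -> : V * T * A ^+ 2 = A * V * (A * T) by ring.
apply: (@le_trans _ _ (C * V' * (A * T))).
  by rewrite ler_wpM2r// mulr_ge0// ltW.
have -> : C * V' * (A * T) = C * (A * (V' * T)) by ring.
by rewrite expr2 -mulrA ler_wpM2l.
Qed.

Lemma cell_width (R : realType) (N x y e : R) (k : nat) : 0 < N -> N^-1 <= e ->
  k%:R <= N * (x + 1) -> N * (x + 1) <= k.+1%:R ->
  k%:R <= N * (y + 1) -> N * (y + 1) <= k.+1%:R -> `|x - y| <= e.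
Proof.
move=> N0 Ne; rewrite -natr1 => h1 h2 h3 h4; apply: le_trans Ne.
rewrite -[leRHS]mul1r ler_pdivlMr// -[X in _ * X](ger0_norm (ltW N0)) -normrM.
by rewrite ler_norml; apply/andP; split; lra.
Qed.

Section Centers.
Context {R : realType}.
Implicit Types (a l : R) (z u : R[i]).

Definition corner a l : R[i] := (1 - l)%:C * expi a.

Lemma cabs_corner a l : l <= 1 -> cabs (corner a l) = 1 - l.
Proof. by move=> l1; rewrite cabsM cabs_expi mulr1 cabs_real ger0_norm// subr_ge0. Qed.

Lemma carleson_corner a l z : 0 < l -> l <= 1 -> carleson a l z ->
  cabs (z - corner a l) <= 17 * l.
Proof.
move=> l0 l1 [r /=]; rewrite in_itv/= => /andP[r1 r2] [_ [t /= + <-] <-].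
rewrite in_itv/= => /andP[t1 t2].
have p4 : pi < 4 :> R by have := @pihalf_lt2 R; lra.
have -> : r%:C * expi t - corner a l =
    (r - (1 - l))%:C * expi t + (1 - l)%:C * (expi t - expi a).
  by rewrite /corner [(r - (1 - l))%:C](rmorphB (real_complex R)); ring.
apply: (le_trans (cabsD _ _)); rewrite !cabsM cabs_expi mulr1 !cabs_real.
rewrite ger0_norm ?subr_ge0// ger0_norm ?subr_ge0//.
have h := expi_dist t a; rewrite ger0_norm ?subr_ge0// in h.
have h1 : 2 * pi * l <= 8 * l by rewrite ler_wpM2r ?(ltW l0)//; lra.
have h2 : cabs (expi t - expi a) <= 16 * l by apply: (le_trans h); lra.
have h3 : (1 - l) * cabs (expi t - expi a) <= 16 * l.
  by apply: le_trans h2; rewrite ler_piMl ?cabs_ge0//; lra.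
lra.
Qed.

Lemma cabs_conjM_dist z u z0 u0 : cabs u <= 1 -> cabs z0 <= 1 ->
  cabs (z^* * u - z0^* * u0) <= cabs (z - z0) + cabs (u - u0).
Proof.
move=> u1 z1; have -> : z^* * u - z0^* * u0 = (z - z0)^* * u + z0^* * (u - u0).
  by rewrite conjB mulrBl mulrBr addrA subrK.
apply: (le_trans (cabsD _ _)); rewrite !cabsM !cabs_conj; apply: lerD.
  by rewrite ler_piMr ?cabs_ge0.
by rewrite ler_piMl ?cabs_ge0.
Qed.

Lemma corner_far a b l M : 0 < l -> 1 <= M -> 18 * M * l <= 1 ->
  `|b - a| = 2 * pi * M * l ->
  M * l / 4 <= cabs (1 - (corner a l)^* * corner b l) <= 18 * M * l.
Proof.
move=> l0 M1 Ml hd.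
have p4 : pi < 4 :> R by have := @pihalf_lt2 R; lra.
have p2 : 2 <= pi :> R by have := @pihalf_ge1 R; lra.
set t := b - a in hd; set d := 2 * pi * M * l in hd.
have Ml0 : l <= M * l by rewrite ler_peMl// ltW.
have l18 : 18 * l <= 1 by nra.
have E : (corner a l)^* * corner b l = ((1 - l) ^+ 2)%:C * expi t.
  rewrite /corner conjM conjR -expiN mulrACA -expiD [- a + b]addrC.
  by rewrite -(rmorphM (real_complex R)) expr2.
have d8 : d <= 8 * (M * l) by rewrite /d -mulrA ler_wpM2r//; nra.
have d4 : 4 * (M * l) <= d by rewrite /d -[leRHS]mulrA ler_wpM2r//; nra.
have dp : d <= pi / 2 by nra.
rewrite E; apply/andP; split.
  apply: le_trans (Im_le_cabs _).
  have -> : complex.Im (1 - ((1 - l) ^+ 2)%:C * expi t) = - ((1 - l) ^+ 2 * sin t).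
    by rewrite /= mul0r addr0 sub0r.
  rewrite normrN normrM ger0_norm ?sqr_ge0//.
  have st : `|sin t| = sin d.
    have sd : 0 <= sin d.
      apply: le_trans (sin_ge_quarter _); last by apply/andP; split => //; nra.
      by rewrite divr_ge0//; nra.
    have [t0|t0] := leP 0 t.
      by move: hd; rewrite ger0_norm// => ->; rewrite ger0_norm.
    move: hd; rewrite ltr0_norm// => hd.
    by rewrite -[t]opprK hd sinN normrN ger0_norm.
  rewrite st; have := @sin_ge_quarter R d; rewrite dp andbT => h.
  have {}h : d / 4 <= sin d by apply: h; nra.
  have q4 : 4^-1 <= (1 - l) ^+ 2 by nra.
  apply: (@le_trans _ _ (4^-1 * (d / 4))); first by lra.
  by apply: ler_pM => //; rewrite divr_ge0//; nra.
have -> : 1 - ((1 - l) ^+ 2)%:C * expi t =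
   (1 - (1 - l) ^+ 2)%:C + ((1 - l) ^+ 2)%:C * (expi 0 - expi t) :> R[i].
  by rewrite expi0 (rmorphB (real_complex R)) rmorph1 mulrBr mulr1 addrA subrK.
apply: (le_trans (cabsD _ _)); rewrite cabsM !cabs_real.
have s0 : 0 <= (1 - l) ^+ 2 by exact: sqr_ge0.
have s1 : (1 - l) ^+ 2 <= 1 by nra.
rewrite ger0_norm ?subr_ge0// ger0_norm//.
have := expi_dist 0 t; rewrite sub0r normrN hd => h.
have h3 : (1 - l) ^+ 2 * cabs (expi 0 - expi t) <= 2 * d.
  by apply: le_trans h; rewrite ler_piMl ?cabs_ge0.
nra.
Qed.

End Centers.

Section Necessity.
Context {R : realType}.
Variable om : {finite_measure set (measurableTypeR R) -> \bar R}.
Hypothesis hom : class_R om.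
Variables (B : R[i] -> R[i] -> R[i]) (g : R).
Variable nu : {measure set (measurableTypeR R) -> \bar R}.
Local Notation mu := (polar_measure om).
Local Notation W := (bmass om).
Hypothesis hB : is_bergman_kernel mu B.
Hypothesis g1 : 1 <= g.
Hypothesis nuD : (nu [set` `[0%R, 1%R]] < +oo)%E.
Hypothesis nuC : nu (~` [set` `[0%R, 1%R]]) = 0%E.
Hypothesis hK : forall z u, disc z -> disc u -> B z u = kernel nu g (z^* * u).
Local Notation Phi := (kernel_size nu g).
Variable p : R.
Hypothesis p1 : 1 < p.
Local Notation q := (conj_exp p).
Let md := @measurable_disc R.

Lemma kernel_gt0 w : cabs w < 1 -> 0 < cabs (kernel nu g w).
Proof.
move=> w1; have [c c0 hc] := kernel_size_ge_mass hom hB g1 nuD nuC hK.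
suff P : 0 < Phi (cabs (1 - w)).
  by have := kernel_ge nuD g w1; lra.
have P1 x : 0 < x -> x <= 1 -> 0 < Phi x.
  move=> x0 x1; have := lt_le_trans c0 (hc x x0 x1).
  by rewrite pmulr_lgt0// mulr_gt0// bmass_gt0.
have x0 : 0 < cabs (1 - w) by have := cabs_dist 1 w; rewrite cabs1; lra.
have [x1|x1] := leP (cabs (1 - w)) 1; first exact: P1.
have := lt_le_trans (P1 1 ltr01 (lexx 1)) (kernel_size_ge nuD g ltr01 (ltW x1)).
by rewrite divr1 pmulr_rgt0// powR_gt0.
Qed.

(** Translates of a square by a large multiple of its side are far enough for the
    kernel to be almost constant on the product of the two, and close enough for
    its value to remain of the order of the inverse mass. *)
Lemma far_squares (e : R) : 0 < e -> exists M l0 c : R,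
  [/\ 0 < M, 0 < l0 <= 1, 0 < c & forall a b l, 0 < l -> l <= l0 ->
    `|b - a| = 2 * pi * M * l -> exists w,
    near_point e (carleson a l) (carleson b l) w /\
    c <= cabs (kernel nu g w) * (l * W l)].
Proof.
move=> e0; have [c c0 hc] := kernel_size_ge_mass hom hB g1 nuD nuC hK.
(* each square lies within 17 l of its corner, and 4 * (17 + 17) = 136 *)
pose M := 136 / e + 1.
have Me : 136 <= e * M by rewrite /M mulrDr mulrCA mulfV ?gt_eqF// mulr1; lra.
have M1 : 1 <= M.
  have : 0 < 136 / e by apply: divr_gt0 => //; rewrite ltr0n.
  by rewrite /M; lra.
clearbody M; pose Y := 18 * M; have Y1 : 1 <= Y by rewrite /Y; lra.
have Y0 : 0 < Y by lra.
have Yg : 0 < Y `^ (g + 1) by rewrite powR_gt0.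
exists M, Y^-1, (c / (2 * Y `^ (g + 1))); split.
- exact: lt_le_trans M1.
- by rewrite invr_gt0 Y0 invf_le1.
- by rewrite divr_gt0// mulr_gt0.
move=> a b l l0; rewrite -(ler_pM2l Y0) mulfV ?gt_eqF// => lY hd.
have l1 : l <= 1 by nra.
have /andP[f1 f2] := corner_far l0 M1 lY hd.
have ca := cabs_corner a l1; have cb := cabs_corner b l1.
set w := (corner a l)^* * corner b l in f1 f2 *.
have w1 : cabs w < 1 by rewrite cabsM cabs_conj ca cb; nra.
exists w; split.
  split=> // z u Zz Eu.
  have u1 : cabs u <= 1 by have /discE/ltW := carleson_sub_disc l0 l1 Eu.
  apply: (le_trans (cabs_conjM_dist _ _ u1 _)); first by rewrite ca; lra.
  have hz := carleson_corner l0 l1 Zz; have hu := carleson_corner l0 l1 Eu.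
  apply: (@le_trans _ _ (34 * l)); first by move: hz hu; lra.
  apply: le_trans (ler_wpM2l (ltW e0) f1).
  have -> : e * (M * l / 4) = e * M * l / 4 by ring.
  by have := ler_wpM2r (ltW l0) Me; lra.
have x0 : 0 < cabs (1 - w) by have := cabs_dist 1 w; rewrite cabs1; lra.
have P1 := kernel_ge nuD g w1.
have P2 := kernel_size_le nuD g1 x0 f2.
have P3 := kernel_size_ge nuD g l0 (ltac:(nra) : l <= Y * l).
rewrite mulfK ?gt_eqF// in P3.
have x : 0 < l * W l by rewrite mulr_gt0// bmass_gt0.
rewrite ler_pdivrMr ?mulr_gt0//; apply: (le_trans (hc l l0 l1)).
have P4 : Phi l <= Y `^ (g + 1) * (2 * cabs (kernel nu g w)).
  apply: (le_trans P3); apply: ler_wpM2l; first exact: ltW.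
  exact: le_trans P2 P1.
have -> : cabs (kernel nu g w) * (l * W l) * (2 * Y `^ (g + 1)) =
   Y `^ (g + 1) * (2 * cabs (kernel nu g w)) * (l * W l) by ring.
by apply: ler_wpM2r P4; exact: ltW.
Qed.

Section Weight.
Variable v : R[i] -> R.
Hypothesis wv : is_weight mu v.
Hypothesis wb : weak_bounded mu (proj_kernel B) p v.

Lemma square_weight_gt0 a l : 0 < l -> l <= 1 -> 0 < \int[mu]_(z in carleson a l) v z.
Proof.
move=> l0 l1; have mS : measurable (carleson a l) by exact: measurable_carleson.
have Sd : carleson a l `<=` disc by exact: carleson_sub_disc.
have iS : mu.-integrable (carleson a l) (EFin \o v) by apply: integrableS wv.2.
rewrite fine_gt0//; apply/andP; split; last first.
  by rewrite ltey_eq integrable_fin_num.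
apply: integral_gt0 => //; last exact: carleson_mass_gt0.
  by apply: measurable_funS Sd (weight_measurable wv).
by move=> z /Sd; exact: wv.1.
Qed.

(** The disc is covered by finitely many small cells, each of which is tested
    against a small square on the opposite side of the disc: there |1 - z^* u|
    is bounded below, hence the kernel is almost constant. *)
Lemma weak_dual_integrable : mu.-integrable disc (EFin \o (fun z => dual_weight p q (v z))).
Proof.
have [C [C0 weak]] := wb; have [e' e'0 osc'] := kernel_osc nuD g1.
pose e := Num.min e' 1; have e0 : 0 < e by rewrite lt_min e'0 ltr01.
have e1 : e <= 1 by rewrite ge_min lexx orbT.
have osc w w0 : cabs w < 1 -> cabs w0 < 1 -> cabs (w - w0) <= e * cabs (1 - w0) ->
    cabs (kernel nu g w - kernel nu g w0) <= 2^-1 * cabs (kernel nu g w0).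
  move=> w1 w01 h; apply: osc' => //; apply: (le_trans h).
  by apply: ler_wpM2r; rewrite ?cabs_ge0// ge_min lexx.
clearbody e; set s := fun z => dual_weight p q (v z).
have ms : measurable_fun disc s.
  exact: measurable_powR_comp (weight_measurable wv).
have [N hN] : exists N : nat, 4 / e <= N.+1%:R.
  by exists (Num.truncn (4 / e)); exact/ltW/truncnS_gt.
have N0 : 0 < N.+1%:R :> R by rewrite ltr0n.
have Ne : N.+1%:R^-1 <= e / 4.
  by rewrite -[leRHS]invrK invf_div lef_pV2 ?posrE ?divr_gt0.
pose F (ij : 'I_(2 * N.+1) * 'I_(2 * N.+1)) : set R[i] := disc `&`
  [set z | ij.1%:R <= N.+1%:R * (complex.Re z + 1) <= ij.1.+1%:R /\
           ij.2%:R <= N.+1%:R * (complex.Im z + 1) <= ij.2.+1%:R].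
have mF ij : measurable (F ij).
  rewrite (_ : F ij = disc `&`
    ((setT `&` (fun z => N.+1%:R * (complex.Re z + 1)) @^-1` `[ij.1%:R, ij.1.+1%:R]) `&`
     (setT `&` (fun z => N.+1%:R * (complex.Im z + 1)) @^-1` `[ij.2%:R, ij.2.+1%:R]))).
    apply: measurableI => //; apply: measurableI.
      have mre : measurable_fun setT (fun z : R[i] => N.+1%:R * (complex.Re z + 1)).
        by apply: measurable_funM => //; apply: measurable_funD => //; exact: measurable_Re.
      by apply: mre => //; exact: measurable_itv.
    have mim : measurable_fun setT (fun z : R[i] => N.+1%:R * (complex.Im z + 1)).
      by apply: measurable_funM => //; apply: measurable_funD => //; exact: measurable_Im.
    by apply: mim => //; exact: measurable_itv.
  apply/seteqP; split => z /=; rewrite !in_itv/=.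
    by move=> [? [? ?]]; do ![split => //].
  by move=> [? [[_ ?] [_ ?]]]; do ![split => //].
have Fd ij : F ij `<=` disc by move=> z [].
apply: (@integrable_cover _ _ _ _ _ _ F) => // [z dz|ij].
  have hk (x : R) : `|x| < 1 -> exists k : 'I_(2 * N.+1),
      k%:R <= N.+1%:R * (x + 1) <= k.+1%:R.
    move=> x1; pose y := N.+1%:R * (x + 1).
    have y0 : 0 <= y by rewrite mulr_ge0//; move: x1; rewrite ltr_norml => /andP[]; lra.
    have y2 : y < 2 * N.+1%:R.
      by rewrite /y mulrC ltr_pM2r//; move: x1; rewrite ltr_norml => /andP[]; lra.
    have hy : (Num.truncn y < 2 * N.+1)%N.
      rewrite -(@ltr_nat R) natrM; apply: le_lt_trans y2.
      by have := truncn_le y; rewrite y0.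
    exists (Ordinal hy) => /=; rewrite -/y.
    by have := truncn_le y; rewrite y0 => -> /=; exact/ltW/truncnS_gt.
  have z1 : cabs z < 1 by exact/discE.
  have [i hi] := hk _ (le_lt_trans (Re_le_cabs z) z1).
  have [j hj] := hk _ (le_lt_trans (Im_le_cabs z) z1).
  by exists (i, j).
have [[u0 Fu0]|/forallNP F0] := pselect (exists u, F ij u); last first.
  rewrite (_ : F ij = set0); first exact: integrable_set0.
  by apply/seteqP; split => u // /F0.
have du0 := Fd _ _ Fu0; have u01 : cabs u0 < 1 by exact/discE.
(* the square and the cell contribute e / 2 each to the oscillation *)
pose l := e / 34; have l0 : 0 < l by rewrite divr_gt0// ltr0n.
have l34 : 34 * l = e by rewrite mulrC divfK// pnatr_eq0.
have l1 : l <= 1 by lra.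
have [a ha] : exists a : R, complex.Re ((corner a l)^* * u0) <= 0.
  have [r0|r0] := leP (complex.Re u0) 0.
    exists 0; rewrite /corner expi0 mulr1 conjR ReM /= mul0r subr0.
    by rewrite mulr_ge0_le0// subr_ge0.
  exists pi; rewrite /corner conjM conjR -expiN /expi cosN sinN cospi sinpi !ReM !ImM /=.
  rewrite !(mulr0, mul0r, oppr0, subr0, addr0, mulrN, mulr1, mulNr).
  by rewrite oppr_le0 mulr_ge0 ?subr_ge0// ltW.
pose w := (corner a l)^* * u0; pose Z := carleson a l.
have ca := cabs_corner a l1.
have w1 : cabs w < 1.
  by rewrite cabsM cabs_conj ca mulr_ilt1 ?cabs_ge0 ?subr_ge0//; lra.
have near : near_point e Z (F ij) w.
  split=> // z u Zz Fu.
  have u1 : cabs u <= 1 by have /discE/ltW := Fd _ _ Fu.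
  apply: (le_trans (cabs_conjM_dist _ _ u1 _)); first by rewrite ca; lra.
  have hz := carleson_corner l0 l1 Zz.
  have hu : cabs (u - u0) <= e / 2.
    case: Fu => _ /= [/andP[x1 x2] /andP[y1 y2]].
    case: Fu0 => _ /= [/andP[x1' x2'] /andP[y1' y2']].
    have h1 := cell_width N0 Ne x1 x2 x1' x2'; have h2 := cell_width N0 Ne y1 y2 y1' y2'.
    apply: (le_trans (cabs_le_ReIm _)).
    have -> : complex.Re (u - u0) = complex.Re u - complex.Re u0 by rewrite ReD; case: (u0).
    have -> : complex.Im (u - u0) = complex.Im u - complex.Im u0 by rewrite ImD; case: (u0).
    by apply: le_trans (lerD h1 h2) _; lra.
  apply: (@le_trans _ _ e); first by move: hz hu; lra.
  rewrite ler_peMr ?(ltW e0)//; apply: le_trans (le_trans (ler_norm _) (Re_le_cabs _)).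
  have -> : complex.Re (1 - w) = 1 - complex.Re w by rewrite ReD; case: (w).
  by rewrite lerDl oppr_ge0.
have mZ : measurable Z by exact: measurable_carleson.
have Zd : Z `<=` disc by exact: carleson_sub_disc.
have [] // := weak_test_dual hK p1 wv C0 weak osc mZ Zd (mF ij) (Fd ij) near
  (kernel_gt0 w1) (square_weight_gt0 a l0 l1).
Qed.

(** Large squares are controlled by the total masses. A small one is paired with
    a translate, and tested in both roles. *)
Lemma weak_bounded_bekolle : bekolle_class mu p v.
Proof.
have [C [C0 weak]] := wb; have [e e0 osc] := kernel_osc nuD g1.
have [M [l0 [c [M0 /andP[l00 l01] c0 far]]]] := far_squares e0.
have [c2 c20 hc2] := carleson_mass_ge hom.
have iS := weak_dual_integrable; have iV := wv.2.
have p10 : 0 < p - 1 by rewrite subr_gt0.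
set s := fun z => dual_weight p q (v z) in iS.
have v0 z : disc z -> 0 < v z by exact: wv.1.
have s0 z : disc z -> 0 < s z by move=> dz; rewrite dual_weight_gt0// v0.
pose VD := \int[mu]_(z in disc) v z; pose SD := \int[mu]_(z in disc) s z.
pose m0 := c2 * (l0 * W l0).
have m00 : 0 < m0 by rewrite !mulr_gt0// bmass_gt0.
(* [K1] is for the small squares, [K2] for the large ones *)
pose K1 := C ^+ 2 / ((c * c2 / 4) `^ p) ^+ 2.
pose K2 := VD / m0 * (SD / m0) `^ (p - 1).
have K10 : 0 <= K1 by rewrite divr_ge0 ?sqr_ge0.
have VD0 : 0 <= VD by apply: Rintegral_ge0 => z /v0/ltW.
have SD0 : 0 <= SD by apply: Rintegral_ge0 => z /s0/ltW.
have K20 : 0 <= K2 by rewrite mulr_ge0 ?powR_ge0// divr_ge0// ltW.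
suff bound : (bekolle mu p v <= (K1 + K2)%:E)%E by exact: le_lt_trans bound (ltry _).
apply: ge_ereal_sup => _ [_ [a [l [lp l1 ->]]] <-].
set S := carleson a l.
have mS b : measurable (carleson b l) by exact: measurable_carleson.
have Sd b : carleson b l `<=` disc by exact: carleson_sub_disc.
have iSS b : mu.-integrable (carleson b l) (EFin \o s) by apply: integrableS iS.
have iVS b : mu.-integrable (carleson b l) (EFin \o v) by apply: integrableS iV.
have muf b : mu (carleson b l) \is a fin_num by exact: fin_num_measure.
have mass b : c2 * (l * W l) <= fine (mu (carleson b l)).
  by rewrite -lee_fin fineK//; exact: hc2.
have x0 : 0 < l * W l by rewrite mulr_gt0// bmass_gt0.
have mu0 b : 0 < fine (mu (carleson b l)) by apply: lt_le_trans (mass b); rewrite mulr_gt0.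
have fV : (\int[mu]_(z in S) (v z)%:E)%E \is a fin_num.
  by apply: integrable_fin_num; [exact: mS|exact: iVS].
have fS : (\int[mu]_(z in S) (s z)%:E)%E \is a fin_num.
  by apply: integrable_fin_num; [exact: mS|exact: iSS].
have muE : mu S = (fine (mu S))%:E by rewrite fineK//; exact: muf.
suff H : ((\int[mu]_(z in S) (v z)%:E) / mu S *
    ((\int[mu]_(z in S) (s z)%:E) / mu S) `^ (p / q) <= (K1 + K2)%:E)%E by exact: H.
rewrite -(fineK fV) -(fineK fS) muE inver gt_eqF; last exact: mu0.
rewrite -/(Rintegral mu S v) -/(Rintegral mu S s).
rewrite conj_exp_div// -[((\int[mu]_(z in S) s z)%:E * _)%E]EFinM poweR_EFin -!EFinM lee_fin.
have S0 b : 0 <= \int[mu]_(z in carleson b l) s z by apply: Rintegral_ge0 => z /Sd/s0/ltW.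
have V0 b : 0 < \int[mu]_(z in carleson b l) v z by exact: square_weight_gt0.
rewrite ratio_powR//; [|exact: mu0|exact: S0].
have [ll|ll] := leP l l0; last first.
  apply: (@le_trans _ _ K2); last by rewrite lerDr.
  have ml : m0 <= fine (mu S).
    apply: le_trans (mass a); rewrite /m0 ler_wpM2l ?(ltW c20)//.
    by apply: ler_pM; rewrite ?(ltW l00) ?(ltW ll)//; [exact/ltW/bmass_gt0|exact/bmass_le/ltW].
  have VV : \int[mu]_(z in S) v z <= VD.
    apply: fine_le; [exact: fV|by apply: integrable_fin_num|].
    apply: ge0_subset_integral; [exact: mS|exact: md|exact: measurable_int iV| |exact: Sd].
    by move=> z dz; rewrite lee_fin ltW// v0.
  have SS : \int[mu]_(z in S) s z <= SD.
    apply: fine_le; [exact: fS|by apply: integrable_fin_num|].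
    apply: ge0_subset_integral; [exact: mS|exact: md|exact: measurable_int iS| |exact: Sd].
    by move=> z dz; rewrite lee_fin ltW// s0.
  rewrite /K2 ratio_powR//; have m1 := mu0 a.
  apply: ler_pM.
  - by rewrite mulr_ge0 ?powR_ge0// ltW// V0.
  - by rewrite invr_ge0 powR_ge0.
  - apply: ler_pM VV _; [exact: ltW (V0 a)|exact: powR_ge0|].
    by apply: ge0_ler_powR SS; rewrite ?nnegrE ?(ltW p10) ?S0.
  rewrite lef_pV2 ?posrE ?powR_gt0//.
  by apply: ge0_ler_powR ml; rewrite ?nnegrE ?ltW ?mu0//; lra.
apply: (@le_trans _ _ K1); last by rewrite lerDl.
pose b := a + 2 * pi * M * l; pose S' := carleson b l.
have Ml0 : 0 <= 2 * pi * M * l by rewrite !mulr_ge0 ?pi_ge0 ?ltW.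
have dab : `|b - a| = 2 * pi * M * l by rewrite /b addrAC subrr add0r ger0_norm.
have dba : `|a - b| = 2 * pi * M * l by rewrite distrC.
have [w1 [near1 k1]] := far a b l lp ll dab.
have [w2 [near2 k2]] := far b a l lp ll dba.
have tb := weak_test_dual hK p1 wv C0 weak osc (mS b) (Sd b) (mS a) (Sd a) near2
  (kernel_gt0 near2.1) (V0 b).
have ta := weak_test_mass hK p1 wv C0 weak osc (mS a) (Sd a) (mS b) (Sd b) near1.
exact: (two_squares p1 x0 c0 c20 C0 (S0 a) (V0 a) (V0 b) (mass a) (mass b) k1 k2 tb.2 ta).
Qed.

End Weight.
End Necessity.


(** * The equivalence and the norm estimate *)

Theorem theorem2 (R : realType) (p : R) (hp : 1 < p)
    (om : {finite_measure set (measurableTypeR R) -> \bar R}) (hom : class_R om)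
    (B : R[i] -> R[i] -> R[i])
    (hB : is_bergman_kernel (polar_measure om) B)
    (hrep : admits_representation B) :
  (forall v : R[i] -> R, is_weight (polar_measure om) v ->
    [/\ strong_bounded (polar_measure om) (max_proj_kernel B) p v <->
          strong_bounded (polar_measure om) (proj_kernel B) p v,
        strong_bounded (polar_measure om) (proj_kernel B) p v <->
          weak_bounded (polar_measure om) (proj_kernel B) p v &
        weak_bounded (polar_measure om) (proj_kernel B) p v <->
          bekolle_class (polar_measure om) p v]) /\
  (exists C : R, 0 < C /\
    forall v : R[i] -> R, is_weight (polar_measure om) v ->
      (op_norm (polar_measure om) (max_proj_kernel B) p v <=
        C%:E * poweR (bekolle (polar_measure om) p v)
                     (Num.max 1 (p - 1)^-1)%R)%E).
Proof.
have [g [nu [g1 nuD nuC hK]]] := representation_kernel hrep.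
have [m [m0 decay]] := bmass_decay hom.
have [c c0 hc] := topbox_mass hom m0 decay.
have [C C0 hC] := max_strong_bound hom hB g1 nuD nuC hK hp m0 c0 hc.
split=> [v wv|]; last first.
  exists C; split => // v wv; have e0 : 0 < Num.max 1 (p - 1)^-1 :> R by rewrite lt_max ltr01.
  (* an infinite constant makes the estimate trivial *)
  have [bv|] := ltP (bekolle (polar_measure om) p v) +oo%E; last first.
    rewrite leye_eq => /eqP ->; rewrite poweRyr ?gt_eqF// gt0_muley ?leey//.
  have bf : bekolle (polar_measure om) p v \is a fin_num.
    by rewrite ge0_fin_numE//; exact: bekolle_ge0.
  rewrite -(fineK bf) poweR_EFin -EFinM; apply: ereal_inf_lbound.
  by eexists; first exact: hC wv bv.
have h12 := max_bounded_proj_bounded nuD nuC hK hp wv.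
have h23 := strong_bounded_weak_bounded (L := proj_kernel B) hp wv.
have h34 := weak_bounded_bekolle hom hB g1 nuD nuC hK hp wv.
have h41 : bekolle_class (polar_measure om) p v ->
    strong_bounded (polar_measure om) (max_proj_kernel B) p v.
  by move=> bv; eexists; exact: hC wv bv.
split; split=> h.
- exact: h12.
- exact/h41/h34/h23.
- exact: h23.
- exact/h12/h41/h34.
- exact: h34.
- exact/h23/h12/h41.
Qed.
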